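(* (Boltzmann-Gibbs principle.) Assume that $d\le3$ and fix $0<\rho<1$. Let $(a_n)_{n\ge1}$ be positive numbers with $a_n\to\infty$ and $a_n\le\sqrt{\log n}$ for $n\ge2$. Let $\mu_n$ be a sequence of probability measures on $\Omega_n$ such that $H_n(\mu_n\,|\,\nu^n_\rho)\le R_d(n)$, where $R_1(n)=\sqrt{a_n}$, $R_2(n)=a_n\log n$, $R_3(n)=a_n\,n$. Then $$\lim_{n\to\infty}\mathbb E_{\mu_n}\Big[\,\Big|\int_0^t\frac1{\sqrt{a_nn^d}}\sum_{x\in\mathbb T^d_n}G(s,x/n)\,(\Pi_\rho f)(\tau_x\eta^n(s))\,ds\Big|\,\Big]=0$$ for all $t>0$, all functions $G$ in $C^{0,1}(\mathbb R_+\times\mathbb T^d)$, and all cylinder functions $f:\{0,1\}^{\mathbb Z^d}\to\mathbb R$, where $$(\Pi_\rho f)(\eta)=f(\eta)-\tilde f(\rho)-\tilde f'(\rho)(\eta_0-\rho).$$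
   Context: Model (voter model with stirring). $\mathbb T^d_n=(\mathbb Z/n\mathbb Z)^d$, $\Omega_n=\{0,1\}^{\mathbb T^d_n}$, $\eta=(\eta_x)_{x\in\mathbb T^d_n}$; $\|\cdot\|$ is the $\ell^1$ norm; $e_1,\dots,e_d$ is the canonical basis; $(\tau_x\eta)_z=\eta_{x+z}$; $\sigma^x\eta$ is $\eta$ with the value at $x$ replaced by $1-\eta_x$; $\sigma^{x,y}\eta$ is $\eta$ with the values at $x$ and $y$ exchanged. A cylinder function is a real function on $\{0,1\}^{\mathbb Z^d}$ depending on finitely many coordinates; it is evaluated at $\eta\in\Omega_n$ by identifying $\eta$ with its $n$-periodic extension, and $n\ge3$ is always taken large enough that the supports of the cylinder functions involved, together with $0$ and $e_j$, project injectively to $\mathbb T_n^d$. Fixed cylinder functions $c_j$, $1\le j\le d$, satisfy $c_j\ge\mathfrak c_0>0$, $c_j$ does not depend on $\eta_0,\eta_{e_j}$, and there are cylinder functions $h_{j,k}$ with $c_j(\eta)[\eta_{e_j}-\eta_0]=\sum_{k=1}^d\{h_{j,k}(\tau_{e_k}\eta)-h_{j,k}(\eta)\}$. Generators: $(L_n^Sf)(\eta)=\sum_{x}\sum_{j=1}^dc_j(\tau_x\eta)\{f(\sigma^{x,x+e_j}\eta)-f(\eta)\}$, $(L_n^Vf)(\eta)=\sum_x\sum_{y:\|y-x\|=1}(\eta_y-\eta_x)^2[f(\sigma^x\eta)-f(\eta)]$, $L_n=n^2L_n^S+a_nL_n^V$. $\eta^n(t)$ is the continuous-time Markov chain with generator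 $L_n$, $\mathbb E_{\mu_n}$ the expectation when it starts from $\mu_n$. $\nu^n_\rho$ is the Bernoulli product measure of density $\rho$ on $\Omega_n$; $H_n(\mu|\nu)=\int\log(d\mu/d\nu)\,d\mu$ is the relative entropy. For a cylinder function $f$, $\tilde f(\rho)=E_{\nu_\rho}[f]$ with $\nu_\rho$ the Bernoulli($\rho$) product measure on $\{0,1\}^{\mathbb Z^d}$; $\tilde f'$ is the derivative of this polynomial. $C^{0,1}(\mathbb R_+\times\mathbb T^d)$ is the set of continuous real functions on $\mathbb R_+\times\mathbb T^d$ with one continuous derivative in space. *)

(* Defs.v *)
From HB Require Import structures.
From mathcomp Require Import all_boot all_order all_algebra all_fingroup finmap.
From mathcomp Require Import all_classical all_reals all_analysis.

Set Implicit Arguments.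
Unset Strict Implicit.
Unset Printing Implicit Defensive.

Import Order.TTheory GRing.Theory Num.Theory.
Import numFieldNormedType.Exports.

Local Open Scope classical_set_scope.
Local Open Scope ring_scope.

Notation lattice d := 'rV[int]_d.
Notation torus d n := 'rV['Z_n]_d.

Definition zconfig (d : nat) := lattice d -> bool.

Definition config (d n : nat) := {ffun torus d n -> bool}.

(** Unit vectors e_j, in Z^d, (Z/nZ)^d and R^d alike. *)
Definition unit_vec (V : pzRingType) (d : nat) (j : 'I_d) : 'rV[V]_d := delta_mx 0 j.

Definition zshift (d : nat) (x : lattice d) (eta : zconfig d) : zconfig d :=
  fun z => eta (x + z).

Definition tshift (d n : nat) (x : torus d n) (eta : config d n) : config d n :=
  [ffun z => eta (x + z)].

Definition flip_at (d n : nat) (x : torus d n) (eta : config d n) : config d n :=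
  [ffun z => if z == x then ~~ eta x else eta z].

Definition exchange_at (d n : nat) (x y : torus d n) (eta : config d n) : config d n :=
  [ffun z => eta (tperm x y z)].

Definition proj_torus (d n : nat) (z : lattice d) : torus d n :=
  map_mx (fun k : int => k%:~R) z.

Definition periodic_ext (d n : nat) (eta : config d n) : zconfig d :=
  fun z => eta (proj_torus n z).

(** The l^1 distance to 0 in (Z/nZ)^d, meaningful for 2 <= n (for smaller n,
    'Z_n is Z/2Z): each coordinate contributes its distance to nZ. *)
Definition torus_norm (d n : nat) (z : torus d n) : nat :=
  (\sum_(j < d) minn (z 0%R j) (n - z 0%R j))%N.

(** The support carried by the record need not be minimal. *)
Record cylinder (d : nat) (R : realType) := Cylinder {
  cyl_fun :> zconfig d -> R ;
  cyl_supp : {fset lattice d} ;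
  cyl_suppP : forall eta xi : zconfig d,
    (forall z, z \in cyl_supp -> eta z = xi z) -> cyl_fun eta = cyl_fun xi }.

Definition independent_of (d : nat) (R : realType) (f : zconfig d -> R)
    (z0 : lattice d) :=
  forall eta xi : zconfig d, (forall z, z != z0 -> eta z = xi z) -> f eta = f xi.

Definition gradient_condition (d : nat) (R : realType)
    (c : 'I_d -> cylinder d R) (h : 'I_d -> 'I_d -> cylinder d R) :=
  forall (j : 'I_d) (eta : zconfig d),
    c j eta * ((eta (unit_vec _ j))%:R - (eta 0)%:R) =
    \sum_(k < d) (h j k (zshift (unit_vec _ k) eta) - h j k eta).

Section Generators.
Variables (d n : nat) (R : realType).
Implicit Types (c : 'I_d -> cylinder d R) (f : config d n -> R).

Definition gen_stirring c f : config d n -> R := fun eta =>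
  \sum_(x : torus d n) \sum_(j < d)
    c j (periodic_ext (tshift x eta)) *
    (f (exchange_at x (x + unit_vec _ j) eta) - f eta).

Definition gen_voter f : config d n -> R := fun eta =>
  \sum_(x : torus d n) \sum_(y : torus d n | torus_norm (y - x) == 1%N)
    ((eta y)%:R - (eta x)%:R) ^+ 2 * (f (flip_at x eta) - f eta).

Definition stirring_voter_gen c (a : R) f : config d n -> R := fun eta =>
  n%:R ^+ 2 * gen_stirring c f eta + a * gen_voter f eta.

End Generators.

(** Probability measures on a finite set, given by their mass functions. *)
Definition is_pmf (S : finType) (R : realType) (mu : S -> R) :=
  (forall x, 0 <= mu x) /\ \sum_x mu x = 1.

Definition bernoulli_weight (R : realType) (rho : R) (b : bool) : R :=
  if b then rho else 1 - rho.

Definition bernoulli_prod (I : finType) (R : realType) (rho : R)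
    (eta : {ffun I -> bool}) : R :=
  \prod_(x : I) bernoulli_weight rho (eta x).

(** Relative entropy, for nu charging every point (so that mu << nu always);
    the convention 0 log 0 = 0 is built in, as [ln 0 = 0]. *)
Definition rel_entropy (S : finType) (R : realType) (mu nu : S -> R) : R :=
  \sum_x mu x * ln (mu x / nu x).

Definition extend_false (d : nat) (A : {fset lattice d}) (xi : {ffun A -> bool}) :
    zconfig d :=
  fun z => if insub z is Some u then xi u else false.

(** E_{nu_rho}[f] for the product measure nu_rho on {0,1}^(Z^d): since f only
    reads the sites of its support, this is an integral against the finite
    marginal of nu_rho there. *)
Definition bernoulli_mean (d : nat) (R : realType) (f : cylinder d R) (rho : R) : R :=
  \sum_(xi : {ffun cyl_supp f -> bool}) bernoulli_prod rho xi * f (extend_false xi).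

Definition Pi_rho (d : nat) (R : realType) (rho : R) (f : cylinder d R) : zconfig d -> R :=
  fun eta => f eta - bernoulli_mean f rho
             - derive1 (bernoulli_mean f) rho * ((eta 0)%:R - rho).

(** The operator exp(t L) on the functions over a finite set. *)
Definition semigroup (S : finType) (R : realType) (L : (S -> R) -> (S -> R))
    (t : R) (f : S -> R) : S -> R :=
  fun x => limn (series (fun k => t ^+ k / k`!%:R * iter k L f x)).

(** [X] is, on the probability space [(T, P)], a continuous-time Markov chain
    with generator [L] and initial law [mu]: its paths are cadlag for the
    discrete topology of [S], and its finite-dimensional distributions are given
    by the transition function exp(t L).  Only times t >= 0 matter. *)
Record markov_chain (S : finType) (R : realType) (L : (S -> R) -> (S -> R))
    (mu : S -> R) (dsp : measure_display) (T : measurableType dsp)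
    (P : probability T R) (X : R -> T -> S) : Prop := MarkovChain {
  mc_measurable : forall (t : R) (x : S), 0 <= t ->
    measurable [set w | X t w = x] ;
  mc_right_continuous : forall (w : T) (t : R), 0 <= t ->
    \forall s \near t^'+, X s w = X t w ;
  mc_left_limit : forall (w : T) (t : R), 0 < t ->
    exists x : S, \forall s \near t^'-, X s w = x ;
  mc_finite_dim : forall (k : nat) (t : nat -> R) (x : nat -> S),
    t 0%N = 0 -> (forall i, (i < k)%N -> t i <= t i.+1) ->
    P [set w | forall i, (i <= k)%N -> X (t i) w = x i] =
    (mu (x 0%N) * \prod_(0 <= i < k)
       semigroup L (t i.+1 - t i) (fun y => (y == x i.+1)%:R) (x i))%:E }.

(** The point x / n of the macroscopic torus. *)
Definition macro (d n : nat) (R : realType) (x : torus d n) : 'rV[R]_d :=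
  map_mx (fun k : 'Z_n => (k : nat)%:R / n%:R) x.

Definition space_deriv (d : nat) (R : realType) (j : 'I_d)
    (G : R -> 'rV[R]_d -> R) (s : R) (u : 'rV[R]_d) : R :=
  derive1 (fun h : R => G s (u + h *: unit_vec _ j)) 0.

(** The class C^{0,1}(R_+ x T^d), functions on the torus T^d = (R/Z)^d being
    Z^d-periodic functions on R^d. *)
Record C01 (d : nat) (R : realType) (G : R -> 'rV[R]_d -> R) : Prop := MkC01 {
  C01_periodic : forall (s : R) (u : 'rV[R]_d) (j : 'I_d), 0 <= s ->
    G s (u + unit_vec _ j) = G s u ;
  C01_continuous :
    {within [set p : R * 'rV[R]_d | 0 <= p.1], continuous (fun p => G p.1 p.2)} ;
  C01_derivable : forall (s : R) (u : 'rV[R]_d) (j : 'I_d), 0 <= s ->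
    derivable (fun h : R => G s (u + h *: unit_vec _ j)) 0 1 ;
  C01_deriv_continuous : forall j : 'I_d,
    {within [set p : R * 'rV[R]_d | 0 <= p.1],
      continuous (fun p => space_deriv j G p.1 p.2)} }.

Definition entropy_bound (R : realType) (d n : nat) (a : R) : R :=
  match d with
  | 1%N => Num.sqrt a
  | 2%N => a * ln n%:R
  | _ => a * n%:R
  end.

(** 1 / sqrt(a n^d) * sum_x G(s, x/n) (Pi_rho f)(tau_x eta). *)
Definition fluctuation (d n : nat) (R : realType) (a rho : R)
    (G : R -> 'rV[R]_d -> R) (f : cylinder d R) (s : R) (eta : config d n) : R :=
  (Num.sqrt (a * n%:R ^+ d))^-1 *
  \sum_(x : torus d n) G s (macro R x) * Pi_rho rho f (periodic_ext (tshift x eta)).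

(* Main.v *)
(** Write [w_x = eta_x - rho] and let [nu] be the Bernoulli measure. In Walsh
    products, [Pi_rho f] is a combination of products of at least two distinct
    [w]'s and of differences [w_z - w_0]. For a density [u^2], differences are
    handled by one integration by parts along exchanges. In a product, the
    spins are replaced by averages over blocks of side [q^2] and [q^5], with
    [q ~ n^(1/9)]: each replacement costs some stirring Dirichlet form [D u], and
    squares of block averages are controlled by the entropy inequality. Hence,
    for [th >= 1],
      [E_nu (sum_x G_x w_(x+A) u^2) <= n^2 D u / th + C (H (u^2) + th q^E)]
    where [q^E << n^(d/2)] because [d <= 3]. Since [nu] is not invariant for the
    voter dynamics, the energy of [L_n] contains the potential
    [a_n sum_(|x-y|=1) w_x w_y]; it has the same form, and the same bound with
    [th ~ a_n] absorbs it in the stirring energy.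

    For the Euler discretisation of the chain, let a path law be tilted by a
    density [Y] with values in [[1/3, 3]], and let [v_i] be the square root of
    the density of its i-th marginal. Gibbs' variational inequality against the
    martingale [prod_i v_(i+1) (x_(i+1)) / (ph v_(i+1)) (x_i)] bounds the entropy
    at time [i] plus the time-summed energies of the [v_j] by the initial
    entropy and a constant. With the static bound and Gronwall's lemma this
    controls the tilted expectation of the additive functional [X], and
    [Y ~ 2 + sgn X] turns it into a bound on the expectation of [|X|]. The result
    is [C exp (C a_n) q^(-1/2)], which vanishes as [a_n <= sqrt (ln n)]. *)
Require Import Defs.
From HB Require Import structures.
From mathcomp Require Import all_boot all_order all_algebra all_fingroup finmap.
From mathcomp Require Import all_classical all_reals all_analysis.
From mathcomp Require Import measurable_realfun ring lra zify.

Set Implicit Arguments.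
Unset Strict Implicit.
Unset Printing Implicit Defensive.

Import Order.TTheory GRing.Theory Num.Theory.
Import numFieldNormedType.Exports.

Local Open Scope classical_set_scope.
Local Open Scope ring_scope.

(** * Bernoulli expectations and exchanges *)

(** The obstacle is that the absolute value stands outside the time integral: its sign depends on
    the whole path, and a law tilted by that sign is not Markov, so its entropy cannot be
    differentiated along a forward equation. The variational inequality on path space replaces that
    computation, and a tilt with values in [1/3, 3] costs it only a constant. Discretising time
    makes the set of paths finite.

    The static error must be small compared with n^(d/2). With small blocks of side m and large
    blocks of side L, the errors are of order m^2 n^(d-2), L^2 n^(d-2) m^(-d) and n^d L^(-d). A
    single scale m = L would need both L << n^(1-d/4) and L >> n^(1/2), which is impossible from d =
    2 on. Two scales reach d = 3, and the first error alone excludes d = 4. The sides q^2 and q^5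
    with q of order n^(1/9) serve the three dimensions at once. *)

Section BernoulliExpectation.
Variables (R : realType) (I : finType) (rho : R).
Hypothesis rho01 : 0 < rho < 1.
Local Notation cfg := {ffun I -> bool}.
Local Notation nu := (@bernoulli_prod I R rho).
Implicit Types (x y z : I) (eta : cfg) (f g u : cfg -> R).

Definition flip x eta : cfg := [ffun z => if z == x then ~~ eta x else eta z].

Definition swap x y eta : cfg := [ffun z => eta (tperm x y z)].

Definition centered eta x : R := (eta x)%:R - rho.

Definition mean f : R := \sum_eta nu eta * f eta.

Lemma bernoulli_weight_gt0 b : 0 < bernoulli_weight rho b.
Proof. by case/andP: rho01 => ? ?; case: b => /=; lra. Qed.

Lemma bernoulli_prod_gt0 eta : 0 < nu eta.
Proof. by apply: prodr_gt0 => x _; exact: bernoulli_weight_gt0. Qed.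

Lemma bernoulli_prod_ge0 eta : 0 <= nu eta.
Proof. exact/ltW/bernoulli_prod_gt0. Qed.

Lemma eq_mean f g : f =1 g -> mean f = mean g.
Proof. by move=> fg; apply: eq_bigr => eta _; rewrite fg. Qed.

Lemma le_mean f g : (forall eta, f eta <= g eta) -> mean f <= mean g.
Proof.
by move=> fg; apply: ler_sum => eta _; rewrite ler_pM2l// bernoulli_prod_gt0.
Qed.

Lemma mean_ge0 f : (forall eta, 0 <= f eta) -> 0 <= mean f.
Proof. by move=> f0; apply: sumr_ge0 => eta _; rewrite mulr_ge0// bernoulli_prod_ge0. Qed.

Lemma meanD f g : mean (fun eta => f eta + g eta) = mean f + mean g.
Proof. by rewrite /mean -big_split/=; apply: eq_bigr => eta _; rewrite mulrDr. Qed.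

Lemma meanZ (k : R) f : mean (fun eta => k * f eta) = k * mean f.
Proof. by rewrite /mean mulr_sumr; apply: eq_bigr => eta _; rewrite mulrCA. Qed.

Lemma meanN f : mean (fun eta => - f eta) = - mean f.
Proof. by rewrite /mean -sumrN; apply: eq_bigr => eta _; rewrite mulrN. Qed.

Lemma meanB f g : mean (fun eta => f eta - g eta) = mean f - mean g.
Proof. by rewrite meanD meanN. Qed.

Lemma mean_sum (J : Type) (r : seq J) (P : pred J) (F : J -> cfg -> R) :
  mean (fun eta => \sum_(j <- r | P j) F j eta) = \sum_(j <- r | P j) mean (F j).
Proof.
by rewrite /mean exchange_big/=; apply: eq_bigr => eta _; rewrite mulr_sumr.
Qed.

Lemma sum_bernoulli_prod : \sum_eta nu eta = 1.
Proof.
rewrite /bernoulli_prod -(bigA_distr_bigA (fun (_ : I) b => bernoulli_weight rho b))/=.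
by rewrite big1// => x _; rewrite big_bool/= addrC subrK.
Qed.

Lemma mean_cst (k : R) : mean (fun=> k) = k.
Proof. by rewrite /mean -mulr_suml sum_bernoulli_prod mul1r. Qed.

Lemma flipK x : involutive (flip x).
Proof.
move=> eta; apply/ffunP => z; rewrite !ffunE eqxx negbK.
by case: eqP => [->|].
Qed.

Lemma swapK x y : involutive (swap x y).
Proof. by move=> eta; apply/ffunP => z; rewrite !ffunE tpermK. Qed.

Lemma bernoulli_prod_flip x eta :
  nu (flip x eta) * bernoulli_weight rho (eta x) =
  nu eta * bernoulli_weight rho (~~ eta x).
Proof.
rewrite /bernoulli_prod (bigD1 x)//= [in RHS](bigD1 x)//= ffunE eqxx.
rewrite mulrC mulrA [in RHS]mulrAC; congr (_ * _).
by apply: eq_bigr => z /negbTE zx; rewrite ffunE zx.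
Qed.

Lemma bernoulli_prod_swap x y eta : nu (swap x y eta) = nu eta.
Proof.
rewrite /bernoulli_prod [RHS](reindex_inj (@perm_inj _ (tperm x y)))/=.
by apply: eq_bigr => z _; rewrite ffunE.
Qed.

Lemma mean_swap x y f : mean (fun eta => f (swap x y eta)) = mean f.
Proof.
rewrite /mean [RHS](reindex_inj (inv_inj (swapK x y)))/=.
by apply: eq_bigr => eta _; rewrite bernoulli_prod_swap.
Qed.

Lemma mean_flip x f : mean (fun eta => bernoulli_weight rho (~~ eta x) * f (flip x eta)) =
  mean (fun eta => bernoulli_weight rho (~~ eta x) * f eta).
Proof.
rewrite /mean [LHS](reindex_inj (inv_inj (flipK x)))/=.
apply: eq_bigr => eta _; rewrite flipK ffunE eqxx negbK mulrA.
by rewrite bernoulli_prod_flip mulrA.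
Qed.

(** The conditional expectation of [f] given the spins off [x]; it allows the spins to be integrated
    out one at a time. *)
Definition resample x f eta : R :=
  bernoulli_weight rho (eta x) * f eta + bernoulli_weight rho (~~ eta x) * f (flip x eta).

Lemma mean_resample x f : mean (resample x f) = mean f.
Proof.
rewrite meanD mean_flip -meanD; apply: eq_mean => eta.
by case: (eta x) => /=; ring.
Qed.

(** Moving [flip x] onto the measure turns the gain term into a weight on agreeing pairs,
    [(1 - rho) / rho] on two occupied sites and its inverse on two empty ones, while the loss term
    is [-1] on disagreeing pairs. These are the values of [w_x w_y / (rho (1 - rho))] for the
    centered spins [w]. No term of degree one appears, so the potential is of the kind that block
    replacement handles. *)
Lemma voter_adjoint x y f : x != y ->
  mean (fun eta => ((eta y)%:R - (eta x)%:R) ^+ 2 * (f (flip x eta) - f eta)) =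
  (rho * (1 - rho))^-1 * mean (fun eta => centered eta x * centered eta y * f eta).
Proof.
move=> xy; have [/andP[r0 r1]] : (0 < rho < 1) by [].
rewrite -meanZ.
under eq_mean do rewrite mulrBr.
rewrite meanB.
have -> : mean (fun eta => ((eta y)%:R - (eta x)%:R) ^+ 2 * f (flip x eta)) =
  mean (fun eta => bernoulli_weight rho (~~ eta x) *
    ((bernoulli_weight rho (eta x))^-1 * ((eta y)%:R - (~~ eta x)%:R) ^+ 2 * f eta)).
  rewrite -(mean_flip x (fun eta => (bernoulli_weight rho (eta x))^-1 *
     ((eta y)%:R - (~~ eta x)%:R) ^+ 2 * f eta)).
  apply: eq_mean => eta; rewrite !ffunE eqxx negbK eq_sym (negbTE xy).
  by rewrite !mulrA divff ?mul1r// gt_eqF// bernoulli_weight_gt0.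
rewrite -meanB; apply: eq_mean => eta.
by rewrite /centered; case: (eta x); case: (eta y) => /=; field; lra.
Qed.

End BernoulliExpectation.

Section Exchanges.
Variables (R : realType) (I : finType) (rho : R).
Hypothesis rho01 : 0 < rho < 1.
Local Notation cfg := {ffun I -> bool}.
Local Notation mean := (@mean R I rho).
Implicit Types (x y z : I) (eta : cfg) (f g u : cfg -> R).

Definition hop x y u : R := mean (fun eta => (u (swap x y eta) - u eta) ^+ 2).

Lemma hop_ge0 x y u : 0 <= hop x y u.
Proof. by apply: mean_ge0 => // eta; exact: sqr_ge0. Qed.

Lemma hopC x y u : hop x y u = hop y x u.
Proof. by apply: eq_bigr => eta _; rewrite /swap tpermC. Qed.

Lemma hopxx x u : hop x x u = 0.
Proof.
rewrite /hop -[RHS](mean_cst I rho 0); apply: eq_mean => eta.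
suff -> : swap x x eta = eta by rewrite subrr expr0n.
by apply/ffunP => z; rewrite ffunE tperm1 perm1.
Qed.

Lemma swap_conj x y z eta : x != z -> y != z ->
  swap x y (swap y z (swap x y eta)) = swap x z eta.
Proof.
move=> xz yz; apply/ffunP => t; rewrite !ffunE; congr (eta _).
have -> : tperm x z = ((tperm y z) ^ (tperm x y))%g.
  by rewrite tpermJ tpermR tpermD.
by rewrite conjgE !permM tpermV.
Qed.

(** By [swap_conj] the exchange of [x] and [z] is made of two exchanges across [x, y] and one across
    [y, z]; Cauchy-Schwarz is applied with weights 1 and [k]. The weight stays free because
    [far_form_path] takes for [k] the length of the remaining path. *)
Lemma hop_triangle (k : R) x y z u : 0 < k ->
  hop x z u <= (1 + k) * (4 * hop x y u + hop y z u / k).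
Proof.
move=> k0; have k10 : 0 <= 1 + k by lra.
have h0 := hop_ge0.
have [->|xz] := eqVneq x z.
  by rewrite hopxx; apply: mulr_ge0 => //; apply: addr_ge0; apply: mulr_ge0 => //; rewrite ?invr_ge0 ltW.
have [<-|yz] := eqVneq y z.
  by rewrite hopxx mul0r addr0; have := h0 x y u; nra.
pose A eta := u (swap x y eta) - u eta.
pose B eta := u (swap y z eta) - u eta.
have pt eta : (u (swap x z eta) - u eta) ^+ 2 <=
    (1 + k) * (2 * A (swap y z (swap x y eta)) ^+ 2 + 2 * A eta ^+ 2
      + k^-1 * B (swap x y eta) ^+ 2).
  rewrite -(swap_conj _ xz yz).
  have -> : u (swap x y (swap y z (swap x y eta))) - u eta =
    A (swap y z (swap x y eta)) + A eta + B (swap x y eta).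
    by rewrite /A /B; ring.
  move: (A (swap y z _)) (A eta) (B _) => a a' b.
  rewrite -subr_ge0.
  have -> : (1 + k) * (2 * a ^+ 2 + 2 * a' ^+ 2 + k^-1 * b ^+ 2) - (a + a' + b) ^+ 2
    = (1 + k) * (a - a') ^+ 2 + k^-1 * (k * (a + a') - b) ^+ 2.
    by field; lra.
  by rewrite addr_ge0// mulr_ge0 ?sqr_ge0// invr_ge0 ltW.
apply: (le_trans (le_mean rho01 pt)).
rewrite meanZ !meanD !meanZ.
rewrite (mean_swap rho x y (fun eta => A (swap y z eta) ^+ 2)).
rewrite (mean_swap rho y z (fun eta => A eta ^+ 2)).
rewrite (mean_swap rho x y (fun eta => B eta ^+ 2)).
rewrite -/(hop x y u) -/(hop y z u) (mulrC (hop y z u)).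
by rewrite ler_wpM2l// lerD2r; lra.
Qed.

Lemma mean_sub_swap x y F u : (forall eta, F (swap x y eta) = F eta) ->
  mean (fun eta => F eta * (u (swap x y eta) - u eta) * u eta) =
  - (mean (fun eta => F eta * (u (swap x y eta) - u eta) ^+ 2) / 2).
Proof.
move=> HF.
suff : mean (fun eta => F eta * (u (swap x y eta) - u eta) * u eta) *+ 2 =
   - mean (fun eta => F eta * (u (swap x y eta) - u eta) ^+ 2).
  by rewrite mulr2n; lra.
rewrite mulr2n -{1}(mean_swap rho x y) -meanD -meanN.
by apply: eq_mean => eta; rewrite HF swapK; ring.
Qed.

Lemma centered_swapl x y eta : centered rho (swap x y eta) x = centered rho eta y.
Proof. by rewrite /centered ffunE tpermL. Qed.

Lemma centered_swapr x y eta : centered rho (swap x y eta) y = centered rho eta x.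
Proof. by rewrite /centered ffunE tpermR. Qed.

Lemma centered_swapD x y z eta : z != x -> z != y ->
  centered rho (swap x y eta) z = centered rho eta z.
Proof. by move=> zx zy; rewrite /centered ffunE tpermD// eq_sym. Qed.

Lemma centered_norm eta x : `|centered rho eta x| <= 1.
Proof. by case/andP: rho01 => ? ?; rewrite /centered ler_norml; case: (eta x) => /=; lra. Qed.

(** [F] is even and the difference of spins is odd under the exchange, so [u ^+ 2] may be replaced
    by half of its increment, a difference times a sum. Young's inequality charges the difference to
    [hop] and the sum to [F ^+ 2 * u ^+ 2]. *)
Lemma exchange_by_parts (k : R) x y F u : 0 < k ->
  (forall eta, F (swap x y eta) = F eta) ->
  mean (fun eta => F eta * (centered rho eta x - centered rho eta y) * u eta ^+ 2)
  <= k * hop x y u + (4 * k)^-1 * mean (fun eta => F eta ^+ 2 * u eta ^+ 2).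
Proof.
move=> k0 HF.
pose W eta := centered rho eta x - centered rho eta y.
have pt eta : F eta * W eta * (u eta ^+ 2 - u (swap x y eta) ^+ 2) <=
    2 * k * (u (swap x y eta) - u eta) ^+ 2 +
    (4 * k)^-1 * (F eta ^+ 2 * u eta ^+ 2 + F eta ^+ 2 * u (swap x y eta) ^+ 2).
  have W1 : W eta ^+ 2 <= 1.
    by rewrite /W /centered; case: (eta x); case: (eta y) => /=; nra.
  move: (F eta) (W eta) W1 (u (swap _ _ _)) (u eta) => f w w1 b a.
  rewrite -subr_ge0.
  have -> : 2 * k * (b - a) ^+ 2 + (4 * k)^-1 * (f ^+ 2 * a ^+ 2 + f ^+ 2 * b ^+ 2) -
    f * w * (a ^+ 2 - b ^+ 2) =
    2 * k * (b - a + f * w * (a + b) / (4 * k)) ^+ 2 +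
    (8 * k)^-1 * f ^+ 2 * ((1 - w ^+ 2) * (a + b) ^+ 2 + (a - b) ^+ 2).
    by field; lra.
  rewrite addr_ge0//; first by rewrite mulr_ge0 ?sqr_ge0; lra.
  apply: mulr_ge0; first by apply: mulr_ge0; rewrite ?sqr_ge0 ?invr_ge0//; lra.
  apply: addr_ge0; rewrite ?sqr_ge0//; apply: mulr_ge0; rewrite ?sqr_ge0//; lra.
have -> : mean (fun eta => F eta * W eta * u eta ^+ 2) =
    mean (fun eta => F eta * W eta * (u eta ^+ 2 - u (swap x y eta) ^+ 2)) / 2.
  suff : mean (fun eta => F eta * W eta * u eta ^+ 2) *+ 2 =
     mean (fun eta => F eta * W eta * (u eta ^+ 2 - u (swap x y eta) ^+ 2)).
    by rewrite mulr2n; lra.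
  rewrite mulr2n -{1}(mean_swap rho x y) -meanD.
  apply: eq_mean => eta; rewrite HF /W centered_swapl centered_swapr; ring.
have -> : mean (fun eta => F eta ^+ 2 * u eta ^+ 2) =
  mean (fun eta => F eta ^+ 2 * u eta ^+ 2 + F eta ^+ 2 * u (swap x y eta) ^+ 2) / 2.
  have E := mean_swap rho x y (fun eta => F eta ^+ 2 * u eta ^+ 2).
  have {}E : mean (fun eta => F eta ^+ 2 * u (swap x y eta) ^+ 2) =
     mean (fun eta => F eta ^+ 2 * u eta ^+ 2).
    by rewrite -E; apply: eq_mean => eta; rewrite HF.
  by rewrite meanD E; lra.
have := le_mean rho01 pt; rewrite meanD 2!meanZ -/(hop x y u).
move: (mean _) (mean _) => ? ?; lra.
Qed.

End Exchanges.

(** * Moving a particle along a path *)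

Section MovingParticle.
Variables (R : realType) (T : finZmodType) (rho : R).
Hypothesis rho01 : 0 < rho < 1.
Variables (J : finType) (e : J -> T).
Local Notation cfg := {ffun T -> bool}.
Local Notation mean := (@mean R T rho).
Local Notation hop := (@hop R T rho).
Implicit Types (x y z : T) (eta : cfg) (u : cfg -> R).

Definition exchange_form u : R := \sum_x \sum_j hop x (x + e j) u.

Definition far_form y u : R := \sum_x hop x (x + y) u.

Lemma far_form_step j u : far_form (e j) u <= exchange_form u.
Proof.
apply: ler_sum => x _; rewrite (bigD1 j)//= lerDl.
by apply: sumr_ge0 => i _; exact: hop_ge0.
Qed.

Lemma far_formN y u : far_form (- y) u = far_form y u.
Proof.
rewrite /far_form (reindex_inj (addIr y))/=; apply: eq_bigr => x _.
by rewrite addrK hopC.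
Qed.

(** Summed over all starting points, the tail of the path is a translate and costs its own
    [far_form]. With [k] the length of the tail, [(1 + k) (4 + 4 k^2 / k) = 4 (1 + k)^2], so the
    cost is quadratic in the length. Steps are constrained only by their cost because both signs of
    the unit vectors occur. *)
Lemma far_form_path (s : seq T) u :
  (forall y, y \in s -> far_form y u <= exchange_form u) ->
  far_form (\sum_(y <- s) y) u <= 4 * (size s)%:R ^+ 2 * exchange_form u.
Proof.
elim: s => [|y s IH] Hs.
  rewrite big_nil /far_form big1 ?mulr0n ?expr0n ?mulr0 ?mul0r//.
  by move=> x _; rewrite addr0 hopxx.
have G0 : 0 <= exchange_form u.
  by apply: sumr_ge0 => x _; apply: sumr_ge0 => j _; exact: hop_ge0.
rewrite big_cons; have [s0|s0] := posnP (size s).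
  move/size0nil: s0 => ->; rewrite big_nil addr0 /=.
  apply: (le_trans (Hs _ (mem_head _ _))); lra.
pose k : R := (size s)%:R; have k0 : 0 < k by rewrite ltr0n.
have {}IH := IH (fun z zs => Hs z (mem_behead (s := y :: s) zs)).
have Hy := Hs _ (mem_head _ _).
apply: (@le_trans _ _ ((1 + k) * (4 * far_form y u + far_form (\sum_(z <- s) z) u / k))).
  rewrite /far_form mulr_sumr [X in _ * (_ + X)]mulr_suml.
  rewrite [X in _ * (_ + X)](reindex_inj (addIr y))/= -big_split/= mulr_sumr.
  apply: ler_sum => x _; rewrite addrA.
  exact: hop_triangle.
have -> : (size (y :: s))%:R = k + 1 :> R by rewrite /k -natr1.
apply: (@le_trans _ _ ((1 + k) * (4 * exchange_form u + (4 * k ^+ 2 * exchange_form u) / k))).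
  apply: ler_wpM2l; first by rewrite addr_ge0// ltW.
  by rewrite lerD// ?ler_pM2l// ler_pM2r// invr_gt0.
rewrite le_eqVlt; apply/orP; left; apply/eqP; field; lra.
Qed.

End MovingParticle.

(** * Entropy inequalities *)

Lemma expR_le_quadratic (R : realType) (y : R) : `|y| <= 1 / 2 ->
  expR y <= 1 + y + 2 * y ^+ 2.
Proof.
rewrite ler_norml => /andP[y1 y2].
have h : 1 - y <= expR (- y) by exact: expR_ge1Dx.
have y0 : 0 < 1 - y by lra.
rewrite -[y in expR y]opprK expRN invf_ple ?posrE ?expR_gt0//; last by nra.
apply: le_trans h; rewrite -[leLHS]mul1r ler_pdivrMr; nra.
Qed.

(** For small [s] the linear terms cancel, the variable being centered, and the quadratic ones
    remain. For [|s| > 1/2] the exponents are at most [|s| <= 2 s^2]. *)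
Lemma two_point_subgaussian (R : realType) (rho s : R) : 0 < rho < 1 ->
  rho * expR (s * (1 - rho)) + (1 - rho) * expR (s * - rho) <= expR (2 * s ^+ 2).
Proof.
case/andP=> r0 r1; have [s2|s2] := lerP `|s| (1 / 2).
  apply: le_trans (expR_ge1Dx _).
  have bnd w : `|w| <= 1 -> `|s * w| <= 1 / 2.
    by move=> w1; rewrite normrM -[leRHS]mulr1 ler_pM.
  have h1 : `|1 - rho| <= 1 by rewrite ler_norml; lra.
  have h2 : `|- rho| <= 1 by rewrite ler_norml; lra.
  have := expR_le_quadratic (bnd _ h1); have := expR_le_quadratic (bnd _ h2).
  move=> E1 E2.
  apply: (@le_trans _ _ (rho * (1 + s * (1 - rho) + 2 * (s * (1 - rho)) ^+ 2) +
    (1 - rho) * (1 + s * - rho + 2 * (s * - rho) ^+ 2))).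
    by rewrite lerD// ler_pM2l//; lra.
  rewrite -subr_ge0.
  have -> : 1 + 2 * s ^+ 2 - (rho * (1 + s * (1 - rho) + 2 * (s * (1 - rho)) ^+ 2) +
    (1 - rho) * (1 + s * - rho + 2 * (s * - rho) ^+ 2)) =
    2 * s ^+ 2 * (1 - rho * (1 - rho)) by ring.
  apply: mulr_ge0; first by rewrite mulr_ge0// sqr_ge0.
  nra.
have s0 : `|s| <= 2 * s ^+ 2 by rewrite -(real_normK (num_real s)); nra.
have bnd w : `|w| <= 1 -> expR (s * w) <= expR (2 * s ^+ 2).
  move=> w1; rewrite ler_expR; apply: le_trans s0.
  by rewrite (le_trans (ler_norm _))// normrM -[leRHS]mulr1 ler_pM.
have h1 : `|1 - rho| <= 1 by rewrite ler_norml; lra.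
have h2 : `|- rho| <= 1 by rewrite ler_norml; lra.
have -> : expR (2 * s ^+ 2) = rho * expR (2 * s ^+ 2) + (1 - rho) * expR (2 * s ^+ 2) by ring.
by rewrite lerD// ler_pM2l ?bnd//; lra.
Qed.

(** Expanding the square leaves the term [2 c x w], linear in the spin [w] and hence subgaussian:
    integrating one spin out replaces [c] by [c (1 + 8 c)] at the price of a factor [exp c]. *)
Lemma two_point_square (R : realType) (rho c x : R) : 0 < rho < 1 -> 0 < c ->
  rho * expR (c * (x + (1 - rho)) ^+ 2) + (1 - rho) * expR (c * (x + - rho) ^+ 2)
  <= expR (c + c * (1 + 8 * c) * x ^+ 2).
Proof.
move=> rho01 c0; have /andP[r0 r1] := rho01.
have bnd w : w ^+ 2 <= 1 ->
    expR (c * (x + w) ^+ 2) <= expR (c * x ^+ 2 + c) * expR ((2 * c * x) * w).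
  move=> w1; rewrite -expRD ler_expR -subr_ge0.
  have -> : c * x ^+ 2 + c + 2 * c * x * w - c * (x + w) ^+ 2 = c * (1 - w ^+ 2) by ring.
  by rewrite mulr_ge0 ?subr_ge0// ltW.
apply: (@le_trans _ _ (expR (c * x ^+ 2 + c) *
  (rho * expR ((2 * c * x) * (1 - rho)) + (1 - rho) * expR ((2 * c * x) * - rho)))).
  rewrite mulrDr 2!(mulrCA (expR _)) lerD// ler_pM2l ?bnd//; nra.
apply: (@le_trans _ _ (expR (c * x ^+ 2 + c) * expR (2 * (2 * c * x) ^+ 2))).
  by rewrite ler_pM2l ?expR_gt0// two_point_subgaussian.
by rewrite -expRD ler_expR; nra.
Qed.

(** Young's inequality [a b <= a ln a - a + exp b] at each point. [Z] is shifted by [K] so that the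
    exponential terms sum to at most 1 and are cancelled by the sum of [- m Y]. *)
Lemma gibbs_variational (R : realType) (S : finType) (m Y Z : S -> R) (K : R) :
  (forall x, 0 <= m x) -> (forall x, 0 <= Y x) -> \sum_x m x * Y x = 1 ->
  \sum_x m x * expR (Z x) <= expR K ->
  \sum_x m x * (Y x * Z x) <= \sum_x m x * (Y x * ln (Y x)) + K.
Proof.
move=> m0 Y0 mY mZ.
have pt x : Y x * (Z x - K) <= Y x * ln (Y x) - Y x + expR (Z x - K).
  have [->|Yx] := eqVneq (Y x) 0; first by rewrite !mul0r subr0 add0r expR_ge0.
  have {Yx} : 0 < Y x by rewrite lt_neqAle eq_sym Yx Y0.
  move: (Y x) (Z x - K) => a b a0.
  have -> : expR b = a * expR (b - ln a) by rewrite expRB lnK ?posrE//; field; rewrite gt_eqF.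
  by have := expR_ge1Dx (b - ln a); nra.
have : \sum_x m x * (Y x * (Z x - K)) <=
    \sum_x m x * (Y x * ln (Y x) - Y x + expR (Z x - K)).
  by apply: ler_sum => x _; rewrite ler_wpM2l.
under eq_bigr do rewrite mulrBr mulrBr.
under [X in _ <= X -> _]eq_bigr do rewrite mulrDr mulrBr.
rewrite sumrB big_split/= sumrB mY.
have -> : \sum_x m x * (Y x * K) = K.
  by under eq_bigr do rewrite mulrA; rewrite -mulr_suml mY mul1r.
suff : \sum_x m x * expR (Z x - K) <= 1 by lra.
under eq_bigr do rewrite expRB mulrA.
by rewrite -mulr_suml ler_pdivrMr ?expR_gt0// mul1r.
Qed.

(** * Exponential moments of squared block sums *)

Section BlockAverages.
Variables (R : realType) (I : finType) (rho : R).
Hypothesis rho01 : 0 < rho < 1.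
Local Notation cfg := {ffun I -> bool}.
Local Notation mean := (@mean R I rho).
Local Notation centered := (@centered R I rho).
Implicit Types (x y z : I) (eta : cfg) (f g u : cfg -> R).

Definition entropy g : R := mean (fun eta => g eta * ln (g eta)).

Definition density g := (forall eta, 0 <= g eta) /\ mean g = 1.

Lemma entropy_inequality g U K : density g -> mean (fun eta => expR (U eta)) <= expR K ->
  mean (fun eta => U eta * g eta) <= entropy g + K.
Proof.
move=> [g0 g1] UK.
have := gibbs_variational (bernoulli_prod_ge0 rho01) g0 g1 UK.
by rewrite /entropy /(mean _); under eq_bigr do rewrite (mulrC (g _)).
Qed.

Lemma entropy_ge0 g : density g -> 0 <= entropy g.
Proof.
move=> gd; have := @entropy_inequality g (fun=> 0) 0 gd.
by rewrite /= mean_cst// meanZ mul0r addr0; apply.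
Qed.

Lemma exp_square_site (c : R) s (x : cfg -> R) (rest : cfg -> R) : 0 < c ->
  (forall eta, 0 <= rest eta) ->
  (forall eta, x (flip s eta) = x eta) -> (forall eta, rest (flip s eta) = rest eta) ->
  mean (fun eta => expR (c * (x eta + centered eta s) ^+ 2) * rest eta) <=
  mean (fun eta => expR (c + c * (1 + 8 * c) * x eta ^+ 2) * rest eta).
Proof.
move=> c0 r0 xs rs; rewrite -(mean_resample rho s).
apply: le_mean => // eta; rewrite /resample /centered ffunE eqxx xs rs.
rewrite (mulrA (bernoulli_weight _ (eta s))) (mulrA (bernoulli_weight _ (~~ _))) -mulrDl.
apply: ler_wpM2r => //; have := two_point_square (x eta) rho01 c0.
by case: (eta s) => /=; rewrite ?mulr0n ?mulr1n ?sub0r //; rewrite addrC.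
Qed.

(** Removing the sites one by one iterates [c -> c (1 + 8 c)], a discrete form of [c' = 8 c^2]; the
    solution [th / (1 - 8 th j)] of that equation dominates the iteration. [rest] stands for the
    factors of the other blocks. *)
Lemma exp_square_sites (th : R) (l : seq I) (x : cfg -> R) (rest : cfg -> R) :
  0 < th -> 8 * th * (size l)%:R < 1 -> uniq l ->
  (forall eta, 0 <= rest eta) ->
  (forall s eta, s \in l -> x (flip s eta) = x eta) ->
  (forall s eta, s \in l -> rest (flip s eta) = rest eta) ->
  mean (fun eta => expR (th * (x eta + \sum_(s <- l) centered eta s) ^+ 2) * rest eta) <=
  mean (fun eta => expR (th / (1 - 8 * th * (size l)%:R) * (x eta ^+ 2 + (size l)%:R)) * rest eta).
Proof.
move=> th0; elim: l x => [|s l IH] x.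
  move=> _ _ _ _ _; apply: le_mean => // eta.
  by rewrite big_nil !addr0 mulr0 subr0 divr1.
have -> : (size (s :: l))%:R = (size l)%:R + 1 :> R by rewrite natr1.
set j : R := (size l)%:R => j1 /andP[sl ul] r0 xl rl.
have j0 : 0 <= j by rewrite ler0n.
have jl : 8 * th * j < 1 by nra.
pose c := th / (1 - 8 * th * j).
have d0 : 0 < 1 - 8 * th * j by lra.
have c0 : 0 < c by rewrite divr_gt0.
have cE : c * (1 - 8 * th * j) = th by rewrite /c; field; lra.
apply: (@le_trans _ _ (mean (fun eta =>
   expR (c * ((x eta + centered eta s) ^+ 2 + j)) * rest eta))).
  under eq_mean do rewrite big_cons addrA.
  apply: (IH (fun eta => x eta + centered eta s) jl ul r0) => [t eta tl|t eta tl]; last by rewrite rl// inE tl orbT.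
  rewrite xl ?inE ?tl ?orbT// /centered ffunE; case: eqP => // ts.
  by move: sl; rewrite ts tl.
under eq_mean do rewrite mulrDr expRD -mulrA.
apply: (@le_trans _ _ (mean (fun eta =>
   expR (c + c * (1 + 8 * c) * x eta ^+ 2) * (expR (c * j) * rest eta)))).
  apply: (exp_square_site c0) => eta; first by rewrite mulr_ge0 ?expR_ge0.
    by rewrite xl// mem_head.
  by rewrite rl// mem_head.
apply: le_mean => // eta; rewrite mulrA -expRD ler_wpM2r// ler_expR.
have D0 : 0 < 1 - 8 * th * (j + 1) by lra.
set C := th / _.
have CE : C * (1 - 8 * th * (j + 1)) = th by rewrite /C; field; lra.
have cC : c * (1 + 8 * c) <= C.
  have dE : 1 - 8 * th * (j + 1) = (1 - 8 * th * j) * (1 - 8 * c).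
    by transitivity ((1 - 8 * th * j) - 8 * (c * (1 - 8 * th * j))); [rewrite cE|]; ring.
  have c8 : 0 < 1 - 8 * c by move: D0; rewrite dE pmulr_rgt0.
  rewrite /C dE ler_pdivlMr ?mulr_gt0// -[leRHS]cE -subr_ge0.
  move: (1 - 8 * th * j) d0 => D D0'.
  have -> : c * D - c * (1 + 8 * c) * (D * (1 - 8 * c)) = 64 * c ^+ 3 * D by ring.
  by apply: mulr_ge0; [apply: mulr_ge0 => //; apply: exprn_ge0|]; exact: ltW.
have := sqr_ge0 (x eta); move: (x eta ^+ 2) => X X0.
have : c <= C by nra.
by nra.
Qed.

(** When [16 th k <= 1], one block contributes at most [th k / (1 - 8 th k) <= 1 / 8] to the
    exponent. Disjointness lets the blocks be integrated out one after the other. *)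
Lemma exp_square_blocks (th : R) (k : nat) (ls : seq (seq I)) :
  0 < th -> 16 * th * k%:R <= 1 -> uniq (flatten ls) ->
  (forall l, l \in ls -> size l = k) ->
  mean (fun eta => expR (\sum_(l <- ls) th * (\sum_(s <- l) centered eta s) ^+ 2)) <=
  expR ((size ls)%:R / 8).
Proof.
move=> th0 thk; elim: ls => [|l ls IH] /=.
  by rewrite mul0r; under eq_mean do rewrite big_nil; rewrite mean_cst.
rewrite cat_uniq => /and3P[ul hl uls] sz.
have szl : size l = k by rewrite sz// mem_head.
under eq_mean do rewrite big_cons expRD.
have := @exp_square_sites th l (fun=> 0)
  (fun eta => expR (\sum_(l <- ls) th * (\sum_(s <- l) centered eta s) ^+ 2)).
rewrite szl; under eq_mean do rewrite add0r.
have k0 : 0 <= k%:R :> R by rewrite ler0n.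
move=> H; apply: (le_trans (H _ _ _ _ _ _)) => //.
- by nra.
- move=> s eta sl; congr expR; apply: eq_big_seq => l' l'ls.
  congr (_ * _ ^+ 2); apply: eq_big_seq => t tl'.
  rewrite /centered ffunE; case: eqP => // ts; exfalso; move/hasP: hl; apply.
  by exists s => //; apply/flattenP; exists l' => //; rewrite -ts.
have -> : (size ls).+1%:R / 8 = (size ls)%:R / 8 + 1 / 8 :> R.
  by rewrite -[(size ls).+1%:R]natr1; field.
rewrite meanZ expRD mulrC ler_pM ?expR_ge0//.
- by apply: mean_ge0 => // eta; exact: expR_ge0.
- by apply: IH => // l' l'ls; rewrite sz// inE l'ls orbT.
rewrite ler_expR expr0n/= add0r mul1r mulrAC ler_pdivrMr; nra.
Qed.

End BlockAverages.

(** * Block replacement *)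

Lemma sum_cst (V : pzSemiRingType) (I : finType) (c : V) : \sum_(i : I) c = #|I|%:R * c.
Proof. by rewrite sumr_const mulr_natl; congr (_ *+ _); exact: eq_card. Qed.

Section BlockReplacement.
Variables (R : realType) (T : finZmodType) (rho : R).
Hypothesis rho01 : 0 < rho < 1.
Local Notation cfg := {ffun T -> bool}.
Local Notation mean := (@mean R T rho).
Local Notation centered := (@centered R T rho).
Local Notation far_form := (@far_form R T rho).
Local Notation entropy := (@entropy R T rho).
Local Notation density := (@density R T rho).
Implicit Types (x y z : T) (eta : cfg) (u g : cfg -> R).

Definition block_avg (B : finType) (v : B -> T) x eta : R :=
  (#|B|%:R)^-1 * \sum_b centered eta (x + v b).

Lemma block_avg_swapD (B : finType) (v : B -> T) x y z eta :
  (forall b, x + v b != y) -> (forall b, x + v b != z) ->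
  block_avg v x (swap y z eta) = block_avg v x eta.
Proof.
move=> xy xz; congr (_ * _); apply: eq_bigr => b _.
by rewrite centered_swapD.
Qed.

(** For each origin [r] the blocks at the sites [r + w i] are disjoint, so the entropy inequality
    applies to all of them at once; [th = 1 / (16 b)] is the largest value that [exp_square_blocks]
    admits. Summing over [r] counts every site [#|E|] times, so the entropy is multiplied only by
    the inverse of the proportion of the torus that one grid fills. *)
Lemma block_avg_l2 (B E : finType) (v : B -> T) (w : E -> T) g :
  (0 < #|B|)%N -> (0 < #|E|)%N ->
  injective (fun p : E * B => w p.1 + v p.2) -> density g ->
  mean (fun eta => \sum_x block_avg v x eta ^+ 2 * g eta) <=
  16 * #|T|%:R / (#|E|%:R * #|B|%:R) * entropy g + 2 * #|T|%:R / #|B|%:R.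
Proof.
move=> B0 E0 inj gd.
have b0 : 0 < #|B|%:R :> R by rewrite ltr0n.
have e0 : 0 < #|E|%:R :> R by rewrite ltr0n.
set b : R := #|B|%:R in b0 *; set e : R := #|E|%:R in e0 *.
pose th : R := (16 * b)^-1.
have th0 : 0 < th by rewrite invr_gt0 mulr_gt0.
have key r : mean (fun eta => (\sum_i b / 16 * block_avg v (r + w i) eta ^+ 2) * g eta)
    <= entropy g + e / 8.
  apply: entropy_inequality => //.
  pose ls := [seq [seq r + w i + v c | c <- enum B] | i <- enum E].
  have := @exp_square_blocks R T rho rho01 th #|B| ls th0.
  rewrite size_map -cardE -/e => H.
  apply: le_trans (H _ _ _); last first.
  - by move=> l /mapP[i _ ->]; rewrite size_map -cardE.
  - rewrite -[flatten ls]/[seq r + w i + v c | i <- enum E, c <- enum B].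
    apply: allpairs_uniq; rewrite ?enum_uniq// => -[i c] [i' c'] _ _ /=.
    by rewrite -!addrA => /addrI; exact: (inj (i, c) (i', c')).
  - by rewrite /th -/b le_eqVlt; apply/orP; left; apply/eqP; field; lra.
  apply: le_mean => // eta; rewrite ler_expR big_map big_enum/=.
  rewrite le_eqVlt; apply/orP; left; apply/eqP; apply: eq_bigr => i _.
  rewrite big_map big_enum/= /block_avg -/b /th.
  by move: (\sum_(_ in _) _) => S; field; lra.
pose Q := mean (fun eta => \sum_x block_avg v x eta ^+ 2 * g eta).
have sumE : \sum_r mean (fun eta => (\sum_i b / 16 * block_avg v (r + w i) eta ^+ 2) * g eta)
   = e * (b / 16) * Q.
  rewrite -mean_sum -meanZ; apply: eq_mean => eta /=.
  rewrite -mulr_suml exchange_big/= -[in RHS]mulr_suml mulrA; congr (_ * _).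
  rewrite (eq_bigr (fun=> b / 16 * \sum_x block_avg v x eta ^+ 2)).
    by rewrite sum_cst -/e; ring.
  move=> i _; rewrite -mulr_sumr; congr (_ * _).
  by rewrite [RHS](reindex_inj (addIr (w i))).
have : e * (b / 16) * Q <= \sum_(r : T) (entropy g + e / 8).
  by rewrite -sumE; apply: ler_sum => r _; exact: key.
have -> : \sum_(r : T) (entropy g + e / 8) = #|T|%:R * (entropy g + e / 8).
  by rewrite sum_cst.
rewrite -/Q; move: (#|T|%:R : R) => t h.
have -> : 16 * t / (e * b) * entropy g + 2 * t / b =
  (t * (entropy g + e / 8)) / (e * (b / 16)) by field; lra.
rewrite ler_pdivlMr 1?mulrC//; apply: mulr_gt0 => //; exact: divr_gt0.
Qed.

(** [F] ignores every exchange of [x + z] with a site of its block, so the spin can be compared with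
    each spin of the block by parts, and the bounds are averaged. *)
Lemma swap_block_bound (B : finType) (v : B -> T) z (F : T -> cfg -> R) u (k D : R) :
  (0 < #|B|)%N -> 0 < k ->
  (forall x c eta, F x (swap (x + z) (x + z + v c) eta) = F x eta) ->
  (forall c, far_form (v c) u <= D) ->
  mean (fun eta => \sum_x F x eta *
     (centered eta (x + z) - block_avg v (x + z) eta) * u eta ^+ 2) <=
  k * D + (4 * k)^-1 * mean (fun eta => \sum_x F x eta ^+ 2 * u eta ^+ 2).
Proof.
move=> B0 k0 HF HD.
have b0 : 0 < #|B|%:R :> R by rewrite ltr0n.
set b : R := #|B|%:R in b0 *; set Q := mean (fun eta => \sum_x F x eta ^+ 2 * u eta ^+ 2).
have key c : mean (fun eta => \sum_x F x eta *
     (centered eta (x + z) - centered eta (x + z + v c)) * u eta ^+ 2) <= k * D + (4 * k)^-1 * Q.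
  rewrite mean_sum.
  apply: (@le_trans _ _ (\sum_x (k * hop rho (x + z) (x + z + v c) u +
     (4 * k)^-1 * mean (fun eta => F x eta ^+ 2 * u eta ^+ 2)))).
    apply: ler_sum => x _.
    exact: (@exchange_by_parts R T rho rho01 k (x + z) (x + z + v c) (F x) u k0 (HF x c)).
  rewrite big_split/= -!mulr_sumr /Q mean_sum lerD2r ler_pM2l//.
  apply: le_trans (HD c); rewrite /(far_form _ _).
  by rewrite [leRHS](reindex_inj (addIr z)).
have -> : mean (fun eta => \sum_x F x eta *
     (centered eta (x + z) - block_avg v (x + z) eta) * u eta ^+ 2) =
  b^-1 * \sum_c mean (fun eta => \sum_x F x eta *
     (centered eta (x + z) - centered eta (x + z + v c)) * u eta ^+ 2).
  rewrite -mean_sum -meanZ; apply: eq_mean => eta /=.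
  rewrite exchange_big/= mulr_sumr; apply: eq_bigr => x _.
  rewrite -mulr_suml -mulr_sumr sumrB sum_cst -/b /block_avg -/b.
  by move: (\sum_(_ : B) _) => S; field; lra.
rewrite mulrC ler_pdivrMr//.
apply: (@le_trans _ _ (\sum_(c : B) (k * D + (4 * k)^-1 * Q))).
  by apply: ler_sum => c _; exact: key.
by rewrite sum_cst mulrC.
Qed.

Lemma sqr_le1 (r : R) : `|r| <= 1 -> r ^+ 2 <= 1.
Proof. by rewrite ler_norml => /andP[? ?]; nra. Qed.

(* Both spins are replaced by block averages, first [z] at the small scale [v1],
   then [b] at the large scale [v2], and finally [z] again at the large scale:
   an average already present makes the cost of the next replacement smaller. *)
Lemma two_block_bound (B1 B2 : finType) (v1 : B1 -> T) (v2 : B2 -> T) z b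
    (K : T -> cfg -> R) u (k1 k2 D1 D2 q1 q2 : R) :
  (0 < #|B1|)%N -> (0 < #|B2|)%N -> 0 < k1 -> 0 < k2 -> mean (fun eta => u eta ^+ 2) = 1 ->
  (forall x eta, `|K x eta| <= 1) ->
  (forall x c eta, K x (swap (x + z) (x + z + v1 c) eta) = K x eta) ->
  (forall x c eta, K x (swap (x + z) (x + z + v2 c) eta) = K x eta) ->
  (forall x c eta, K x (swap (x + b) (x + b - v2 c) eta) = K x eta) ->
  z != b -> (forall c, z + v1 c != b) -> (forall c, z != b - v2 c) ->
  (forall c c', z + v1 c != b - v2 c') -> (forall c c', z + v2 c != b - v2 c') ->
  (forall c, far_form (v1 c) u <= D1) -> (forall c, far_form (v2 c) u <= D2) ->
  mean (fun eta => \sum_x block_avg v1 x eta ^+ 2 * u eta ^+ 2) <= q1 ->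
  mean (fun eta => \sum_x block_avg v2 x eta ^+ 2 * u eta ^+ 2) <= q2 ->
  mean (fun eta => \sum_x block_avg (fun c => - v2 c) x eta ^+ 2 * u eta ^+ 2) <= q2 ->
  mean (fun eta => \sum_x K x eta * centered eta (x + z) * centered eta (x + b) * u eta ^+ 2)
  <= 2 * k1 * D1 + 2 * k2 * D2 + (4 * k1)^-1 * (#|T|%:R + q2)
     + (4 * k2)^-1 * (q1 + q2) + q2.
Proof.
move=> B10 B20 k10 k20 u1 K1 Kz1 Kz2 Kb2 zb z1b zb2 z1b2 z2b2 hD1 hD2 hq1 hq2 hq2'.
pose A1 x := block_avg v1 (x + z); pose A2 x := block_avg v2 (x + z).
pose A2' x := block_avg (fun c => - v2 c) (x + b).
have xI (x y y' : T) : (x + y == x + y') = (y == y').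
  by apply/eqP/eqP => [/addrI|->].
have K2 x eta r : (K x eta * r) ^+ 2 <= r ^+ 2.
  by rewrite exprMn -[leRHS]mul1r ler_wpM2r ?sqr_ge0// sqr_le1.
have le_q (F : T -> cfg -> R) (G : T -> cfg -> R) q :
    (forall x eta, F x eta ^+ 2 <= G x eta) ->
    mean (fun eta => \sum_x G x eta * u eta ^+ 2) <= q ->
    mean (fun eta => \sum_x F x eta ^+ 2 * u eta ^+ 2) <= q.
  move=> FG; apply: le_trans; apply: le_mean => // eta; apply: ler_sum => x _.
  by rewrite ler_wpM2r ?sqr_ge0.
have shift (B : finType) (v : B -> T) y q :
    mean (fun eta => \sum_x block_avg v x eta ^+ 2 * u eta ^+ 2) <= q ->
    mean (fun eta => \sum_x block_avg v (x + y) eta ^+ 2 * u eta ^+ 2) <= q.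
  apply: le_trans; apply: le_mean => // eta.
  by rewrite [leRHS](reindex_inj (addIr y)).
have T1 : mean (fun eta => \sum_x (K x eta * centered eta (x + b)) *
    (centered eta (x + z) - A1 x eta) * u eta ^+ 2) <= k1 * D1 + (4 * k1)^-1 * #|T|%:R.
  apply: (le_trans (swap_block_bound (F := fun x eta => K x eta * centered eta (x + b))
     B10 k10 _ hD1)).
    by move=> x c eta; rewrite Kz1 centered_swapD// -?addrA xI// eq_sym.
  rewrite lerD2l ler_pM2l ?invr_gt0 ?mulr_gt0//.
  apply: (le_q _ (fun _ _ => 1)) => [x eta|].
    by rewrite (le_trans (K2 _ _ _))// sqr_le1// centered_norm.
  rewrite le_eqVlt; apply/orP; left; apply/eqP.
  rewrite mean_sum (eq_bigr (fun=> 1)) ?sum_cst ?mulr1// => x _.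
  by rewrite -[RHS]u1; apply: eq_mean => eta; rewrite mul1r.
have T2 : mean (fun eta => \sum_x (K x eta * A1 x eta) *
    (centered eta (x + b) - A2' x eta) * u eta ^+ 2) <= k2 * D2 + (4 * k2)^-1 * q1.
  have hD2' c : far_form (- v2 c) u <= D2 by rewrite far_formN.
  apply: (le_trans (swap_block_bound (F := fun x eta => K x eta * A1 x eta)
     B20 k20 _ hD2')).
    move=> x c eta; rewrite Kb2 /A1 block_avg_swapD// => c'; rewrite -!addrA xI//.
  rewrite lerD2l ler_pM2l ?invr_gt0 ?mulr_gt0//.
  by apply: (le_q _ (fun x eta => A1 x eta ^+ 2)) => // ; exact: shift.
have A2'_q : mean (fun eta => \sum_x (- (K x eta * A2' x eta)) ^+ 2 * u eta ^+ 2) <= q2.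
  apply: (le_q (fun x eta => - (K x eta * A2' x eta)) (fun x eta => A2' x eta ^+ 2)).
    by move=> x eta; rewrite sqrrN.
  exact: shift.
have A2'_q' : mean (fun eta => \sum_x (K x eta * A2' x eta) ^+ 2 * u eta ^+ 2) <= q2.
  apply: (le_q (fun x eta => K x eta * A2' x eta) (fun x eta => A2' x eta ^+ 2)) => //.
  exact: shift.
(* Integration by parts acts on a single spin, so [A1] is turned back into the spin at [z] before
   the large-scale replacement. The weight is now [A2'], with squared norm at most [q2], instead of
   a spin. *)
have T3 : mean (fun eta => \sum_x (- (K x eta * A2' x eta)) *
    (centered eta (x + z) - A1 x eta) * u eta ^+ 2) <= k1 * D1 + (4 * k1)^-1 * q2.
  apply: (le_trans (swap_block_bound (F := fun x eta => - (K x eta * A2' x eta))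
     B10 k10 _ hD1)).
    move=> x c eta; rewrite Kz1 /A2' block_avg_swapD// => c'; rewrite -!addrA xI// eq_sym//.
  by rewrite lerD2l ler_pM2l ?invr_gt0 ?mulr_gt0.
have T4 : mean (fun eta => \sum_x (K x eta * A2' x eta) *
    (centered eta (x + z) - A2 x eta) * u eta ^+ 2) <= k2 * D2 + (4 * k2)^-1 * q2.
  apply: (le_trans (swap_block_bound (F := fun x eta => K x eta * A2' x eta)
     B20 k20 _ hD2)).
    move=> x c eta; rewrite Kz2 /A2' block_avg_swapD// => c'; rewrite -!addrA xI// eq_sym//.
  by rewrite lerD2l ler_pM2l ?invr_gt0 ?mulr_gt0.
have T5 : mean (fun eta => \sum_x K x eta * A2' x eta * A2 x eta * u eta ^+ 2) <= q2.
  apply: (@le_trans _ _ (2^-1 * (mean (fun eta => \sum_x A2' x eta ^+ 2 * u eta ^+ 2)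
     + mean (fun eta => \sum_x A2 x eta ^+ 2 * u eta ^+ 2)))).
    rewrite -meanD -meanZ; apply: le_mean => // eta.
    rewrite -big_split/= mulr_sumr; apply: ler_sum => x _.
    rewrite -mulrDl mulrA ler_wpM2r ?sqr_ge0//.
    have := K1 x eta; rewrite ler_norml => /andP[ka kb].
    have := sqr_ge0 (A2' x eta - A2 x eta); have := sqr_ge0 (A2' x eta + A2 x eta).
    move: (K x eta) (A2' x eta) (A2 x eta) ka kb => r s t ? ? h1 h2.
    rewrite -subr_ge0.
    have -> : 2^-1 * (s ^+ 2 + t ^+ 2) - r * s * t =
       ((1 - r) * (s + t) ^+ 2 + (1 + r) * (s - t) ^+ 2) / 4 by field.
    by rewrite divr_ge0// addr_ge0// mulr_ge0// ?sqr_ge0; lra.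
  have := shift _ _ b _ hq2'; have := shift _ _ z _ hq2.
  by rewrite -/(A2 _) -/(A2' _); lra.
have -> : mean (fun eta => \sum_x K x eta * centered eta (x + z) * centered eta (x + b) * u eta ^+ 2)
  = mean (fun eta => \sum_x (K x eta * centered eta (x + b)) *
    (centered eta (x + z) - A1 x eta) * u eta ^+ 2)
  + mean (fun eta => \sum_x (K x eta * A1 x eta) *
    (centered eta (x + b) - A2' x eta) * u eta ^+ 2)
  + mean (fun eta => \sum_x (- (K x eta * A2' x eta)) *
    (centered eta (x + z) - A1 x eta) * u eta ^+ 2)
  + mean (fun eta => \sum_x (K x eta * A2' x eta) *
    (centered eta (x + z) - A2 x eta) * u eta ^+ 2)
  + mean (fun eta => \sum_x K x eta * A2' x eta * A2 x eta * u eta ^+ 2).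
  rewrite -!meanD; apply: eq_mean => eta; rewrite -!big_split/=.
  by apply: eq_bigr => x _; ring.
lra.
Qed.

End BlockReplacement.

(** * Discrete chains *)

Lemma sum_tupleS (V : nmodType) (S : finType) (N : nat) (F : seq S -> V) :
  \sum_(s : N.+1.-tuple S) F s = \sum_x \sum_(s : N.-tuple S) F (x :: s).
Proof.
rewrite pair_big/= (reindex (fun p : S * N.-tuple S => [tuple of p.1 :: p.2]))/=.
  by apply: eq_bigr => p _.
exists (fun s : N.+1.-tuple S => (thead s, [tuple of behead s])).
  by move=> [x s] _ /=; rewrite theadE; congr pair; apply/val_inj.
by move=> s _ /=; rewrite [RHS]tuple_eta; apply/val_inj.
Qed.

Lemma sum_tuple0 (V : nmodType) (S : finType) (F : seq S -> V) :
  \sum_(s : 0.-tuple S) F s = F [::].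
Proof. by rewrite (big_pred1 [tuple]) // => s; apply/esym/eqP; exact: tuple0. Qed.

Section PathSums.
Variables (R : realType) (S : finType).
Implicit Types (K : nat -> S -> S -> R) (x y : S) (s : seq S).

Fixpoint path_weight K (i : nat) x s : R :=
  if s is y :: s' then K i x y * path_weight K i.+1 y s' else 1.

Fixpoint path_sum K (i : nat) x s : R :=
  if s is y :: s' then K i x y + path_sum K i.+1 y s' else 0.

Lemma path_weightE K i x s : path_weight K i x s =
  \prod_(0 <= j < size s) K (i + j)%N (nth x (x :: s) j) (nth x (x :: s) j.+1).
Proof.
elim: s i x => [|y s IH] i x /=; first by rewrite big_geq.
rewrite big_nat_recl//= addn0 IH; congr (_ * _).
apply: eq_big_nat => j /andP[_ js]; rewrite addSnnS.
by rewrite !(set_nth_default x y) //= ltnS ltnW.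
Qed.

Lemma path_sumE K i x s : path_sum K i x s =
  \sum_(0 <= j < size s) K (i + j)%N (nth x (x :: s) j) (nth x (x :: s) j.+1).
Proof.
elim: s i x => [|y s IH] i x /=; first by rewrite big_geq.
rewrite big_nat_recl//= addn0 IH; congr (_ + _).
apply: eq_big_nat => j /andP[_ js]; rewrite addSnnS.
by rewrite !(set_nth_default x y) //= ltnS ltnW.
Qed.

Lemma path_weight_expR K F i x s : path_weight K i x s * expR (path_sum F i x s) =
  path_weight (fun i x y => K i x y * expR (F i x y)) i x s.
Proof.
elim: s i x => [|y s IH] i x /=; first by rewrite expR0 mulr1.
by rewrite expRD mulrACA IH.
Qed.

Lemma path_weight_ge0 K i x s : (forall i x y, 0 <= K i x y) -> 0 <= path_weight K i x s.
Proof. by move=> K0; elim: s i x => //= y s IH i x; rewrite mulr_ge0. Qed.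

Lemma sum_path_weight K N i x : (forall i x, \sum_y K i x y = 1) ->
  \sum_(s : N.-tuple S) path_weight K i x s = 1.
Proof.
move=> K1; elim: N i x => [|N IH] i x.
  by rewrite (sum_tuple0 (path_weight K i x)).
rewrite (sum_tupleS _ (path_weight K i x)) /= -[RHS](K1 i x); apply: eq_bigr => y _.
by rewrite -mulr_sumr IH mulr1.
Qed.

(** The kernels are changed one step at a time. Only [K] is a stochastic kernel: [K'] will be the
    semigroup, handled as a power series, and its rows are controlled through their absolute sums,
    at most [1 + eps]. *)
Lemma path_weight_dist (K K' : nat -> S -> S -> R) (eps : R) N i x :
  0 <= eps -> (forall i x y, 0 <= K i x y) -> (forall i x, \sum_y K i x y = 1) ->
  (forall i x, \sum_y `|K' i x y - K i x y| <= eps) ->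
  \sum_(s : N.-tuple S) `|path_weight K' i x s - path_weight K i x s| <= (1 + eps) ^+ N - 1.
Proof.
move=> e0 K0 K1 KK; elim: N i x => [|N IH] i x.
  by rewrite (sum_tuple0 (fun s => `|path_weight K' i x s - path_weight K i x s|))/= expr0 !subrr normr0.
rewrite (sum_tupleS _ (fun s => `|path_weight K' i x s - path_weight K i x s|)) /=.
apply: (@le_trans _ _ (\sum_y (`|K' i x y| * ((1 + eps) ^+ N - 1) + `|K' i x y - K i x y|))).
  apply: ler_sum => y _.
  apply: (@le_trans _ _ (\sum_(s : N.-tuple S) (`|K' i x y| *
     `|path_weight K' i.+1 y s - path_weight K i.+1 y s| +
     `|K' i x y - K i x y| * path_weight K i.+1 y s))).
    apply: ler_sum => s _.
    have -> : K' i x y * path_weight K' i.+1 y s - K i x y * path_weight K i.+1 y s =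
       K' i x y * (path_weight K' i.+1 y s - path_weight K i.+1 y s) +
       (K' i x y - K i x y) * path_weight K i.+1 y s by ring.
    apply: (le_trans (ler_normD _ _)); rewrite !normrM lerD2l.
    by rewrite (ger0_norm (path_weight_ge0 _ _ _ K0)).
  rewrite big_split/= -!mulr_sumr sum_path_weight// mulr1 lerD2r.
  by rewrite ler_wpM2l.
rewrite big_split/= -mulr_suml.
have : \sum_y `|K' i x y| <= 1 + eps.
  apply: (@le_trans _ _ (\sum_y (`|K' i x y - K i x y| + K i x y))).
    apply: ler_sum => y _; rewrite -{2}(ger0_norm (K0 i x y)).
    by apply: le_trans (ler_normD _ _); rewrite subrK.
  by rewrite big_split/= K1 addrC lerD2l.
have := KK i x; have : 1 <= (1 + eps) ^+ N by rewrite exprn_ege1// lerDl.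
rewrite exprS; move: (_ ^+ N) (\sum_y `|_|) (\sum_y `|_|) => a b c; nra.
Qed.

End PathSums.

(** * Entropy and energy of a tilted Euler chain *)

Section TiltedChain.
Variables (R : realType) (S : finType) (nu : S -> R) (A : S -> S -> R) (h : R).
Hypothesis nu_gt0 : forall x, 0 < nu x.
Hypothesis A_offdiag : forall x y, x != y -> 0 <= A x y.
Hypothesis A_row : forall x, \sum_y A x y = 0.
Hypothesis h_ge0 : 0 <= h.
Hypothesis h_small : forall x, 0 < 1 + h * A x x.
Implicit Types (x y : S) (u v f : S -> R).

Definition euler_kernel x y : R := (x == y)%:R + h * A x y.
Local Notation ph := euler_kernel.

Definition matrix_op f x : R := \sum_y A x y * f y.

Definition energy v : R := - \sum_x nu x * (v x * matrix_op v x).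

(** A bound on half the squared norm of [A v] over unit vectors [v], from [|v y| <= nu y ^ (-1/2)].
    It may be huge, but it only occurs multiplied by [h ^+ 2] and disappears with the mesh. *)
Definition curvature_cst : R :=
  2^-1 * \sum_x nu x * (\sum_y `|A x y| * Num.sqrt (nu y)^-1) ^+ 2.

Lemma euler_kernel_ge0 x y : 0 <= ph x y.
Proof.
rewrite /ph; case: eqP => [<-|/eqP xy]; first exact: ltW.
by rewrite add0r mulr_ge0// A_offdiag.
Qed.

Lemma euler_kernel_diag x : 0 < ph x x.
Proof. by rewrite /ph eqxx. Qed.

Lemma sum_euler_kernel x : \sum_y ph x y = 1.
Proof.
rewrite big_split/= -mulr_sumr A_row mulr0 addr0 (bigD1 x)//= eqxx big1 ?addr0//.
by move=> y /negbTE; rewrite eq_sym => ->.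
Qed.

Lemma euler_kernel_op f x : \sum_y ph x y * f y = f x + h * matrix_op f x.
Proof.
under eq_bigr do rewrite mulrDl -mulrA.
rewrite big_split/= -mulr_sumr; congr (_ + _).
rewrite (bigD1 x)//= eqxx mul1r big1 ?addr0//.
by move=> y /negbTE; rewrite eq_sym => ->; rewrite mul0r.
Qed.

Lemma euler_kernel_pos f x : (forall y, 0 < f y) -> 0 < \sum_y ph x y * f y.
Proof.
move=> f0; rewrite (bigD1 x)//= ltr_pwDl ?mulr_gt0 ?euler_kernel_diag//.
by apply: sumr_ge0 => y _; apply: mulr_ge0; [exact: euler_kernel_ge0|exact: ltW].
Qed.

(** Half the squared norm of [u - v - h A v] is nonnegative; expanding it leaves the energy of [v]
    alone, although [u] and [v] differ. The computation covers a measure [nu] that is not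
    invariant. *)
Lemma euler_pairing u v : \sum_x nu x * u x ^+ 2 = 1 -> \sum_x nu x * v x ^+ 2 = 1 ->
  h * energy v - h ^+ 2 * curvature_cst <=
  1 - \sum_x nu x * (u x * \sum_y ph x y * v y).
Proof.
move=> u1 v1.
have vb y : `|v y| <= Num.sqrt (nu y)^-1.
  rewrite -sqrtr_sqr ler_wsqrtr// -div1r ler_pdivlMr// mulrC -v1 (bigD1 y)//=.
  by rewrite lerDl; apply: sumr_ge0 => x _; rewrite mulr_ge0 ?sqr_ge0 ?ltW.
have Lb : \sum_x nu x * matrix_op v x ^+ 2 <=
    \sum_x nu x * (\sum_y `|A x y| * Num.sqrt (nu y)^-1) ^+ 2.
  apply: ler_sum => x _; rewrite ler_pM2l// -(real_normK (num_real (matrix_op v x))).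
  apply: lerXn2r; rewrite ?nnegrE//.
    by apply: sumr_ge0 => y _; rewrite mulr_ge0// sqrtr_ge0.
  apply: (le_trans (ler_norm_sum _ _ _)); apply: ler_sum => y _.
  by rewrite normrM ler_wpM2l.
have -> : \sum_x nu x * (u x * \sum_y ph x y * v y) =
   \sum_x (nu x * (u x * v x) + h * (nu x * (u x * matrix_op v x))).
  by apply: eq_bigr => x _; rewrite euler_kernel_op; ring.
have pt x : 0 <= nu x * (2^-1 * (u x - v x - h * matrix_op v x) ^+ 2).
  by apply: mulr_ge0; [exact: ltW|apply: mulr_ge0; rewrite ?sqr_ge0 ?invr_ge0].
have : 0 <= \sum_x nu x * (2^-1 * (u x - v x - h * matrix_op v x) ^+ 2).
  by apply: sumr_ge0 => x _.
have -> : \sum_x nu x * (2^-1 * (u x - v x - h * matrix_op v x) ^+ 2) =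
  2^-1 * (\sum_x nu x * u x ^+ 2) + 2^-1 * (\sum_x nu x * v x ^+ 2)
  - \sum_x (nu x * (u x * v x) + h * (nu x * (u x * matrix_op v x)))
  + h * (\sum_x nu x * (v x * matrix_op v x)) + 2^-1 * h ^+ 2 * (\sum_x nu x * matrix_op v x ^+ 2).
  rewrite !mulr_sumr -!sumrN -!big_split/=; apply: eq_bigr => x _; by field.
rewrite u1 v1 /energy /curvature_cst.
have := sqr_ge0 h; move: Lb.
move: (\sum_x nu x * _ ^+ 2) (\sum_x nu x * _ ^+ 2) => a b; nra.
Qed.

Variable mu : S -> R.
Hypothesis mu_gt0 : forall x, 0 < mu x.
Hypothesis mu_sum : \sum_x mu x = 1.
Variable N : nat.

Definition path_law (p : S * N.-tuple S) : R := mu p.1 * path_weight (fun=> ph) 0 p.1 p.2.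

Definition site (p : S * N.-tuple S) (i : nat) : S := nth p.1 (p.1 :: p.2) i.

Lemma path_law_ge0 p : 0 <= path_law p.
Proof.
apply: mulr_ge0; first exact: ltW.
by apply: path_weight_ge0 => _ x y; exact: euler_kernel_ge0.
Qed.

Lemma sum_path_law : \sum_p path_law p = 1.
Proof.
rewrite -(pair_big xpredT xpredT (fun x s => path_law (x, s)))/= -[RHS]mu_sum.
apply: eq_bigr => x _; rewrite /path_law/= -mulr_sumr sum_path_weight ?mulr1//.
by move=> _ y; exact: sum_euler_kernel.
Qed.

Variable Y : S * N.-tuple S -> R.
Hypothesis Y_gt0 : forall p, 0 < Y p.
Hypothesis Y_sum : \sum_p path_law p * Y p = 1.

Definition marginal (i : nat) (y : S) : R := \sum_(p | site p i == y) path_law p * Y p.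

Definition marginal_density i y : R := marginal i y / nu y.

(** The path that stays at [y] is charged, because the diagonal of the Euler kernel is positive.
    This makes the logarithms and the divisions by [marginal_root] below legitimate. *)
Lemma marginal_gt0 i y : 0 < marginal i y.
Proof.
pose p : S * N.-tuple S := (y, [tuple of nseq N y]).
have py : site p i == y by rewrite /site /= -[y :: nseq N y]/(nseq N.+1 y) nth_nseq if_same.
rewrite /marginal (bigD1 p)//= ltr_pwDl//; last first.
  by apply: sumr_ge0 => q _; apply: mulr_ge0; [exact: path_law_ge0|exact: ltW].
rewrite mulr_gt0// mulr_gt0//= path_weightE prodr_gt0// => j _.
have E k : nth y (y :: nseq N y) k = y by rewrite -[y :: nseq N y]/(nseq N.+1 y) nth_nseq if_same.
by rewrite (E j) (E j.+1) euler_kernel_diag.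
Qed.

Lemma marginal_mean i (f : S -> R) :
  \sum_p path_law p * (Y p * f (site p i)) = \sum_y marginal i y * f y.
Proof.
rewrite (partition_big (fun p => site p i) xpredT)//=; apply: eq_bigr => y _.
by rewrite mulr_suml; apply: eq_bigr => p /eqP <-; rewrite mulrA.
Qed.

Lemma sum_marginal i : \sum_y marginal i y = 1.
Proof.
have := marginal_mean i (fun=> 1); under eq_bigr do rewrite mulr1.
by under [X in _ = X -> _]eq_bigr do rewrite mulr1; rewrite Y_sum => <-.
Qed.

Lemma marginal_density_gt0 i y : 0 < marginal_density i y.
Proof. by rewrite divr_gt0// marginal_gt0. Qed.

Definition marginal_entropy i : R := \sum_y marginal i y * ln (marginal_density i y).

Definition marginal_root i y : R := Num.sqrt (marginal_density i y).

Lemma marginal_root_gt0 i y : 0 < marginal_root i y.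
Proof. by rewrite sqrtr_gt0 marginal_density_gt0. Qed.

Lemma marginal_root_sqr i y : marginal_root i y ^+ 2 = marginal_density i y.
Proof. by rewrite sqr_sqrtr// ltW// marginal_density_gt0. Qed.

Lemma sum_marginal_root i : \sum_y nu y * marginal_root i y ^+ 2 = 1.
Proof.
rewrite -[RHS](sum_marginal i); apply: eq_bigr => y _.
by rewrite marginal_root_sqr /marginal_density mulrC divfK// gt_eqF.
Qed.

Lemma ln_marginal_root i y : ln (marginal_root i y) = ln (marginal_density i y) / 2.
Proof.
have := lnXn 2 (marginal_root_gt0 i y); rewrite marginal_root_sqr => ->.
by rewrite mulr2n; lra.
Qed.

(* The Gibbs variational inequality for the exponential martingale
   [\prod_i v_{i+1}(x_{i+1}) / (ph v_{i+1})(x_i)], where [v_i] is the square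
   root of the density of the i-th marginal of the tilted path measure. *)
Lemma path_energy M : (M <= N)%N ->
  2^-1 * marginal_entropy M + h * \sum_(0 <= i < M) energy (marginal_root i.+1) <=
  2^-1 * marginal_entropy 0 + \sum_p path_law p * (Y p * ln (Y p))
  + M%:R * (h ^+ 2 * curvature_cst).
Proof.
move=> MN.
pose v := marginal_root; pose pv i x := \sum_y ph x y * v i y.
have v0 i y : 0 < v i y by exact: marginal_root_gt0.
have pv0 i x : 0 < pv i x by exact: euler_kernel_pos.
(* The martingale is stopped at time [M]: the later factors are 1. *)
pose F i x y := if (i < M)%N then ln (v i.+1 y) - ln (pv i.+1 x) else 0.
have Gibbs : \sum_p path_law p * (Y p * path_sum F 0 p.1 p.2) <=
    \sum_p path_law p * (Y p * ln (Y p)) + 0.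
  apply: gibbs_variational => //.
  - exact: path_law_ge0.
  - by move=> p; exact: ltW.
  rewrite expR0 -mu_sum.
  under eq_bigr do rewrite -mulrA path_weight_expR.
  rewrite -(pair_big xpredT xpredT (fun x (s : N.-tuple S) => mu x * path_weight
    (fun i x y => ph x y * expR (F i x y)) 0 x s))/=.
  rewrite le_eqVlt; apply/orP; left; apply/eqP.
  apply: eq_bigr => x _; rewrite -mulr_sumr sum_path_weight ?mulr1// => i y.
  rewrite /F; case: (i < M)%N; last first.
    by rewrite expR0; under eq_bigr do rewrite mulr1; exact: sum_euler_kernel.
  under eq_bigr do rewrite expRB !lnK ?posrE// mulrA.
  by rewrite -mulr_suml -/(pv i.+1 y) divff// gt_eqF.
have EF : \sum_p path_law p * (Y p * path_sum F 0 p.1 p.2) =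
    \sum_(0 <= i < M) (\sum_y marginal i.+1 y * ln (v i.+1 y) -
                       \sum_y marginal i y * ln (pv i.+1 y)).
  rewrite (eq_bigr (fun p => \sum_(0 <= i < M) (path_law p * (Y p * ln (v i.+1 (site p i.+1)))
     - path_law p * (Y p * ln (pv i.+1 (site p i)))))).
    rewrite exchange_big/=; apply: eq_bigr => i _.
    by rewrite sumrB (marginal_mean i.+1 (fun y => ln (v i.+1 y)))
      (marginal_mean i (fun y => ln (pv i.+1 y))).
  move=> p _; rewrite path_sumE size_tuple (big_cat_nat (leq0n M) MN)/= [X in _ + X]big_nat_cond.
  rewrite [X in _ + X]big1 ?addr0; last first.
    by move=> i /andP[/andP[Mi _] _]; rewrite /F add0n ltnNge Mi.
  rewrite !mulr_sumr; apply: eq_big_nat => i /andP[_ iM].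
  by rewrite /F add0n iM /site; ring.
rewrite EF addr0 in Gibbs.
(* [ln r <= r - 1] for [r = pv i.+1 y / v i y], averaged under the marginal [nu y * v i y ^+ 2],
   produces the pairing of [euler_pairing]. The other logarithms are half the entropies at times
   [i + 1] and [i], whence the telescoping. *)
have step i : 2^-1 * marginal_entropy i.+1 - 2^-1 * marginal_entropy i
     + (h * energy (v i.+1) - h ^+ 2 * curvature_cst) <=
   \sum_y marginal i.+1 y * ln (v i.+1 y) - \sum_y marginal i y * ln (pv i.+1 y).
  have -> : \sum_y marginal i.+1 y * ln (v i.+1 y) = 2^-1 * marginal_entropy i.+1.
    rewrite /marginal_entropy mulr_sumr; apply: eq_bigr => y _.
    by rewrite ln_marginal_root; field.
  have := euler_pairing (sum_marginal_root i) (sum_marginal_root i.+1).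
  rewrite -/(v i.+1).
  suff : \sum_y marginal i y * ln (pv i.+1 y) <= 2^-1 * marginal_entropy i -
     (1 - \sum_x nu x * (marginal_root i x * \sum_y ph x y * marginal_root i.+1 y)).
    lra.
  rewrite -[X in _ - (X - _)](sum_marginal i) /marginal_entropy mulr_sumr -!sumrB.
  apply: ler_sum => y _.
  have -> : 2^-1 * (marginal i y * ln (marginal_density i y)) = marginal i y * ln (v i y).
    by rewrite ln_marginal_root; field.
  have -> : nu y * (marginal_root i y * \sum_z ph y z * marginal_root i.+1 z) =
     marginal i y * (pv i.+1 y / v i y).
    have -> : marginal i y = nu y * v i y ^+ 2.
      by rewrite marginal_root_sqr /marginal_density mulrC divfK// gt_eqF.
    by rewrite -/(v i y) -/(pv i.+1 y); field; rewrite gt_eqF.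
  rewrite -[X in _ - (X - _)]mulr1 -!mulrBr ler_pM2l ?marginal_gt0//.
  have -> : ln (pv i.+1 y) = ln (v i y) + ln (pv i.+1 y / v i y).
    by rewrite ln_div ?posrE//; lra.
  have r0 : 0 < pv i.+1 y / v i y by rewrite divr_gt0.
  have : ln (pv i.+1 y / v i y) <= pv i.+1 y / v i y - 1.
    have := @le_ln1Dx R (pv i.+1 y / v i y - 1).
    by rewrite addrCA subrr addr0; apply; lra.
  lra.
have tele : \sum_(0 <= i < M) (2^-1 * marginal_entropy i.+1 - 2^-1 * marginal_entropy i
     + (h * energy (v i.+1) - h ^+ 2 * curvature_cst)) =
   2^-1 * marginal_entropy M - 2^-1 * marginal_entropy 0 +
   (h * \sum_(0 <= i < M) energy (v i.+1) - M%:R * (h ^+ 2 * curvature_cst)).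
  rewrite big_split/= telescope_sumr// sumrB -mulr_sumr.
  by congr (_ + (_ - _)); rewrite sumr_const_nat subn0 mulr_natl.
have : \sum_(0 <= i < M) (2^-1 * marginal_entropy i.+1 - 2^-1 * marginal_entropy i
     + (h * energy (v i.+1) - h ^+ 2 * curvature_cst)) <=
     \sum_(0 <= i < M) (\sum_y marginal i.+1 y * ln (v i.+1 y) -
                       \sum_y marginal i y * ln (pv i.+1 y)).
  by apply: ler_sum => i _; exact: step.
rewrite tele -/v; lra.
Qed.

End TiltedChain.

Lemma discrete_gronwall (R : realType) (G : nat -> R) (a r : R) (N : nat) : 0 <= r ->
  (forall M, (M < N)%N -> G M <= a + r * \sum_(0 <= i < M) G i) ->
  forall M, (M <= N)%N -> a + r * \sum_(0 <= i < M) G i <= a * (1 + r) ^+ M.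
Proof.
move=> r0 HG; elim=> [|M IH] MN; first by rewrite big_geq// mulr0 addr0 expr0 mulr1.
rewrite big_nat_recr//= exprS.
have := IH (ltnW MN); have := HG _ MN; move: (_ ^+ M) (\sum_(0 <= _ < M) _) => e s; nra.
Qed.

Lemma young_entropy (R : realType) (a b : R) : 0 <= a ->
  a * b <= a * ln a - a + expR b.
Proof.
rewrite le_eqVlt => /orP[/eqP <-|a0]; first by rewrite !mul0r subr0 add0r expR_ge0.
have -> : expR b = a * expR (b - ln a) by rewrite expRB lnK ?posrE//; field; rewrite gt_eqF.
by have := expR_ge1Dx (b - ln a); nra.
Qed.

(** * Gronwall bound for additive functionals of the Euler chain *)

Section PathBound.
Variables (R : realType) (S : finType) (nu : S -> R) (A : S -> S -> R) (h : R) (N : nat).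
Hypothesis nu_gt0 : forall x, 0 < nu x.
Hypothesis nu_sum : \sum_x nu x = 1.
Hypothesis A_offdiag : forall x y, x != y -> 0 <= A x y.
Hypothesis A_row : forall x, \sum_y A x y = 0.
Hypothesis h_ge0 : 0 <= h.
Hypothesis h_small : forall x, 0 < 1 + h * A x x.
Implicit Types (x y : S) (u v f : S -> R).

Definition sq_entropy u : R := \sum_x nu x * (u x ^+ 2 * ln (u x ^+ 2)).

Definition positive_unit u := (forall x, 0 < u x) /\ \sum_x nu x * u x ^+ 2 = 1.

Lemma sq_entropy_ge0 u : positive_unit u -> 0 <= sq_entropy u.
Proof.
move=> [u0 u1].
have /= := @gibbs_variational R S nu (fun x => u x ^+ 2) (fun=> 0) 0.
have -> : \sum_x nu x * (u x ^+ 2 * 0) = 0 by rewrite big1// => x _; rewrite !mulr0.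
rewrite addr0; apply => //.
- by move=> x; exact: ltW.
- by move=> x; exact: sqr_ge0.
- by rewrite expR0 -mulr_suml nu_sum mulr1.
Qed.

Variables (D : (S -> R) -> R) (c b alpha beta : R) (W : nat -> S -> R).
Hypothesis D_ge0 : forall u, 0 <= D u.
Hypotheses (c_ge0 : 0 <= c) (b_ge0 : 0 <= b) (alpha_ge0 : 0 <= alpha) (beta_ge0 : 0 <= beta).
Hypothesis energy_ge : forall u, positive_unit u -> D u - c * sq_entropy u - b <= energy nu A u.
Hypothesis W_le : forall i u, positive_unit u ->
  `|\sum_x nu x * (W i x * u x ^+ 2)| <= alpha * (D u + sq_entropy u + beta).
Hypothesis ch : c * h <= 1 / 4.

Variable mu : S -> R.
Hypothesis mu_ge : forall x, nu x / 2 <= mu x.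
Hypothesis mu_sum : \sum_x mu x = 1.

Definition riemann_sum (p : S * N.-tuple S) : R :=
  h * \sum_(0 <= i < N) W i.+1 (site p i.+1).

Definition initial_cst : R := 4 + 3 / 2 * rel_entropy mu nu.

Definition gronwall_cst : R :=
  initial_cst + N%:R * h * b + N%:R * (h ^+ 2 * curvature_cst nu A).

Definition tilted_cst : R := alpha * (gronwall_cst +
  (c + 1) * (N%:R * h) * (4 * gronwall_cst * expR (4 * c * (N%:R * h))) + N%:R * h * beta).

Local Notation path_law := (@path_law R S A h mu N).

Let mu_gt0 x : 0 < mu x.
Proof. by apply: lt_le_trans (mu_ge x); rewrite divr_gt0. Qed.

Lemma curvature_cst_ge0 : 0 <= curvature_cst nu A.
Proof.
apply: mulr_ge0; first by rewrite invr_ge0.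
by apply: sumr_ge0 => x _; apply: mulr_ge0; [exact: ltW|exact: sqr_ge0].
Qed.

Section Tilted.
Variable Y : S * N.-tuple S -> R.
Hypothesis Y_bound : forall p, 1 / 3 <= Y p <= 3.
Hypothesis Y_sum : \sum_p path_law p * Y p = 1.
Local Notation q := (marginal A h mu Y).
Local Notation H := (marginal_entropy nu A h mu Y).
Local Notation v := (marginal_root nu A h mu Y).

Let Y_gt0 p : 0 < Y p.
Proof. by have /andP[+ _] := Y_bound p; apply: lt_le_trans; rewrite divr_gt0. Qed.

Let law_ge0 := path_law_ge0 A_offdiag h_ge0 h_small mu_gt0.

Lemma ln_le_sub1 (x : R) : 0 < x -> ln x <= x - 1.
Proof.
move=> x0; have := @le_ln1Dx R (x - 1); rewrite addrCA subrr addr0; apply; lra.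
Qed.

(** The bound [q <= 3 mu] on the tilted initial law cannot be inserted in the entropy where the
    logarithm is negative. The hypothesis [nu / 2 <= mu] makes [ln (2 mu / nu)] nonnegative, and the
    entropy is first compared with the mean of that logarithm. The path entropy is at most 2 because
    [ln Y <= Y - 1 <= 2]. *)
Lemma tilted_initial : 2^-1 * H 0%N + \sum_p path_law p * (Y p * ln (Y p)) <= initial_cst.
Proof.
have lnY p : ln (Y p) <= 2.
  by have /andP[_ Y3] := Y_bound p; have := ln_le_sub1 (Y_gt0 p); lra.
have h1 : \sum_p path_law p * (Y p * ln (Y p)) <= 2.
  apply: (@le_trans _ _ ((\sum_p path_law p * Y p) * 2)); last by rewrite Y_sum mul1r.
  rewrite mulr_suml; apply: ler_sum => p _; rewrite mulrA; apply: ler_wpM2l => //.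
  by apply: mulr_ge0; [exact: law_ge0|exact: ltW].
have q3 y : q 0%N y <= 3 * mu y.
  apply: (@le_trans _ _ (\sum_(p | site p 0 == y) path_law p * 3)).
    apply: ler_sum => p _; rewrite ler_wpM2l//.
    by have /andP[] := Y_bound p.
  rewrite -mulr_suml mulrC ler_pM2l//.
  rewrite (eq_bigl (fun p : S * N.-tuple S => (p.1 == y) && true)); last first.
    by move=> p; rewrite andbT.
  rewrite -(pair_big (fun x => x == y) xpredT (fun x s => path_law (x, s)))/= big_pred1_eq.
  under eq_bigr do rewrite /(path_law _)/=.
  rewrite -mulr_sumr sum_path_weight ?mulr1//.
  by move=> _ x; exact: sum_euler_kernel.
have q0 y : 0 < q 0%N y by exact: (marginal_gt0 A_offdiag h_ge0 h_small mu_gt0 Y_gt0).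
have q1 : \sum_y q 0%N y = 1 by exact: sum_marginal.
have H0 : H 0%N <= 1 / 2 + 3 * (1 + rel_entropy mu nu).
  have -> : 1 / 2 + 3 * (1 + rel_entropy mu nu) =
      \sum_y (q 0%N y * (1 / 2) + 3 * (mu y * (1 + ln (mu y / nu y)))).
    rewrite big_split/= -mulr_suml q1 -mulr_sumr /rel_entropy !mul1r; congr (_ + 3 * _).
    transitivity (\sum_y mu y + \sum_y mu y * ln (mu y / nu y)); first by rewrite mu_sum.
    by rewrite -big_split/=; apply: eq_bigr => y _; rewrite mulrDr mulr1.
  apply: ler_sum => y _.
  have mn : 1 <= 2 * mu y / nu y.
    by rewrite ler_pdivlMr// mul1r; have := mu_ge y; lra.
  have mn0 : 0 < mu y / nu y by rewrite divr_gt0.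
  have l2 : ln (2 * (mu y / nu y)) <= 1 + ln (mu y / nu y).
    have -> : ln (2 * (mu y / nu y)) = ln 2 + ln (mu y / nu y) by apply: lnM; rewrite posrE.
    rewrite lerD2r; have := @ln_le_sub1 2; lra.
  have l0 : 0 <= ln (2 * (mu y / nu y)) by rewrite ln_ge0// mulrA.
  have : ln (marginal_density nu A h mu Y 0 y) <= 1 / 2 + ln (2 * (mu y / nu y)).
    apply: (@le_trans _ _ (ln (3 / 2 * (2 * (mu y / nu y))))).
      have m0 : 0 < marginal_density nu A h mu Y 0 y by rewrite divr_gt0.
      rewrite ler_ln ?posrE//; last by apply: mulr_gt0; [lra|apply: mulr_gt0].
      rewrite /marginal_density ler_pdivrMr//.
      have -> : 3 / 2 * (2 * (mu y / nu y)) * nu y = 3 * mu y.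
        by field; rewrite gt_eqF.
      exact: q3.
    have -> : ln (3 / 2 * (2 * (mu y / nu y))) = ln (3 / 2) + ln (2 * (mu y / nu y)).
      by apply: lnM; rewrite posrE; [lra|exact: mulr_gt0].
    rewrite lerD2r.
    have := @ln_le_sub1 (3 / 2); lra.
  set L := ln (marginal_density _ _ _ _ _ _ _); set M := ln (2 * _) in l2 l0 *.
  set l := ln (mu y / nu y) in l2 *; move=> LM.
  have e1 : q 0%N y * L <= q 0%N y * (1 / 2 + M) by rewrite ler_pM2l.
  have e2 : q 0%N y * M <= 3 * mu y * M by rewrite ler_wpM2r.
  have e3 : mu y * M <= mu y * (1 + l) by rewrite ler_pM2l.
  by lra.
by rewrite /initial_cst; lra.
Qed.

Lemma tilted_unit i : positive_unit (v i).
Proof.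
split; first by move=> x; exact: (marginal_root_gt0 nu_gt0 A_offdiag h_ge0 h_small mu_gt0 Y_gt0).
exact: (sum_marginal_root nu_gt0 A_offdiag h_ge0 h_small mu_gt0 Y_gt0 Y_sum).
Qed.

Lemma tilted_entropyE i : H i = sq_entropy (v i).
Proof.
apply: eq_bigr => x _.
rewrite (marginal_root_sqr nu_gt0 A_offdiag h_ge0 h_small mu_gt0 Y_gt0) mulrA.
by congr (_ * _); rewrite /marginal_density mulrC divfK// gt_eqF.
Qed.

Lemma tilted_energy M : (M <= N)%N ->
  2^-1 * H M + h * \sum_(0 <= i < M) D (v i.+1) <=
  gronwall_cst + c * h * \sum_(0 <= i < M) H i.+1.
Proof.
move=> MN.
have := path_energy nu_gt0 A_offdiag A_row h_ge0 h_small mu_gt0 mu_sum Y_gt0 Y_sum MN.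
have := tilted_initial.
have : \sum_(0 <= i < M) (D (v i.+1) - c * H i.+1 - b) <= \sum_(0 <= i < M) energy nu A (v i.+1).
  apply: ler_sum => i _; rewrite tilted_entropyE.
  exact/energy_ge/tilted_unit.
rewrite !sumrB -mulr_sumr sumr_const_nat subn0 -(mulr_natl b).
have MN' : M%:R <= N%:R :> R by rewrite ler_nat.
have e1 : M%:R * (h * b) <= N%:R * (h * b) by rewrite ler_wpM2r// mulr_ge0.
have e2 : M%:R * (h ^+ 2 * curvature_cst nu A) <= N%:R * (h ^+ 2 * curvature_cst nu A).
  by rewrite ler_wpM2r// mulr_ge0 ?sqr_ge0// curvature_cst_ge0.
rewrite /gronwall_cst.
move: (\sum_(0 <= i < M) D _) (\sum_(0 <= i < M) energy _ _ _) (\sum_(0 <= i < M) H _).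
move: (\sum_p _) (H M) (H 0%N) => P HM H0 d e s le_e.
have : h * (d - c * s - M%:R * b) <= h * e by rewrite ler_wpM2l.
lra.
Qed.

Lemma gronwall_cst_ge0 : 0 <= gronwall_cst.
Proof.
have := tilted_energy (leq0n N); rewrite !big_geq// !mulr0 !addr0.
apply: le_trans; rewrite mulr_ge0 ?invr_ge0// tilted_entropyE.
exact/sq_entropy_ge0/tilted_unit.
Qed.

(** At time [M + 1] the right side of [tilted_energy] contains the entropy at that same time, with
    coefficient [c h <= 1 / 4]. It is absorbed on the left, where the coefficient drops from 1/2 to
    1/4; hence the factors 4. *)
Lemma tilted_entropy_le i : (i < N)%N ->
  H i.+1 <= 4 * gronwall_cst * expR (4 * c * (N%:R * h)).
Proof.
move=> iN.
have G0 := gronwall_cst_ge0.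
have Hg M : (M < N)%N -> H M.+1 <= 4 * gronwall_cst + 4 * c * h * \sum_(0 <= j < M) H j.+1.
  move=> MN; have := tilted_energy MN; rewrite !big_nat_recr//=.
  have HM0 : 0 <= H M.+1 by rewrite tilted_entropyE; exact/sq_entropy_ge0/tilted_unit.
  have : 0 <= h * (\sum_(0 <= j < M) D (v j.+1) + D (v M.+1)).
    by rewrite mulr_ge0// addr_ge0// sumr_ge0.
  have : c * h * H M.+1 <= 1 / 4 * H M.+1 by rewrite ler_wpM2r.
  move: (\sum_(0 <= j < M) D _) (\sum_(0 <= j < M) H _) (H M.+1) HM0 => *; lra.
have r0 : 0 <= 4 * c * h by rewrite !mulr_ge0.
have := discrete_gronwall r0 Hg (ltnW iN); have := Hg _ iN.
suff : (1 + 4 * c * h) ^+ i <= expR (4 * c * (N%:R * h)).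
  move: (_ ^+ i) (expR _) (\sum_(_ <= _ < _) _) => x y z xy h1 h2.
  apply: (le_trans h1); apply: (le_trans h2); rewrite ler_wpM2l// mulr_ge0//.
apply: (@le_trans _ _ (expR (4 * c * h) ^+ i)).
  apply: lerXn2r; rewrite ?nnegrE ?expR_ge0 ?expR_ge1Dx//.
  by rewrite addr_ge0.
rewrite -expRM_natl ler_expR.
have -> : 4 * c * (N%:R * h) = N%:R * (4 * c * h) by ring.
by rewrite ler_wpM2r// ler_nat ltnW.
Qed.

(** Once the entropies are bounded, [tilted_energy] at time [N] bounds the summed Dirichlet forms;
    both sums enter through [W_le]. *)
Lemma tilted_bound : `|\sum_p path_law p * (Y p * riemann_sum p)| <= tilted_cst.
Proof.
have G0 := gronwall_cst_ge0.
set E := 4 * gronwall_cst * expR (4 * c * (N%:R * h)).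
have E0 : 0 <= E by rewrite mulr_ge0 ?expR_ge0// mulr_ge0.
have sH : h * \sum_(0 <= i < N) H i.+1 <= N%:R * h * E.
  rewrite -mulrA mulrCA ler_wpM2l//.
  have -> : N%:R * E = \sum_(0 <= i < N) E by rewrite sumr_const_nat subn0 mulr_natl.
  by apply: ler_sum_nat => i /andP[_ iN]; exact: tilted_entropy_le.
have sD : h * \sum_(0 <= i < N) D (v i.+1) <= gronwall_cst + c * (N%:R * h * E).
  have := tilted_energy (leqnn N).
  have : 0 <= H N by rewrite tilted_entropyE; exact/sq_entropy_ge0/tilted_unit.
  have := ler_wpM2l c_ge0 sH; rewrite !mulrA.
  move: (h * \sum_(0 <= i < N) D _) => d; lra.
have -> : \sum_p path_law p * (Y p * riemann_sum p) =
    h * \sum_(0 <= i < N) \sum_x nu x * (W i.+1 x * v i.+1 x ^+ 2).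
  under eq_bigr do rewrite /riemann_sum mulrCA 2!mulr_sumr.
  under eq_bigr do rewrite mulr_sumr.
  rewrite exchange_big/= mulr_sumr; apply: eq_bigr => i _.
  have -> : \sum_x nu x * (W i.+1 x * v i.+1 x ^+ 2) = \sum_x q i.+1 x * W i.+1 x.
    apply: eq_bigr => x _.
    rewrite (marginal_root_sqr nu_gt0 A_offdiag h_ge0 h_small mu_gt0 Y_gt0).
    by rewrite /marginal_density; field; rewrite gt_eqF.
  rewrite -marginal_mean mulr_sumr; apply: eq_bigr => p _.
  by ring.
rewrite normrM ger0_norm//.
apply: (@le_trans _ _ (h * \sum_(0 <= i < N) alpha * (D (v i.+1) + H i.+1 + beta))).
  rewrite ler_wpM2l//; apply: (le_trans (ler_norm_sum _ _ _)).
  by apply: ler_sum => i _; rewrite tilted_entropyE; exact/W_le/tilted_unit.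
rewrite -mulr_sumr 2!big_split/= sumr_const_nat subn0 -(mulr_natl beta).
rewrite mulrCA /tilted_cst -/E ler_wpM2l// !mulrDr.
move: sH sD; move: (h * \sum_(0 <= i < N) D _) (h * \sum_(0 <= i < N) H _) => x y; lra.
Qed.

End Tilted.

(* A bound for tilted laws gives one for the absolute value: tilt by [2 + sgn X]. *)
Lemma path_bound : \sum_p path_law p * `|riemann_sum p| <= 5 * tilted_cst.
Proof.
pose s p : R := if 0 <= riemann_sum p then 1 else -1.
have law_ge0 := path_law_ge0 A_offdiag h_ge0 h_small mu_gt0 (N := N).
have law_sum : \sum_p path_law p = 1 by exact: sum_path_law.
pose Z := \sum_p path_law p * (2 + s p).
have s1 p : 1 <= 2 + s p <= 3 by rewrite /s; case: ifP => _; lra.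
have Z1 : 1 <= Z.
  rewrite -law_sum; apply: ler_sum => p _; rewrite -[leLHS]mulr1 ler_wpM2l//.
  by have /andP[] := s1 p.
have Z3 : Z <= 3.
  apply: (@le_trans _ _ ((\sum_p path_law p) * 3)); last by rewrite law_sum mul1r.
  rewrite mulr_suml; apply: ler_sum => p _; rewrite ler_wpM2l//.
  by have /andP[] := s1 p.
have b1 : `|\sum_p path_law p * ((2 + s p) / Z * riemann_sum p)| <= tilted_cst.
  apply: tilted_bound => [p|].
    have /andP[l u] := s1 p; rewrite ler_pdivlMr ?ler_pdivrMr; lra.
  under eq_bigr do rewrite mulrA; rewrite -mulr_suml -/Z divff//.
  by rewrite gt_eqF//; lra.
have b2 : `|\sum_p path_law p * (1 * riemann_sum p)| <= tilted_cst.
  apply: tilted_bound => [p|]; first lra.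
  by under eq_bigr do rewrite mulr1.
(* With [s] the sign of [X], [|X| = (2 + s) X - 2 X]; the tilted term has the factor [Z <= 3] and
   the trivial tilt the factor 2, hence 5. *)
have -> : \sum_p path_law p * `|riemann_sum p| =
    Z * (\sum_p path_law p * ((2 + s p) / Z * riemann_sum p)) -
    2 * \sum_p path_law p * (1 * riemann_sum p).
  rewrite !mulr_sumr -sumrB; apply: eq_bigr => p _.
  have -> : `|riemann_sum p| = s p * riemann_sum p.
    rewrite /s; case: ifP => [x0|/negbT]; first by rewrite mul1r ger0_norm.
    by rewrite -ltNge mulN1r => x0; rewrite ltr0_norm.
  field; lra.
have T0 : 0 <= tilted_cst by apply: le_trans b2.
move: b1 b2; rewrite !ler_norml => /andP[b1 b1'] /andP[b2 b2'].
move: b1 b1' b2 b2'; move: (\sum_p _) (\sum_p _) => x y *; nra.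
Qed.

End PathBound.

(** * From chains to the process *)

Section Semigroup.
Variables (R : realType) (S : finType) (A : S -> S -> R).
Let b : R := \sum_x \sum_y `|A x y|.

Let b_ge0 : 0 <= b.
Proof. by apply: sumr_ge0 => x _; apply: sumr_ge0. Qed.

Lemma iter_matrix_op_le (f : S -> R) k x : (forall y, `|f y| <= 1) ->
  `|iter k (matrix_op A) f x| <= b ^+ k.
Proof.
move=> f1; elim: k x => [|k IH] x /=; first by rewrite expr0.
apply: (le_trans (ler_norm_sum _ _ _)).
apply: (@le_trans _ _ (\sum_y `|A x y| * b ^+ k)).
  by apply: ler_sum => y _; rewrite normrM ler_wpM2l.
rewrite -mulr_suml exprS ler_wpM2r ?exprn_ge0// /b [leRHS](bigD1 x)//= lerDl.
by apply: sumr_ge0 => z _; apply: sumr_ge0.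
Qed.

(** As [h <= 1], each term of order at least 2 is at most [h ^+ 2] times the corresponding term of
    the series of [expR b]. *)
Lemma semigroup_remainder (f : S -> R) (h : R) x : (forall y, `|f y| <= 1) ->
  0 <= h <= 1 ->
  `|semigroup (matrix_op A) h f x - (f x + h * matrix_op A f x)| <= h ^+ 2 * expR b.
Proof.
move=> f1 /andP[h0 h1].
pose u k := h ^+ k / k`!%:R * iter k (matrix_op A) f x.
have uE k : `|u k| = h ^+ k * `|iter k (matrix_op A) f x| / k`!%:R.
  by rewrite /u normrM ger0_norm ?divr_ge0 ?exprn_ge0// mulrAC.
have f_gt0 k : 0 < (k`!%:R)^-1 :> R by rewrite invr_gt0 ltr0n fact_gt0.
have u_le k : `|u k| <= exp_coeff b k.
  rewrite uE /exp_coeff/= ler_pM2r// -[leRHS]mul1r.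
  by rewrite ler_pM ?exprn_ge0 ?exprn_ile1// iter_matrix_op_le.
have u_le2 k : `|u k.+2| <= h ^+ 2 * exp_coeff b k.+2.
  rewrite uE /exp_coeff mulrA ler_pM2r//.
  apply: ler_pM; rewrite ?exprn_ge0//; last exact: iter_matrix_op_le.
  by rewrite -addn2 exprD -[leRHS]mul1r ler_wpM2r ?sqr_ge0 ?exprn_ile1.
have cvg_u : cvgn (series u).
  apply: normed_cvg; apply: (series_le_cvg _ _ u_le) => //.
  - by move=> k; exact: exp_coeff_ge0.
  - exact: is_cvg_series_exp_coeff.
have partial n : `|series u n.+2 - (f x + h * matrix_op A f x)| <= h ^+ 2 * expR b.
  rewrite /series/= !big_nat_recl//= /u/= expr0 fact0 divr1 mul1r expr1 divr1.
  rewrite [X in `|X|](_ : _ = \sum_(0 <= i < n) u i.+2); last by rewrite /u; lra.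
  apply: (le_trans (ler_norm_sum _ _ _)).
  apply: (@le_trans _ _ (\sum_(0 <= i < n) h ^+ 2 * exp_coeff b i.+2)).
    by apply: ler_sum => i _.
  rewrite -mulr_sumr ler_wpM2l ?sqr_ge0//.
  apply: (@le_trans _ _ (series (exp_coeff b) n.+2)).
    rewrite /series/= !big_nat_recl//= addrA lerDr addr_ge0//; exact: exp_coeff_ge0.
  rewrite /expR; apply: nondecreasing_cvgn_le; last exact: is_cvg_series_exp_coeff.
  by apply/nondecreasing_seqP => k; rewrite seriesS lerDr exp_coeff_ge0.
have -> : semigroup (matrix_op A) h f x = limn (series u) by [].
have cl : (series u n.+2 - (f x + h * matrix_op A f x)) @[n --> \oo] -->
    limn (series u) - (f x + h * matrix_op A f x).
  apply: cvgB; last exact: cvg_cst.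
  by have := cvg_u; rewrite -(cvg_shiftn 2); under eq_fun do rewrite addn2.
rewrite ler_norml; apply/andP; split.
  rewrite -(cvg_lim _ cl)//; apply: limr_ge; first by apply/cvg_ex; eexists; exact: cl.
  by apply: nearW => n; have := partial n; rewrite ler_norml => /andP[].
rewrite -(cvg_lim _ cl)//; apply: limr_le; first by apply/cvg_ex; eexists; exact: cl.
by apply: nearW => n; have := partial n; rewrite ler_norml => /andP[].
Qed.

End Semigroup.

(** * Riemann sums of right-continuous functions *)

Section RiemannSums.
Variables (R : realType) (phi : R -> R) (t M : R).
Hypothesis t_gt0 : 0 < t.
Hypothesis phi_right : forall s, 0 <= s -> phi r @[r --> s^'+] --> phi s.
Hypothesis phi_bounded : forall s, 0 <= s <= 2 * t -> `|phi s| <= M.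
Local Notation leb := (@lebesgue_measure R).

Let h N : R := t / N.+1%:R.

Let h_gt0 N : 0 < h N.
Proof. by rewrite divr_gt0. Qed.

Let hN N : N.+1%:R * h N = t.
Proof. by rewrite /h mulrC divfK. Qed.

(** The right end of the cell of [s]. It lies strictly to the right of [s], so right continuity
    makes [phi (next N s)] converge to [phi s]. This also gives the measurability of [phi], as a
    limit of step functions. *)
Let next N s : R := (Num.truncn (s / h N)).+1%:R * h N.

Let cell N i : set R := [set` `[i%:R * h N, i.+1%:R * h N[].

Let in_cell N s : 0 <= s -> cell N (Num.truncn (s / h N)) s.
Proof.
move=> s0; have : 0 <= s / h N by rewrite divr_ge0// ltW.
by move/truncn_itv; rewrite ler_pdivlMr// ltr_pdivrMr// /cell/= in_itv.
Qed.

Let cell_uniq N i j s : cell N i s -> cell N j s -> i = j.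
Proof.
wlog ij : i j / (i <= j)%N => [H ci cj|].
  have [ij|/ltnW ij] := leqP i j; first exact: H.
  by apply/esym/H.
rewrite /cell/= !in_itv/= => /andP[_ si] /andP[sj _].
have := le_lt_trans sj si; rewrite ltr_pM2r// ltr_nat ltnS => ji.
by apply/eqP; rewrite eqn_leq ij.
Qed.

Let next_bound N s : 0 <= s -> s < next N s <= s + h N.
Proof.
move=> s0; have := in_cell N s0; rewrite /cell/= in_itv/= => /andP[l u].
rewrite /next u/=; rewrite -natr1 mulrDl mul1r; move: l; move: (_ * h N) => y; lra.
Qed.

Let step N s : R := phi (next N s).

Let stepE N s : 0 <= s < t ->
  step N s = \sum_(i < N.+1) phi (i.+1%:R * h N) * \1_(cell N i) s.
Proof.
move=> /andP[s0 st].
have kN : (Num.truncn (s / h N) < N.+1)%N.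
  have := in_cell N s0; rewrite /cell/= in_itv/= => /andP[l _].
  by have := le_lt_trans l st; rewrite -(hN N) ltr_pM2r// ltr_nat.
rewrite (bigD1 (Ordinal kN))//= [X in _ + X]big1 ?addr0; last first.
  move=> i; rewrite -val_eqE/= => ik; rewrite indicE memNset ?mulr0// => ci.
  by move/eqP: ik; apply; exact: cell_uniq ci (in_cell N s0).
by rewrite indicE mem_set ?mulr1//; exact: in_cell.
Qed.

Let cell_measurable N i : measurable (cell N i).
Proof. exact: measurable_itv. Qed.

Local Notation D := ([set` `[0, t[] : set R).

Let step_measurable N : measurable_fun D (step N).
Proof.
apply: (eq_measurable_fun (fun s => \sum_(i < N.+1) phi (i.+1%:R * h N) * \1_(cell N i) s)).
  by move=> s; rewrite inE/= in_itv/= => Ds; rewrite (stepE _ Ds).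
apply: measurable_sum => i.
by apply: measurable_funM => //; exact: measurable_indic.
Qed.

Let next_cvg s : 0 <= s -> next N s @[N --> \oo] --> s.
Proof.
move=> s0; apply: (@squeeze_cvgr _ _ _ _ (fun=> s) (fun N => s + h N)).
- by apply: nearW => N; have /andP[/ltW -> ->] := next_bound N s0.
- exact: cvg_cst.
- rewrite -[X in _ --> X]addr0; apply: cvgD; first exact: cvg_cst.
  rewrite -(mulr0 t); apply: cvgM; first exact: cvg_cst.
  exact: cvg_harmonic.
Qed.

Let step_cvg s : 0 <= s -> step N s @[N --> \oo] --> phi s.
Proof.
move=> s0; have /cvg_at_rightP := phi_right s0; apply; split; last exact: next_cvg.
by move=> N; have /andP[] := next_bound N s0.
Qed.

Let phi_measurable : measurable_fun D phi.
Proof.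
apply: (measurable_fun_cvg step_measurable) => s; rewrite /= in_itv/= => /andP[s0 _].
exact: step_cvg.
Qed.

Let step_bounded N s : 0 <= s < t -> `|step N s| <= M.
Proof.
move=> /andP[s0 st]; apply: phi_bounded.
have /andP[l u] := next_bound N s0; rewrite (le_trans s0 (ltW l))/=.
apply: (le_trans u); have : h N <= t by rewrite /h ler_pdivrMr// ler_peMr ?ler1n ?ltW.
by lra.
Qed.

Let leb_D : (leb D < +oo)%E.
Proof. by rewrite lebesgue_measure_itv/= lte_fin t_gt0 -EFinB ltry. Qed.

Let integral_step N :
  (\int[leb]_(s in D) (step N s)%:E)%E = (h N * \sum_(i < N.+1) phi (i.+1%:R * h N))%:E.
Proof.
transitivity (\int[leb]_(s in D) (\sum_(i < N.+1) (phi (i.+1%:R * h N))%:E * (\1_(cell N i) s)%:E))%E.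
  apply: eq_integral => s; rewrite inE/= in_itv/= => Ds; rewrite (stepE _ Ds).
  by rewrite -sumEFin; apply: eq_bigr => i _; rewrite EFinM.
have int1 i : leb.-integrable D (fun s => (\1_(cell N i) s)%:E).
  by apply: (integrableS measurableT) => //; exact: integrable_indic_itv.
rewrite integral_sum//; last by move=> i; exact: integrableZl.
rewrite mulr_sumr -sumEFin; apply: eq_bigr => i _.
rewrite integralZl// integral_indic//.
rewrite (_ : cell N i `&` D = cell N i); last first.
  apply: setIidl => s; rewrite /cell/= !in_itv/= => /andP[l u].
  apply/andP; split; first by apply: le_trans l; rewrite mulr_ge0// ltW.
  by apply: (lt_le_trans u); rewrite -(hN N) ler_pM2r// ler_nat.
have cellE : leb (cell N i) = (h N)%:E.
  rewrite /cell lebesgue_measure_itv/= lte_fin ltr_pM2r// ltr_nat ltnSn.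
  by rewrite -EFinB -mulrBl -natrB// subSnn mul1r.
by transitivity ((phi (i.+1%:R * h N))%:E * leb (cell N i))%E; rewrite // cellE -EFinM mulrC.
exact: cell_measurable.
Qed.

Lemma riemann_sum_cvg :
  h N * \sum_(i < N.+1) phi (i.+1%:R * h N) @[N --> \oo] -->
  (\int[leb]_(s in `[0, t]) phi s)%R.
Proof.
have mD : measurable D by exact: measurable_itv.
have M0 : 0 <= M.
  by apply: le_trans (phi_bounded (s := 0) _); rewrite ?lexx ?mulr_ge0// ltW.
have H1 : {ae leb, forall s, D s -> (step N s)%:E @[N --> \oo] --> (phi s)%:E}.
  apply: aeW => s; rewrite /= in_itv/= => /andP[s0 _].
  by apply: cvg_EFin; [exact: nearW|exact: step_cvg].
have H2 : leb.-integrable D (cst M%:E).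
  apply: (measurable_bounded_integrable (f := cst M)) => //.
  by exists M; split; [exact: num_real|move=> x Mx y _ /=; rewrite ger0_norm// ltW].
have H3 : {ae leb, forall s N, D s -> (`|(step N s)%:E| <= cst M%:E s)%E}.
  apply: aeW => s N; rewrite /= in_itv/= => Ds.
  by rewrite lee_fin step_bounded.
have [phi_int _ cvg] := @dominated_convergence _ _ R leb D mD
  (fun N s => (step N s)%:E) (fun s => (phi s)%:E) (cst M%:E)
  (fun N => measurableT_comp (@EFin_measurable _ setT) (step_measurable N))
  (measurableT_comp (@EFin_measurable _ setT) phi_measurable) H1 H2 H3.
rewrite -(Rintegral_itv_bndo_bndc phi_int) /Rintegral.
have fin : (\int[leb]_(s in D) (phi s)%:E)%E \is a fin_num by exact: integrable_fin_num.
move: cvg; rewrite -[X in _ --> X -> _](fineK fin) => /fine_cvg.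
by apply: cvg_trans; apply: near_eq_cvg; apply: nearW => N /=; rewrite integral_step.
Qed.

End RiemannSums.

(** * From the Euler chain to the continuous-time process *)

Section ProcessBound.
Variables (R : realType) (S : finType) (A : S -> S -> R) (mu : S -> R).
Hypothesis A_offdiag : forall x y, x != y -> 0 <= A x y.
Hypothesis A_row : forall x, \sum_y A x y = 0.
Hypothesis mu_pmf : is_pmf mu.
Variables (dsp : measure_display) (Omega : measurableType dsp) (P : probability Omega R).
Variable X : R -> Omega -> S.
Hypothesis chain : markov_chain (matrix_op A) mu P X.
Variables (F : R -> S -> R) (t M : R).
Hypothesis t_gt0 : 0 < t.
Hypothesis F_right : forall x s, 0 <= s -> F r x @[r --> s^'+] --> F s x.
Hypothesis F_bounded : forall x s, 0 <= s <= 2 * t -> `|F s x| <= M.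

Let h N : R := t / N.+1%:R.

Let h_gt0 N : 0 < h N.
Proof. by rewrite divr_gt0. Qed.

Let hN N : N.+1%:R * h N = t.
Proof. by rewrite /h mulrC divfK. Qed.

Let M_ge0 (x : S) : 0 <= M.
Proof. by apply: le_trans (F_bounded x (s := 0) _); rewrite ?lexx ?mulr_ge0// ltW. Qed.

Let rsum N (p : S * N.+1.-tuple S) : R :=
  h N * \sum_(0 <= i < N.+1) F (i.+1%:R * h N) (site p i.+1).

Let path N w : S * N.+1.-tuple S := (X 0 w, [tuple X (i.+1%:R * h N) w | i < N.+1]).

Let site_path N w i : (i <= N.+1)%N -> site (path N w) i = X (i%:R * h N) w.
Proof.
case: i => [|i] iN; first by rewrite mul0r.
rewrite /site/= (nth_map (Ordinal iN)) ?size_enum_ord//.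
by rewrite nth_enum_ord.
Qed.

Let cyl N (p : S * N.+1.-tuple S) : set Omega :=
  [set w | forall i, (i <= N.+1)%N -> X (i%:R * h N) w = site p i].

Let cylE N p w : cyl p w <-> path N w = p.
Proof.
split=> [cw|<- i iN]; last by rewrite site_path.
case: p cw => x s cw; congr pair; first by have := cw 0%N isT; rewrite mul0r.
apply: eq_from_tnth => i; rewrite tnth_mktuple.
by rewrite (cw i.+1)// /site/= -tnth_nth.
Qed.

Let cyl_measurable N (p : S * N.+1.-tuple S) : measurable (cyl p).
Proof.
have -> : cyl p = \bigcap_(i in `I_N.+2) [set w | X (i%:R * h N) w = site p i].
  by apply/seteqP; split => [w cw i /= iN|w cw i iN]; exact: cw.
apply: fin_bigcap_measurable => [|i _]; first exact: finite_II.
by apply: (mc_measurable chain); rewrite mulr_ge0// ltW.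
Qed.

Let kernel N x y : R := semigroup (matrix_op A) (h N) (fun z => (z == y)%:R) x.

Let cyl_prob N (p : S * N.+1.-tuple S) :
  P (cyl p) = (mu p.1 * path_weight (fun=> kernel N) 0 p.1 p.2)%:E.
Proof.
have := @mc_finite_dim _ _ _ _ _ _ _ _ chain N.+1 (fun i => i%:R * h N) (site p).
move=> -> //; last 2 first.
- by rewrite mul0r.
- by move=> i _; rewrite ler_pM2r// ler_nat.
rewrite path_weightE size_tuple; congr (_ * _)%:E; apply: eq_big_nat => i _.
by rewrite -mulrBl -natrB// subSnn mul1r.
Qed.

Let rsum_le N (p : S * N.+1.-tuple S) : `|rsum p| <= t * M.
Proof.
rewrite normrM ger0_norm ?(ltW (h_gt0 N))//.
apply: (@le_trans _ _ (h N * \sum_(0 <= i < N.+1) M)).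
  rewrite ler_wpM2l ?(ltW (h_gt0 N))//; apply: (le_trans (ler_norm_sum _ _ _)).
  apply: ler_sum_nat => i /andP[_ iN]; apply: F_bounded.
  rewrite mulr_ge0 ?(ltW (h_gt0 N))//=; apply: (@le_trans _ _ (N.+1%:R * h N)).
    by rewrite ler_pM2r// ler_nat.
  by rewrite hN ler_peMl ?ler1n ?ltW.
by rewrite sumr_const_nat subn0 -mulr_natl mulrA (mulrC (h N)) hN.
Qed.

Let rsum_indic N w : `|rsum (path N w)| =
  \sum_(p : S * N.+1.-tuple S) `|rsum p| * \1_(cyl p) w.
Proof.
rewrite (bigD1 (path N w))//= indicE mem_set ?mulr1; last exact/cylE.
rewrite big1 ?addr0// => p pw; rewrite indicE memNset ?mulr0// => /cylE.
by move=> E; rewrite E eqxx in pw.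
Qed.

Let rsum_measurable N : measurable_fun setT (fun w => `|rsum (path N w)|).
Proof.
under eq_fun do rewrite rsum_indic.
by apply: measurable_sum => p; apply: measurable_funM => //; exact: measurable_indic.
Qed.

Let integral_rsum N : (\int[P]_w (`|rsum (path N w)|)%:E)%E =
  (\sum_(p : S * N.+1.-tuple S) mu p.1 * path_weight (fun=> kernel N) 0 p.1 p.2 * `|rsum p|)%:E.
Proof.
transitivity (\int[P]_w (\sum_(p : S * N.+1.-tuple S) (`|rsum p|)%:E * (\1_(cyl p) w)%:E))%E.
  apply: eq_integral => w _; rewrite rsum_indic -sumEFin.
  by apply: eq_bigr => p _; rewrite EFinM.
have int1 (p : S * N.+1.-tuple S) : P.-integrable setT (fun w => (\1_(cyl p) w)%:E).
  exact: integrable_indic.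
rewrite integral_sum//; last by move=> p; exact: integrableZl.
rewrite -sumEFin; apply: eq_bigr => p _.
by rewrite integralZl// integral_indic// setIT [X in (_ * X)%E]cyl_prob -EFinM mulrC.
Qed.

Let rsum_cvg w : `|rsum (path N w)| @[N --> \oo] -->
  `| (\int[lebesgue_measure]_(s in `[0, t]) F s (X s w))%R |.
Proof.
have right s : 0 <= s -> F r (X r w) @[r --> s^'+] --> F s (X s w).
  move=> s0; apply: (cvg_trans _ (@F_right (X s w) s s0)).
  apply: near_eq_cvg.
  by have := mc_right_continuous chain w s0; apply: filterS => r ->.
have bnd s : 0 <= s <= 2 * t -> `|F s (X s w)| <= M by exact: F_bounded.
have E := cvg_norm (riemann_sum_cvg t_gt0 right bnd); apply: (cvg_trans _ (E _)).
apply: near_eq_cvg; apply: nearW => N; rewrite /rsum big_mkord; congr (`|_ * _|).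
by apply: eq_bigr => i _; rewrite site_path.
Qed.

Let h_cvg0 : h N @[N --> \oo] --> 0.
Proof. by rewrite -(mulr0 t); apply: cvgM; [exact: cvg_cst|exact: cvg_harmonic]. Qed.

Let b : R := \sum_x \sum_y `|A x y|.

Let b_ge0 : 0 <= b.
Proof. by apply: sumr_ge0 => x _; apply: sumr_ge0. Qed.

Let diag_le x : `|A x x| <= b.
Proof.
rewrite /b (bigD1 x)//= (bigD1 x)//= -addrA lerDl addr_ge0//; first exact: sumr_ge0.
by apply: sumr_ge0 => y _; exact: sumr_ge0.
Qed.

Let eps N : R := #|S|%:R * (h N ^+ 2 * expR b).

Let kernel_dist N x : h N <= 1 ->
  \sum_y `|kernel N x y - euler_kernel A (h N) x y| <= eps N.
Proof.
move=> h1; rewrite /eps -sum_cst; apply: ler_sum => y _.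
have := @semigroup_remainder _ _ A (fun z => (z == y)%:R) (h N) x.
rewrite (ltW (h_gt0 N)) h1 => H; apply: le_trans (H _ isT); last first.
  by move=> z; case: eqP => _; rewrite ?normr1 ?normr0.
rewrite /kernel /euler_kernel /matrix_op (bigD1 y)//= eqxx mulr1 big1 ?addr0//.
by move=> z /negbTE ->; rewrite mulr0.
Qed.

Let rsum_mean_le N : h N * (b + 1) < 1 ->
  \sum_(p : S * N.+1.-tuple S) mu p.1 * path_weight (fun=> kernel N) 0 p.1 p.2 * `|rsum p| <=
  \sum_(p : S * N.+1.-tuple S) path_law A (h N) mu p * `|rsum p|
  + t * M * (expR (t * h N * (#|S|%:R * expR b)) - 1).
Proof.
move=> hb; have [mu0 mu1] := mu_pmf.
have h1 : h N <= 1 by have := h_gt0 N; have := b_ge0; nra.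
have hA x : 0 < 1 + h N * A x x.
  have := diag_le x; rewrite ler_norml => /andP[Ax _].
  have := h_gt0 N; nra.
have e0 : 0 <= eps N by rewrite mulr_ge0// mulr_ge0 ?sqr_ge0 ?expR_ge0.
rewrite -lerBlDl -sumrB.
apply: (@le_trans _ _ (\sum_(p : S * N.+1.-tuple S) mu p.1 *
   `|path_weight (fun=> kernel N) 0 p.1 p.2 - path_weight (fun=> euler_kernel A (h N)) 0 p.1 p.2|
   * (t * M))).
  apply: ler_sum => p _; rewrite /path_law -mulrBl -mulrBr.
  apply: (@le_trans _ _ (mu p.1 *
   `|path_weight (fun=> kernel N) 0 p.1 p.2 - path_weight (fun=> euler_kernel A (h N)) 0 p.1 p.2|
   * `|rsum p|)).
    by rewrite ler_wpM2r// ler_wpM2l// ler_norm.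
  by rewrite ler_wpM2l// mulr_ge0.
rewrite -mulr_suml mulrC.
have [x0] : inhabited S.
  apply: contrapT => nS; move: mu1; rewrite big1 => [/eqP|x]; last by case: nS; exact: inhabits x.
  by rewrite eq_sym oner_eq0.
rewrite ler_wpM2l ?mulr_ge0 ?(M_ge0 x0) ?(ltW t_gt0)//.
rewrite -(pair_big xpredT xpredT (fun x (s : N.+1.-tuple S) => mu x *
  `|path_weight (fun=> kernel N) 0 x s - path_weight (fun=> euler_kernel A (h N)) 0 x s|))/=.
apply: (@le_trans _ _ (\sum_x mu x * ((1 + eps N) ^+ N.+1 - 1))).
  apply: ler_sum => x _; rewrite -mulr_sumr ler_wpM2l//.
  apply: path_weight_dist => // _ y; first by move=> z; exact: euler_kernel_ge0 A_offdiag (ltW (h_gt0 N)) hA _ _.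
    exact: sum_euler_kernel.
  exact: kernel_dist.
rewrite -mulr_suml mu1 mul1r lerD2r.
apply: (@le_trans _ _ (expR (eps N) ^+ N.+1)).
  by apply: lerXn2r; rewrite ?nnegrE ?expR_ge0 ?addr_ge0// expR_ge1Dx.
rewrite -expRM_natl ler_expR /eps -(hN N) le_eqVlt; apply/orP; left; apply/eqP; ring.
Qed.

(** Riemann sums converge along every path, and domination by [t * M] carries this to expectations.
    Replacing the law of the sampled process by that of the Euler chain costs a multiple of
    [(1 + eps N) ^+ N.+1 - 1] with [eps N] of order [h N ^+ 2], which vanishes with the mesh. *)
Lemma process_bound (B : nat -> R) (B0 : R) : B N @[N --> \oo] --> B0 ->
  (\forall N \near \oo, \sum_(p : S * N.+1.-tuple S) path_law A (h N) mu p *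
     `|h N * \sum_(0 <= i < N.+1) F (i.+1%:R * h N) (site p i.+1)| <= B N) ->
  ('E_P[fun w => (`| \int[lebesgue_measure]_(s in `[0, t]) F s (X s w) |)%R] <= B0%:E)%E.
Proof.
move=> B_cvg HB; rewrite unlock.
pose f N w := (`|rsum (path N w)|)%:E : \bar R.
pose g w := (`| (\int[lebesgue_measure]_(s in `[0, t]) F s (X s w))%R |)%:E : \bar R.
have mf N : measurable_fun setT (f N) by apply/measurable_EFinP; exact: rsum_measurable.
have mg : measurable_fun setT g.
  by apply/measurable_EFinP; apply: (measurable_fun_cvg rsum_measurable) => w _; exact: rsum_cvg.
have H1 : {ae P, forall w, setT w -> f N w @[N --> \oo] --> g w}.
  by apply: aeW => w _; apply: cvg_EFin; [exact: nearW|exact: rsum_cvg].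
have H2 : P.-integrable setT (EFin \o cst (t * M)) by exact: finite_measure_integrable_cst.
have H3 : {ae P, forall w N, setT w -> (`|f N w| <= (EFin \o cst (t * M)%R) w)%E}.
  by apply: aeW => w N _; rewrite lee_fin normr_id rsum_le.
have [_ _ cvg] := dominated_convergence measurableT mf mg H1 H2 H3.
pose C N := B N + t * M * (expR (t * h N * (#|S|%:R * expR b)) - 1).
have C_cvg : (C N)%:E @[N --> \oo] --> B0%:E.
  apply: cvg_EFin; first exact: nearW.
  rewrite -[X in _ --> X]addr0; apply: cvgD => //.
  rewrite -(mulr0 (t * M)); apply: cvgM; first exact: cvg_cst.
  rewrite -[X in _ --> X](subrr 1); apply: cvgB; last exact: cvg_cst.
  rewrite -[X in _ --> X](@expR0 R); apply: continuous_cvg; first exact: continuous_expR.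
  rewrite -(mul0r (#|S|%:R * expR b)); apply: cvgM; last exact: cvg_cst.
  by rewrite -(mulr0 t); apply: cvgM; [exact: cvg_cst|exact: h_cvg0].
rewrite -(cvg_lim _ cvg)// -(cvg_lim _ C_cvg)//.
apply: lee_lim; [by apply/cvg_ex; eexists; exact: cvg|by apply/cvg_ex; eexists; exact: C_cvg|].
near=> N; rewrite /= integral_rsum lee_fin.
apply: le_trans (rsum_mean_le _) _.
  rewrite -ltr_pdivlMr ?ltr_wpDl// mul1r; near: N.
  by apply: (cvgr_lt _ h_cvg0); rewrite invr_gt0 ltr_wpDl.
by rewrite lerD2r; near: N.
Unshelve. all: by end_near.
Qed.

End ProcessBound.

(** * The generator on the torus *)

Section TorusProjection.
Variables (d n : nat).
Hypothesis n_gt1 : (1 < n)%N.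

Lemma proj_torus0 : proj_torus n (0 : lattice d) = 0.
Proof. by apply/rowP => j; rewrite !mxE. Qed.

Lemma proj_torusD (u v : lattice d) : proj_torus n (u + v) = proj_torus n u + proj_torus n v.
Proof. by apply/rowP => j; rewrite !mxE rmorphD. Qed.

Lemma proj_torusN (u : lattice d) : proj_torus n (- u) = - proj_torus n u.
Proof. by apply/rowP => j; rewrite !mxE rmorphN. Qed.

Lemma proj_torusB (u v : lattice d) : proj_torus n (u - v) = proj_torus n u - proj_torus n v.
Proof. by rewrite proj_torusD proj_torusN. Qed.

Lemma proj_torus_unit (j : 'I_d) : proj_torus n (unit_vec int j) = unit_vec 'Z_n j.
Proof. by apply/rowP => k; rewrite !mxE; case: (_ && _). Qed.

Lemma intr_Zp_eq0 (k : int) : (`|k| < n)%N -> (k%:~R : 'Z_n) = 0 -> k = 0.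
Proof.
have nat_eq0 m : (m < n)%N -> (m%:R : 'Z_n) = 0 -> m = 0%N.
  by move=> mn /(congr1 val); rewrite /= val_Zp_nat// modn_small.
case: k => m /= mn; first by move/nat_eq0 => ->.
by rewrite NegzE mulrNz => /eqP; rewrite oppr_eq0 => /eqP/nat_eq0-/(_ mn).
Qed.

Lemma proj_torus_inj (u v : lattice d) : (forall j, (`|u 0%R j - v 0%R j| < n)%N) ->
  proj_torus n u = proj_torus n v -> u = v.
Proof.
move=> uv /rowP puv; apply/rowP => j; apply/eqP; rewrite -subr_eq0; apply/eqP.
apply: intr_Zp_eq0 => //; rewrite rmorphB /=.
by have := puv j; rewrite !mxE => ->; rewrite subrr.
Qed.

Lemma card_torus : #|torus d n| = (n ^ d)%N.
Proof. by rewrite card_mx mul1n card_ord Zp_cast. Qed.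

Lemma torus_norm0 : torus_norm (0 : torus d n) = 0%N.
Proof. by rewrite /torus_norm big1// => j _; rewrite mxE min0n. Qed.

Lemma torus_norm1 (v : torus d n) : torus_norm v = 1%N ->
  exists j, v = unit_vec 'Z_n j \/ v = - unit_vec 'Z_n j.
Proof.
move=> v1; have vn j : (v 0%R j < n)%N by have := ltn_ord (v 0%R j); rewrite [X in (_ < X)%N -> _]Zp_cast.
have [j vj] : exists j, minn (v 0%R j) (n - v 0%R j) != 0%N.
  apply/existsP; apply: contraTT isT; rewrite negb_exists => /forallP v0.
  move: v1; rewrite /torus_norm big1// => j _.
  by have := v0 j; rewrite negbK => /eqP.
exists j; move: v1; rewrite /torus_norm (bigD1 j)//= => v1.
have vj1 : minn (v 0%R j) (n - v 0%R j) = 1%N by lia.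
move/eqP: v1; rewrite vj1 add1n eqSS sum_nat_eq0 => /forallP v0.
have {}v0 i : i != j -> v 0%R i = 0.
  move=> ij; have /implyP/(_ ij)/eqP := v0 i; have := vn i => ? m0.
  by apply/val_inj => /=; lia.
have := vn j => vnj.
have [e|e] : (v 0%R j : nat) = 1%N \/ (v 0%R j : nat) = n.-1 by lia.
  left; apply/rowP => i; rewrite !mxE eqxx/=; have [->|ij] := eqVneq i j; last exact: v0.
  by apply/val_inj; rewrite /= e modn_small// Zp_cast.
right; apply/rowP => i; rewrite !mxE eqxx/=; have [->|ij] := eqVneq i j; last first.
  by rewrite oppr0 v0.
apply/val_inj; rewrite /= e !Zp_cast// (modn_small n_gt1) modn_small; lia.
Qed.

End TorusProjection.

(** * Generators as rate matrices *)

Section JumpMatrix.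
Variables (R : realType) (S : finType).

Definition jump_matrix (L : (S -> R) -> S -> R) x y : R := L (fun z => (z == y)%:R) x.

Variables (K : finType) (r : K -> S -> R) (s : K -> S -> S) (L : (S -> R) -> S -> R).
Hypothesis r_ge0 : forall k x, 0 <= r k x.
Hypothesis LE : forall f x, L f x = \sum_k r k x * (f (s k x) - f x).

Lemma jump_matrix_offdiag x y : x != y -> 0 <= jump_matrix L x y.
Proof.
move=> /negbTE xy; rewrite /jump_matrix LE; apply: sumr_ge0 => k _.
by rewrite xy subr0 mulr_ge0.
Qed.

Lemma jump_matrix_op f : matrix_op (jump_matrix L) f = L f.
Proof.
apply/funext => x; rewrite /matrix_op /jump_matrix LE.
under eq_bigr do rewrite LE mulr_suml.
rewrite exchange_big/=; apply: eq_bigr => k _.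
under eq_bigr do rewrite -mulrA mulrBl.
rewrite -mulr_sumr sumrB; congr (_ * (_ - _)).
  by rewrite (bigD1 (s k x))//= eqxx mul1r big1 ?addr0// => y /negbTE; rewrite eq_sym => ->; rewrite mul0r.
by rewrite (bigD1 x)//= eqxx mul1r big1 ?addr0// => y /negbTE; rewrite eq_sym => ->; rewrite mul0r.
Qed.

Lemma jump_matrix_row x : \sum_y jump_matrix L x y = 0.
Proof.
transitivity (matrix_op (jump_matrix L) (fun=> 1) x).
  by apply: eq_bigr => y _; rewrite mulr1.
by rewrite jump_matrix_op LE big1// => k _; rewrite subrr mulr0.
Qed.

End JumpMatrix.

(** Exchanges and flips form one family over a finite type; ordered pairs that are not neighbours
    are kept, with rate 0. *)
Definition jump_rate (R : realType) (d n : nat) (c : 'I_d -> cylinder d R) (a : R)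
    (k : (torus d n * 'I_d) + (torus d n * torus d n)) (eta : config d n) : R :=
  match k with
  | inl p => n%:R ^+ 2 * c p.2 (periodic_ext (tshift p.1 eta))
  | inr p => a * ((torus_norm (p.2 - p.1) == 1%N)%:R * ((eta p.2)%:R - (eta p.1)%:R) ^+ 2)
  end.

Definition jump_target (d n : nat) (k : (torus d n * 'I_d) + (torus d n * torus d n))
    (eta : config d n) : config d n :=
  match k with
  | inl p => swap p.1 (p.1 + unit_vec _ p.2) eta
  | inr p => flip p.1 eta
  end.

Lemma gen_jump_form (R : realType) (d n : nat) (c : 'I_d -> cylinder d R) (a : R) f eta :
  @stirring_voter_gen d n R c a f eta =
  \sum_k jump_rate c a k eta * (f (jump_target k eta) - f eta).
Proof.
rewrite big_sumType/= /stirring_voter_gen; congr (_ + _).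
  rewrite /gen_stirring mulr_sumr.
  rewrite -(pair_bigA _ (fun x j => n%:R ^+ 2 * c j (periodic_ext (tshift x eta)) *
     (f (swap x (x + unit_vec _ j) eta) - f eta)))/=.
  apply: eq_bigr => x _; rewrite mulr_sumr; apply: eq_bigr => j _.
  by rewrite mulrA.
rewrite /gen_voter mulr_sumr.
rewrite -(pair_bigA _ (fun x y => a * ((torus_norm (y - x) == 1%N)%:R * ((eta y)%:R - (eta x)%:R) ^+ 2) *
     (f (flip x eta) - f eta)))/=.
apply: eq_bigr => x _; rewrite mulr_sumr big_mkcond/=; apply: eq_bigr => y _.
by case: eqP => _; rewrite ?mul1r ?mul0r ?mulr0 ?mul0r// mulrA.
Qed.

Section Energy.
Variables (R : realType) (d n : nat) (rho : R) (c : 'I_d -> cylinder d R) (c0 a : R).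
Hypothesis rho01 : 0 < rho < 1.
Hypothesis n_gt1 : (1 < n)%N.
Hypotheses (c0_gt0 : 0 < c0) (a_ge0 : 0 <= a).
Hypothesis c_ge : forall j eta, c0 <= c j eta.
Hypothesis c_0 : forall j, independent_of (c j) 0.
Hypothesis c_e : forall j, independent_of (c j) (unit_vec int j).
Hypothesis c_small : forall j z k, z \in cyl_supp (c j) -> (`|z 0%R k|.+1 < n)%N.
Local Notation T := (torus d n).
Local Notation mean := (@mean R T rho).
Local Notation A := (jump_matrix (@stirring_voter_gen d n R c a)).
Local Notation form := (exchange_form rho (unit_vec 'Z_n (d := d))).

Definition voter_potential (eta : config d n) : R :=
  \sum_x \sum_(y | torus_norm (y - x) == 1%N) centered rho eta x * centered rho eta y.

Lemma jump_rate_ge0 k (eta : config d n) : 0 <= jump_rate c a k eta.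
Proof.
case: k => p /=; first by rewrite mulr_ge0 ?sqr_ge0// (le_trans (ltW c0_gt0)).
by apply: mulr_ge0 => //; apply: mulr_ge0; rewrite ?sqr_ge0.
Qed.

Lemma gen_offdiag (x y : config d n) : x != y -> 0 <= A x y.
Proof. exact: jump_matrix_offdiag jump_rate_ge0 (gen_jump_form c a) _ _. Qed.

Lemma gen_row (x : config d n) : \sum_y A x y = 0.
Proof. exact: jump_matrix_row (gen_jump_form c a) _. Qed.

Lemma gen_op : matrix_op A = @stirring_voter_gen d n R c a.
Proof. by apply/funext => f; exact: jump_matrix_op (gen_jump_form c a) _. Qed.

Lemma rate_swap j (x : T) (eta : config d n) :
  c j (periodic_ext (tshift x (swap x (x + unit_vec _ j) eta))) =
  c j (periodic_ext (tshift x eta)).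
Proof.
set xi' := periodic_ext _; set xi := periodic_ext _.
(* Independence is given for one site at a time, so the configuration is altered first at [e_j] and
   then at 0. The other sites of the support project neither to 0 nor to [e_j], by [c_small]. *)
pose z1 z := if z == unit_vec int j then xi' z else xi z.
pose z2 z := if z == 0 then xi' z else z1 z.
have e1 : c j z1 = c j xi by apply: c_e => z /negbTE zj; rewrite /z1 zj.
have e2 : c j z2 = c j z1 by apply: c_0 => z /negbTE z0; rewrite /z2 z0.
rewrite -e1 -e2; apply: cyl_suppP => z zs; rewrite /z2 /z1.
have [//|z0] := eqVneq z 0; have [//|zj] := eqVneq z (unit_vec int j).
rewrite /xi' /xi /periodic_ext !ffunE tpermD//.
  apply: contra_neq z0 => /esym/eqP; rewrite -subr_eq0 addrAC subrr add0r => /eqP pz.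
  apply: (@proj_torus_inj d n n_gt1); last by rewrite pz proj_torus0.
  by move=> k; rewrite mxE subr0; apply: ltnW; exact: c_small zs.
apply: contra_neq zj => /addrI; rewrite -proj_torus_unit => /esym.
apply: proj_torus_inj => // k; rewrite !mxE.
have := c_small k zs; move: (z 0%R k) => m; case: (_ && _) => /=; lia.
Qed.

(** The stirring part is symmetric because the rates ignore the exchanged spins, which gives half of
    the squared increments. In the voter part, [(p - q) q <= (p^2 - q^2) / 2] leaves the generator
    applied to [u ^+ 2], whose mean is the potential by [voter_adjoint]. *)
Lemma energy_lower_bound (u : config d n -> R) :
  n%:R ^+ 2 * (c0 / 2) * form u -
  a / (2 * (rho * (1 - rho))) * mean (fun eta => voter_potential eta * u eta ^+ 2) <=
  energy (bernoulli_prod rho) A u.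
Proof.
have /andP[r0 r1] := rho01.
have -> : energy (bernoulli_prod rho) A u =
    n%:R ^+ 2 * - mean (fun eta => gen_stirring c u eta * u eta) +
    a * - mean (fun eta => gen_voter u eta * u eta).
  rewrite /energy gen_op !mulrN -!meanZ -opprD -meanD; congr (- _).
  by apply: eq_bigr => eta _; rewrite /stirring_voter_gen; ring.
have stir : c0 / 2 * form u <= - mean (fun eta => gen_stirring c u eta * u eta).
  have -> : - mean (fun eta => gen_stirring c u eta * u eta) =
      \sum_x \sum_j mean (fun eta => c j (periodic_ext (tshift x eta)) *
        (u (swap x (x + unit_vec _ j) eta) - u eta) ^+ 2) / 2.
    rewrite -meanN (@eq_mean R T rho _ (fun eta => \sum_x \sum_j - (c j (periodic_ext (tshift x eta)) *
        (u (swap x (x + unit_vec _ j) eta) - u eta) * u eta))); last first.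
      move=> eta; rewrite /gen_stirring mulr_suml -sumrN; apply: eq_bigr => x _.
      by rewrite mulr_suml -sumrN.
    rewrite mean_sum; apply: eq_bigr => x _; rewrite mean_sum; apply: eq_bigr => j _.
    rewrite meanN mean_sub_swap ?opprK// => eta; exact: rate_swap.
  rewrite mulr_sumr; apply: ler_sum => x _; rewrite mulr_sumr; apply: ler_sum => j _.
  rewrite mulrAC ler_pM2r// -meanZ; apply: le_mean => // eta.
  by rewrite ler_wpM2r ?sqr_ge0.
have vot : - ((2 * (rho * (1 - rho)))^-1 * mean (fun eta => voter_potential eta * u eta ^+ 2)) <=
    - mean (fun eta => gen_voter u eta * u eta).
  rewrite lerN2.
  have -> : (2 * (rho * (1 - rho)))^-1 * mean (fun eta => voter_potential eta * u eta ^+ 2) =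
    \sum_(x : T) \sum_(y | torus_norm (y - x) == 1%N)
      2^-1 * mean (fun eta => ((eta y)%:R - (eta x)%:R) ^+ 2 * (u (flip x eta) ^+ 2 - u eta ^+ 2)).
    rewrite invfM -mulrA -[in LHS]meanZ -[LHS]meanZ /voter_potential.
    transitivity (mean (fun eta => \sum_(x : T) \sum_(y | torus_norm (y - x) == 1%N)
      2^-1 * ((rho * (1 - rho))^-1 * (centered rho eta x * centered rho eta y * u eta ^+ 2)))).
      apply: eq_mean => eta; rewrite mulr_suml 2!mulr_sumr; apply: eq_bigr => x _.
      by rewrite mulr_suml 2!mulr_sumr.
    rewrite mean_sum; apply: eq_bigr => x _; rewrite mean_sum; apply: eq_bigr => y yx.
    rewrite 2!meanZ (voter_adjoint rho01 (fun eta => u eta ^+ 2))//.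
    by apply: contraTneq yx => ->; rewrite subrr torus_norm0.
  rewrite (@eq_mean R T rho _ (fun eta => \sum_(x : T) \sum_(y | torus_norm (y - x) == 1%N)
     ((eta y)%:R - (eta x)%:R) ^+ 2 * (u (flip x eta) - u eta) * u eta)); last first.
    by move=> eta; rewrite /gen_voter mulr_suml; apply: eq_bigr => x _; rewrite mulr_suml.
  rewrite mean_sum; apply: ler_sum => x _; rewrite mean_sum; apply: ler_sum => y _.
  rewrite -meanZ; apply: le_mean => // eta.
  have := sqr_ge0 ((eta y)%:R - (eta x)%:R : R).
  move: (_ ^+ 2 : R) (u (flip x eta)) (u eta) => w p q w0; rewrite -subr_ge0.
  have -> : 2^-1 * (w * (p ^+ 2 - q ^+ 2)) - w * (p - q) * q = w * (2^-1 * (p - q) ^+ 2) by field.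
  by rewrite mulr_ge0// mulr_ge0 ?sqr_ge0// invr_ge0.
rewrite -[X in X - _]mulrA -[X in _ - X]mulrA -mulrN.
by apply: lerD; apply: ler_wpM2l => //; exact: sqr_ge0.
Qed.

End Energy.

(** The path follows the axes, with [|z_j|] steps in direction [j]. *)
Lemma far_form_lattice (R : realType) (d n : nat) (rho : R) (u : config d n -> R)
    (z : lattice d) : 0 < rho < 1 ->
  far_form rho (proj_torus n z) u <=
  4 * (\sum_j `|z 0%R j|%N)%:R ^+ 2 * exchange_form rho (unit_vec 'Z_n (d := d)) u.
Proof.
move=> rho01.
pose a j : torus d n := if 0 <= z 0 j then unit_vec 'Z_n j else - unit_vec 'Z_n j.
pose s := flatten [seq nseq `|z 0%R j|%N (a j) | j <- enum 'I_d].
have -> : (\sum_j `|z 0%R j|%N)%N = size s.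
  rewrite size_flatten sumnE /shape -map_comp big_map big_enum/=.
  by apply: eq_bigr => j _; rewrite size_nseq.
have -> : proj_torus n z = \sum_(y <- s) y.
  rewrite big_flatten big_map big_enum/= [LHS]row_sum_delta; apply: eq_bigr => j _.
  rewrite mxE big_nseq iter_addr_0 /a; case: (z 0 j) => m /=.
    by rewrite scaler_nat.
  by rewrite NegzE mulrNz scaleNr scaler_nat mulNrn.
apply: far_form_path => // y /flattenP[l /mapP[j _ ->]] /nseqP[-> _].
rewrite /a; case: ifP => _; rewrite ?far_formN; exact: far_form_step.
Qed.

(** The choice of Young's parameter for displacements of length [a]: each of the two block scales
    then spends half of the stirring budget [N ^+ 2 / th]. *)
Lemma block_scale (R : realType) (N th a f : R) : 0 < N -> 0 < th -> 0 < a ->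
  2 * (N ^+ 2 / (16 * th * a ^+ 2)) * (4 * a ^+ 2 * f) = N ^+ 2 / (2 * th) * f /\
  (4 * (N ^+ 2 / (16 * th * a ^+ 2)))^-1 = 4 * th * a ^+ 2 / N ^+ 2.
Proof. by move=> N0 th0 a0; split; field; rewrite !gt_eqF. Qed.

(** * Boxes as blocks, and the static bound for products of spins *)

Section Boxes.
Variables (R : realType) (d n : nat) (rho : R).
Hypothesis rho01 : 0 < rho < 1.
Hypothesis n_gt1 : (1 < n)%N.
Local Notation T := (torus d n).
Local Notation mean := (@mean R T rho).
Local Notation form := (exchange_form rho (unit_vec 'Z_n (d := d))).

Definition box_vec (k : nat) (y : {ffun 'I_d -> 'I_k}) : lattice d := \row_j (y j : nat)%:Z.

Definition box_site (k : nat) (y : {ffun 'I_d -> 'I_k}) : T := proj_torus n (box_vec y).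

Lemma box_vec_ge0 k (y : {ffun 'I_d -> 'I_k}) j : 0 <= box_vec y 0 j.
Proof. by rewrite mxE. Qed.

Lemma box_vec_lt k (y : {ffun 'I_d -> 'I_k}) j : (`|box_vec y 0%R j| < k)%N.
Proof. by rewrite mxE /=. Qed.

Lemma far_form_box k (y : {ffun 'I_d -> 'I_k}) (u : config d n -> R) :
  far_form rho (box_site y) u <= 4 * (d * k)%:R ^+ 2 * form u.
Proof.
apply: (le_trans (far_form_lattice _ _ rho01)).
apply: ler_wpM2r.
  by apply: sumr_ge0 => x _; apply: sumr_ge0 => j _; exact: hop_ge0.
rewrite ler_pM2l// lerXn2r ?nnegrE// ler_nat.
apply: (@leq_trans (\sum_(j < d) k)); last by rewrite sum_nat_const card_ord.
by apply: leq_sum => j _; exact/ltnW/box_vec_lt.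
Qed.

(** Euclidean division by [k] in each coordinate; [k * N <= n] keeps the grid from wrapping around
    the torus. *)
Lemma box_grid_inj (k N : nat) : (k * N <= n)%N ->
  injective (fun p : {ffun 'I_d -> 'I_N} * {ffun 'I_d -> 'I_k} =>
    proj_torus n (k%:Z *: box_vec p.1) + box_site p.2).
Proof.
move=> kN [i y] [i' y'] /=; rewrite /box_site -!proj_torusD.
have bound (e : {ffun 'I_d -> 'I_N}) (f : {ffun 'I_d -> 'I_k}) j : (k * e j + f j < n)%N.
  apply: leq_trans kN; apply: (@leq_trans (k * (e j).+1)).
    by rewrite mulnS addnC ltn_add2r.
  by rewrite leq_mul2l ltn_ord orbT.
move/(proj_torus_inj n_gt1) => H.
have {}H := H _.
have E : k%:Z *: box_vec i + box_vec y = k%:Z *: box_vec i' + box_vec y'.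
  apply: H => j; rewrite !mxE.
  have := bound i y j; have := bound i' y' j.
  by rewrite -!PoszM -!PoszD; lia.
have {}E j : (k * i j + y j = k * i' j + y' j)%N.
  by have /rowP/(_ j) := E; rewrite !mxE -!PoszM -!PoszD => -[].
have k0 (j : 'I_d) : (0 < k)%N := leq_ltn_trans (leq0n _) (ltn_ord (y j)).
have yy j : (y j : nat) = y' j.
  have := congr1 (modn ^~ k) (E j); rewrite /= !(mulnC k) !modnMDl.
  by rewrite !modn_small.
congr pair; apply/ffunP => j; apply/val_inj => /=; last exact: yy.
have := E j; rewrite yy => /addIn/eqP; rewrite eqn_mul2l.
by have := k0 j; case: k {yy E H bound kN y y' k0} => // k _ /= /eqP.
Qed.

(** With [N] the integer quotient, [n <= 2 k N]: one grid fills at least the proportion [2 ^ (-d)]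
    of the torus, which is the origin of [2 ^+ d]. Reflected boxes are included because
    [static_bound] places one box of each orientation. *)
Lemma box_l2 (k : nat) (g : config d n -> R) : (0 < k <= n)%N -> density rho g ->
  mean (fun eta => \sum_x block_avg rho (box_site (k := k)) x eta ^+ 2 * g eta) <=
    16 * 2 ^+ d * entropy rho g + 2 * n%:R ^+ d / k%:R ^+ d /\
  mean (fun eta => \sum_x block_avg rho (fun y => - box_site (k := k) y) x eta ^+ 2 * g eta) <=
    16 * 2 ^+ d * entropy rho g + 2 * n%:R ^+ d / k%:R ^+ d.
Proof.
move=> /andP[k0 kn] gd; pose N := (n %/ k)%N.
have N0 : (0 < N)%N by rewrite divn_gt0.
have kN : (k * N <= n)%N by rewrite mulnC leq_trunc_div.
have nkN : (n <= 2 * (k * N))%N.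
  have := ltn_ceil n k0; rewrite -/N => h; apply: (leq_trans (ltnW h)); nia.
have cB : #|{ffun 'I_d -> 'I_k}| = (k ^ d)%N by rewrite card_ffun !card_ord.
have cE : #|{ffun 'I_d -> 'I_N}| = (N ^ d)%N by rewrite card_ffun !card_ord.
have kd0 : 0 < k%:R ^+ d :> R by rewrite exprn_gt0// ltr0n.
have Nd0 : 0 < N%:R ^+ d :> R by rewrite exprn_gt0// ltr0n.
have H0 := entropy_ge0 rho01 gd.
have le : 16 * #|T|%:R / (#|{ffun 'I_d -> 'I_N}|%:R * #|{ffun 'I_d -> 'I_k}|%:R) * entropy rho g
    + 2 * #|T|%:R / #|{ffun 'I_d -> 'I_k}|%:R <=
    16 * 2 ^+ d * entropy rho g + 2 * n%:R ^+ d / k%:R ^+ d.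
  rewrite card_torus// cB cE !natrX lerD2r ler_wpM2r//.
  rewrite ler_pdivrMr ?mulr_gt0// -mulrA ler_pM2l//.
  by rewrite -!exprMn -!natrM lerXn2r ?nnegrE// ler_nat; lia.
have B0 : (0 < #|{ffun 'I_d -> 'I_k}|)%N by rewrite cB expn_gt0 k0.
have E0 : (0 < #|{ffun 'I_d -> 'I_N}|)%N by rewrite cE expn_gt0 N0.
have inj := box_grid_inj kN.
split; apply: le_trans le.
  exact: (block_avg_l2 (w := fun i => proj_torus n (k%:Z *: box_vec i)) rho01 B0 E0 inj gd).
apply: (block_avg_l2 (w := fun i => - proj_torus n (k%:Z *: box_vec i)) rho01 B0 E0 _ gd).
by move=> p p' /=; rewrite -!opprD => /oppr_inj; exact: (inj p p').
Qed.

Definition block_error (u : config d n -> R) (k : nat) : R :=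
  16 * 2 ^+ d * entropy rho (fun eta => u eta ^+ 2) + 2 * n%:R ^+ d / k%:R ^+ d.

Lemma sum_sq_root_density (u : config d n -> R) : mean (fun eta => u eta ^+ 2) = 1 ->
  density rho (fun eta => u eta ^+ 2).
Proof. by split => // eta; rewrite sqr_ge0. Qed.

Definition site_sum (z : lattice d) : int := \sum_j z 0 j.

Variables (I : finType) (v : I -> lattice d).
Hypothesis v_inj : injective v.

Definition spin_product (J : {set I}) (x : T) (eta : config d n) : R :=
  \prod_(s in J) centered rho eta (x + proj_torus n (v s)).

(** The blocks must avoid the other spins of the product and each other. The site [z] with the
    largest coordinate sum gets boxes with nonnegative increments, and the site [b] with the
    smallest sum among the others gets reflected boxes. Sums only grow along the former and only
    decrease along the latter, so a coincidence forces zero increments, hence equal sites. *)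
Lemma static_bound (J : {set I}) (G : T -> R) (u : config d n -> R) (m L B : nat) (th : R) :
  (1 < #|J|)%N -> (0 < d)%N -> (0 < m <= L)%N -> (2 * B + 2 * L < n)%N ->
  (forall s j, (`|v s 0%R j| <= B)%N) ->
  (forall x, `|G x| <= 1) -> mean (fun eta => u eta ^+ 2) = 1 -> 0 < th ->
  mean (fun eta => \sum_x G x * spin_product J x eta * u eta ^+ 2) <=
  n%:R ^+ 2 / th * form u + 4 * th * (d * m)%:R ^+ 2 / n%:R ^+ 2 * (n%:R ^+ d + block_error u L)
  + 4 * th * (d * L)%:R ^+ 2 / n%:R ^+ 2 * (block_error u m + block_error u L)
  + block_error u L.
Proof.
move=> J1 d0 /andP[m0 mL] Ln vB G1 u1 th0.
have L0 : (0 < L)%N by exact: leq_trans mL.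
have Ln' : (0 < L <= n)%N.
  rewrite L0/= (leq_trans _ (ltnW Ln))// (leq_trans (leq_pmull L (n := 2) _))// leq_addl//.
have mn : (0 < m <= n)%N by rewrite m0 (leq_trans mL)//; case/andP: Ln'.
have /card_gt0P[s0 s0J] : (0 < #|J|)%N by exact: ltnW.
have [z zJ zmax] := @arg_maxP _ _ I s0 (fun s => s \in J) (fun s => site_sum (v s)) s0J.
have /card_gt0P[s1 s1J] : (0 < #|J :\ z|)%N.
  by move: J1; rewrite (cardsD1 z) [z \in J]zJ.
have [b bJ bmin] := @arg_minP _ _ I s1 (fun s => s \in J :\ z) (fun s => site_sum (v s)) s1J.
have bz : b != z by move: bJ; rewrite /= !inE => /andP[].
have sum_ge0 k (y : {ffun 'I_d -> 'I_k}) : 0 <= site_sum (box_vec y).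
  by apply: sumr_ge0 => j _; exact: box_vec_ge0.
have sum_eq0 k (y : {ffun 'I_d -> 'I_k}) : site_sum (box_vec y) <= 0 -> box_vec y = 0.
  move=> y0; apply/rowP => j; apply/eqP; rewrite mxE [X in _ == X]mxE.
  have : site_sum (box_vec y) == 0 by rewrite eq_le y0 sum_ge0.
  rewrite psumr_eq0 => [/allP/(_ j)|i _]; last exact: box_vec_ge0.
  by rewrite mem_index_enum mxE; apply.
have sumD (p p' : lattice d) : site_sum (p + p') = site_sum p + site_sum p'.
  by rewrite /site_sum -big_split/=; apply: eq_bigr => j _; rewrite mxE.
have inj1 k (s s' : I) (y : {ffun 'I_d -> 'I_k}) : (k <= L)%N ->
    proj_torus n (v s) = proj_torus n (v s' + box_vec y) -> v s = v s' + box_vec y.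
  move=> kL; apply: proj_torus_inj => // j; rewrite mxE.
  have := vB s j; have := vB s' j; have := box_vec_lt y j.
  move: (v s 0 j) (v s' 0 j) (box_vec y 0 j) => p p' r; lia.
have inj2 k k' (s s' : I) (y : {ffun 'I_d -> 'I_k}) (y' : {ffun 'I_d -> 'I_k'}) :
    (k <= L)%N -> (k' <= L)%N ->
    proj_torus n (v s + box_vec y) = proj_torus n (v s' - box_vec y') ->
    v s + box_vec y = v s' - box_vec y'.
  move=> kL kL'; apply: proj_torus_inj => // j; rewrite mxE [X in _ - X]mxE [X in _ - (_ + X)]mxE.
  have := vB s j; have := vB s' j; have := box_vec_lt y j; have := box_vec_lt y' j.
  move: (v s 0 j) (v s' 0 j) (box_vec y 0 j) (box_vec y' 0 j) => p p' r r'; lia.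
have neqv s s' : s != s' -> proj_torus n (v s) != proj_torus n (v s').
  apply: contra_neq => e; apply: v_inj; apply: proj_torus_inj e => // j.
  have := vB s j; have := vB s' j; move: (v s 0 j) (v s' 0 j) => p p'; lia.
have far_z k (s : I) (y : {ffun 'I_d -> 'I_k}) : (k <= L)%N -> s \in J -> s != z ->
    proj_torus n (v s) != proj_torus n (v z) + box_site y.
  move=> kL sJ sz; apply/eqP; rewrite -proj_torusD => /(inj1 _ _ _ _ kL) e.
  have := zmax s sJ; rewrite /= e sumD gerDl => /sum_eq0 y0.
  by move/eqP: sz; apply; apply: v_inj; rewrite e y0 addr0.
have far_b k (s : I) (y : {ffun 'I_d -> 'I_k}) : (k <= L)%N -> s \in J -> s != z -> s != b ->
    proj_torus n (v s) != proj_torus n (v b) - box_site y.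
  move=> kL sJ sz sb; apply/eqP => e.
  have /(inj1 _ _ _ _ kL) {}e : proj_torus n (v b) = proj_torus n (v s + box_vec y).
    by rewrite proj_torusD e subrK.
  have := bmin s; rewrite /= !inE sz sJ => /(_ isT); rewrite e sumD gerDl => /sum_eq0 y0.
  by move/eqP: sb; apply; apply: v_inj; rewrite e y0 addr0.
have zb_le : site_sum (v b) <= site_sum (v z).
  by apply: zmax; move: bJ; rewrite /= !inE => /andP[].
have far_zb k k' (y : {ffun 'I_d -> 'I_k}) (y' : {ffun 'I_d -> 'I_k'}) :
    (k <= L)%N -> (k' <= L)%N ->
    proj_torus n (v z) + box_site y != proj_torus n (v b) - box_site y'.
  move=> kL kL'; apply/eqP; rewrite -proj_torusD -proj_torusB => /(inj2 _ _ _ _ _ _ kL kL') e.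
  have e' : v b = v z + (box_vec y + box_vec y') by rewrite addrA e subrK.
  move: zb_le; rewrite e' !sumD gerDl => s0'.
  have y0 : box_vec y = 0.
    by apply: sum_eq0; apply: le_trans s0'; rewrite lerDl.
  have y0' : box_vec y' = 0.
    by apply: sum_eq0; apply: le_trans s0'; rewrite lerDr.
  by move/eqP: bz; apply; apply: v_inj; rewrite e' y0 y0' !addr0.
(* Every box contains its own base point, so [far_zb] also covers the sites [z] and [b]
   themselves. *)
pose y0 k (k0 : (0 < k)%N) : {ffun 'I_d -> 'I_k} := [ffun=> Ordinal k0].
have bs0 k (k0 : (0 < k)%N) : box_site (y0 k k0) = 0.
  rewrite /box_site (_ : box_vec _ = 0) ?proj_torus0//.
  by apply/rowP => j; rewrite !mxE ffunE.
pose K x eta := G x * \prod_(s in J :\ z :\ b) centered rho eta (x + proj_torus n (v s)).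
have prodE x eta : G x * spin_product J x eta =
    K x eta * centered rho eta (x + proj_torus n (v z)) * centered rho eta (x + proj_torus n (v b)).
  rewrite /spin_product (big_setD1 z)//= (big_setD1 b)//= /K; ring.
have inK s : s \in J :\ z :\ b -> [/\ s \in J, s != z & s != b].
  by rewrite !inE => /and3P[].
have xI (x y y' : T) : (x + y == x + y') = (y == y').
  by apply/eqP/eqP => [/addrI|->].
have Kswap x p p' eta : (forall s, s \in J :\ z :\ b ->
    proj_torus n (v s) != p /\ proj_torus n (v s) != p') ->
    K x (swap (x + p) (x + p') eta) = K x eta.
  move=> Hs; congr (_ * _); apply: eq_bigr => s /Hs[h1 h2].
  by rewrite centered_swapD// xI.
have n0 : 0 < n%:R :> R by rewrite ltr0n ltnW.
have dm0 : 0 < (d * m)%:R :> R by rewrite ltr0n muln_gt0 d0.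
have dL0 : 0 < (d * L)%:R :> R by rewrite ltr0n muln_gt0 d0.
pose k1 := n%:R ^+ 2 / (16 * th * (d * m)%:R ^+ 2) : R.
pose k2 := n%:R ^+ 2 / (16 * th * (d * L)%:R ^+ 2) : R.
have k10 : 0 < k1 by rewrite divr_gt0 ?exprn_gt0// !mulr_gt0 ?exprn_gt0.
have k20 : 0 < k2 by rewrite divr_gt0 ?exprn_gt0// !mulr_gt0 ?exprn_gt0.
have cB k : (0 < k)%N -> (0 < #|{ffun 'I_d -> 'I_k}|)%N.
  by move=> k0; rewrite card_ffun !card_ord expn_gt0 k0.
have dens := sum_sq_root_density u1.
have [q1 _] := box_l2 mn dens.
have [q2 q2'] := box_l2 Ln' dens.
have := @two_block_bound R T rho rho01 _ _ (box_site (k := m)) (box_site (k := L))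
  (proj_torus n (v z)) (proj_torus n (v b)) K u k1 k2 _ _ (block_error u m) (block_error u L) (cB _ m0) (cB _ L0)
  k10 k20 u1 _ _ _ _ _ _ _ _ _ (fun y => far_form_box y u) (fun y => far_form_box y u) q1 q2 q2'.
move=> bound.
under eq_mean do under eq_bigr do rewrite prodE.
apply: (le_trans (bound _ _ _ _ _ _ _ _ _)).
- move=> x eta; rewrite normrM -[leRHS]mulr1 ler_pM// normr_prod.
  by apply: prodr_ile1 => s _; rewrite normr_ge0 centered_norm.
- move=> x y eta; rewrite -addrA; apply: Kswap => s /inK[sJ sz sb].
  by rewrite neqv//; split=> //; exact: far_z.
- move=> x y eta; rewrite -addrA; apply: Kswap => s /inK[sJ sz sb].
  by rewrite neqv//; split=> //; exact: far_z.
- move=> x y eta; rewrite -addrA; apply: Kswap => s /inK[sJ sz sb].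
  by rewrite neqv//; split=> //; exact: far_b.
- by rewrite neqv// eq_sym.
- by move=> y; have := far_zb _ _ y (y0 L L0) mL (leqnn _); rewrite bs0 subr0.
- by move=> y; have := far_zb _ _ (y0 L L0) y (leqnn _) (leqnn _); rewrite bs0 addr0.
- by move=> y y'; exact: far_zb.
- by move=> y y'; exact: far_zb.
rewrite card_torus// natrX.
have [-> ->] := block_scale (form u) n0 th0 dm0.
have [-> ->] := block_scale (form u) n0 th0 dL0.
rewrite !lerD2r -mulrDl ler_wpM2r//.
  by apply: sumr_ge0 => x _; apply: sumr_ge0 => j _; exact: hop_ge0.
by rewrite le_eqVlt; apply/orP; left; apply/eqP; field; rewrite gt_eqF.
Qed.

End Boxes.

(** * Static estimates *)

(* The exponent [E] of the cost [q^E] of a static estimate; what matters is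
   [2 E + 1 <= 9 d], that is [q^E <= n^(d/2) / sqrt q]. *)
Definition rate_exp (d : nat) : nat := match d with 1%N => 4 | 2%N => 8 | _ => 13 end.

(** [2 ^+ 27 = (2 ^+ 9) ^+ 3] comes from [n <= (2 q) ^ 9] raised to the power [d <= 3]; 300 collects
    the numerical factors of [static_rate]. *)
Definition rate_cst (R : realType) : R := 300 * 2 ^+ 27.

Lemma rate_cst_ge0 (R : realType) : 0 <= rate_cst R.
Proof. exact: mulr_ge0 (ler0n _ _) (exprn_ge0 _ (ler0n _ _)). Qed.

Section Rates.
Variables (R : realType) (d n q : nat) (rho : R).
Hypothesis rho01 : 0 < rho < 1.
Hypothesis d13 : (1 <= d <= 3)%N.
Hypothesis q_gt0 : (0 < q)%N.
Hypothesis qn : (q ^ 9 <= n <= (2 * q) ^ 9)%N.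
Hypothesis n_gt1 : (1 < n)%N.
Local Notation T := (torus d n).
Local Notation mean := (@mean R T rho).
Local Notation form := (exchange_form rho (unit_vec 'Z_n (d := d))).
Local Notation K := (2 ^+ 27 : R).
Local Notation QE := (q%:R ^+ rate_exp d : R).
Implicit Types u : config d n -> R.

Let Q1 : 1 <= q%:R :> R. Proof. by rewrite ler1n. Qed.

Let Q0 : 0 < q%:R :> R. Proof. by rewrite ltr0n. Qed.

Let N0 : 0 < n%:R :> R. Proof. by rewrite ltr0n ltnW. Qed.

Let NQ : q%:R ^+ 9 <= n%:R :> R.
Proof. by rewrite -natrX ler_nat; case/andP: qn. Qed.

Let QN : n%:R <= (2 * q%:R) ^+ 9 :> R.
Proof. by rewrite -natrM -natrX ler_nat; case/andP: qn. Qed.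

Let Qle i j : (i <= j)%N -> q%:R ^+ i <= q%:R ^+ j :> R.
Proof. by move=> ij; rewrite ler_weXn2l. Qed.

Let K_le i : (i <= 27)%N -> 2 ^+ i <= K.
Proof. by move=> i3; rewrite ler_weXn2l ?ler1n. Qed.

Let d_cases : [\/ d = 1%N, d = 2%N | d = 3%N].
Proof.
by case/andP: d13; case: d => [|[|[|[|]]]]// _ _; [constructor 1|constructor 2|constructor 3].
Qed.

Let Nd_le : n%:R ^+ d <= K * q%:R ^+ (9 * d) :> R.
Proof.
apply: (@le_trans _ _ (((2 * q%:R) ^+ 9) ^+ d)).
  by apply: lerXn2r QN; rewrite nnegrE ?exprn_ge0 ?mulr_ge0.
rewrite -exprM exprMn; apply: ler_wpM2r; first by rewrite exprn_ge0.
by apply: K_le; case: d_cases => ->.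
Qed.

Lemma volume_rate i j : (9 * d + i <= j + rate_exp d)%N ->
  n%:R ^+ d * q%:R ^+ i / q%:R ^+ j <= K * QE.
Proof.
move=> ij; have Qj : 0 < q%:R ^+ j :> R by rewrite exprn_gt0.
rewrite ler_pdivrMr// -mulrA -exprD addnC.
apply: (@le_trans _ _ (K * q%:R ^+ (9 * d) * q%:R ^+ i)).
  by apply: ler_wpM2r Nd_le; rewrite exprn_ge0.
rewrite -mulrA -exprD; apply: ler_wpM2l; first by rewrite exprn_ge0.
exact: Qle.
Qed.

Lemma volume_rate2 i : (i <= 4)%N -> q%:R ^+ i * n%:R ^+ d / n%:R ^+ 2 <= K * QE.
Proof.
move=> i4; have n2 : 0 < n%:R ^+ 2 :> R by rewrite exprn_gt0.
have N1 : 1 <= n%:R :> R by rewrite ler1n ltnW.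
have K1 : 1 <= K by rewrite exprn_ege1// ler1n.
have Qi : q%:R ^+ i <= q%:R ^+ 4 :> R by exact: Qle.
rewrite ler_pdivrMr//.
have [d1|d2|d3] := d_cases.
- rewrite d1 /= expr1; apply: (@le_trans _ _ (q%:R ^+ 4 * n%:R ^+ 2)).
    by apply: ler_pM; rewrite ?exprn_ge0// expr2 ler_peMl.
  by rewrite ler_wpM2r ?sqr_ge0// ler_peMl// exprn_ge0.
- rewrite d2 /= ler_wpM2r ?sqr_ge0//; apply: (le_trans Qi); apply: (@le_trans _ _ (q%:R ^+ 8)).
    exact: Qle.
  by rewrite ler_peMl// exprn_ge0.
- rewrite d3 /= [n%:R ^+ 3]exprSr mulrA mulrAC; apply: ler_wpM2r; first exact: sqr_ge0.
  apply: (@le_trans _ _ (q%:R ^+ 4 * (2 * q%:R) ^+ 9)).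
    by apply: ler_pM => //; rewrite exprn_ge0.
  rewrite exprMn mulrCA -exprD; apply: ler_wpM2r; first by rewrite exprn_ge0.
  exact: K_le.
Qed.

Lemma rate_form_ge0 u : 0 <= form u.
Proof. by apply: sumr_ge0 => x _; apply: sumr_ge0 => j _; exact: hop_ge0. Qed.

(** The term [th / q ^+ 8] comes from [(q ^ 5 / n) ^+ 2 <= q ^ (-8)]; as long as [th <= q ^+ 8], the
    coefficient of the entropy does not grow with [th]. *)
Definition static_error u (th : R) : R :=
  n%:R ^+ 2 / th * form u +
  rate_cst R * ((1 + th / q%:R ^+ 8) * entropy rho (fun eta => u eta ^+ 2) + th * QE).

Lemma static_error_ge0 u th : mean (fun eta => u eta ^+ 2) = 1 -> 0 < th ->
  0 <= static_error u th.
Proof.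
move=> u1 th0; apply: addr_ge0.
  by apply: mulr_ge0; [rewrite divr_ge0 ?sqr_ge0// ltW|exact: rate_form_ge0].
apply: mulr_ge0; first exact: rate_cst_ge0.
apply: addr_ge0; last by rewrite mulr_ge0 ?exprn_ge0// ltW.
apply: mulr_ge0; first by rewrite addr_ge0// divr_ge0 ?exprn_ge0// ltW.
exact/(entropy_ge0 rho01)/sum_sq_root_density.
Qed.

(** As powers of [q], the three volume errors of [static_bound] have exponents [9 d - 14], [7 d - 8]
    and [4 d]. The last is the largest for [d <= 2], and the first two both equal 13 for [d = 3]:
    these maxima are [rate_exp d]. *)
Lemma static_rate (I : finType) (v : I -> lattice d) (J : {set I}) (G : T -> R) u (B : nat) (th : R) :
  injective v -> (1 < #|J|)%N -> (2 * B + 2 * q ^ 5 < n)%N ->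
  (forall s j, (`|v s 0%R j| <= B)%N) ->
  (forall x, `|G x| <= 1) -> mean (fun eta => u eta ^+ 2) = 1 -> 1 <= th ->
  mean (fun eta => \sum_x G x * spin_product rho v J x eta * u eta ^+ 2) <= static_error u th.
Proof.
move=> vinj J1 Bn vB G1 u1 th1; have th0 : 0 < th by exact: lt_le_trans th1.
have /andP[d1 d3] := d13.
have mL : (0 < q ^ 2 <= q ^ 5)%N by rewrite expn_gt0 q_gt0/= leq_pexp2l.
have := @static_bound R d n rho rho01 n_gt1 I v vinj J G u (q ^ 2) (q ^ 5) B th J1 d1 mL Bn vB G1 u1 th0.
move/le_trans; apply; rewrite /static_error -[leLHS]addrA -[leLHS]addrA lerD2l.
have H0 : 0 <= entropy rho (fun eta => u eta ^+ 2).
  exact/(entropy_ge0 rho01)/sum_sq_root_density.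
rewrite /block_error; move: (entropy _ _) H0 => H H0.
have d9 : d%:R ^+ 2 <= 9 :> R by rewrite -natrX ler_nat; case: d_cases => ->.
have d0 : 0 <= d%:R ^+ 2 :> R by exact: sqr_ge0.
pose P : R := 16 * 2 ^+ d.
have P0 : 0 <= P by rewrite mulr_ge0// exprn_ge0.
have P128 : P <= 128.
  by rewrite /P -natrX -natrM ler_nat; case: d_cases => ->.
have sqE i : (d * q ^ i)%:R ^+ 2 = d%:R ^+ 2 * q%:R ^+ (i * 2) :> R.
  by rewrite natrM natrX exprMn -exprM.
have qdE i : (q ^ i)%:R ^+ d = q%:R ^+ (i * d) :> R by rewrite natrX -exprM.
rewrite -/P (sqE 2%N) (sqE 5%N) (qdE 2%N) (qdE 5%N).
have n2 : 0 < n%:R ^+ 2 :> R by rewrite exprn_gt0.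
have K0 : 0 <= K * QE by rewrite mulr_ge0 ?exprn_ge0.
pose X : R := q%:R ^+ (2 * 2) / n%:R ^+ 2; pose Z : R := q%:R ^+ (5 * 2) / n%:R ^+ 2.
pose V2 : R := n%:R ^+ d / q%:R ^+ (2 * d); pose V5 : R := n%:R ^+ d / q%:R ^+ (5 * d).
have X0 : 0 <= X by rewrite divr_ge0 ?exprn_ge0.
have V20 : 0 <= V2 by rewrite divr_ge0 ?exprn_ge0.
have V50 : 0 <= V5 by rewrite divr_ge0 ?exprn_ge0.
pose W : R := (q%:R ^+ 8)^-1.
have W0 : 0 <= W by rewrite invr_ge0 exprn_ge0.
have XZ : X <= Z by rewrite ler_pM2r ?invr_gt0// Qle.
have ZW : Z <= W.
  rewrite /Z /W ler_pdivrMr// -ler_pdivrMl ?invr_gt0 ?exprn_gt0// invrK -exprD.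
  by apply: (@le_trans _ _ ((q%:R ^+ 9) ^+ 2)); rewrite -?exprM ?Qle// exprM lerXn2r ?nnegrE ?exprn_ge0.
have XN : X * n%:R ^+ d <= K * QE by rewrite /X mulrAC; exact: volume_rate2.
have WV2 : W * V2 <= K * QE.
  have := @volume_rate 0 (8 + 2 * d) _; rewrite expr0 mulr1 exprD invfM mulrCA; apply.
  by case: d_cases => ->.
have V5K : V5 <= K * QE.
  have := @volume_rate 0 (5 * d) _; rewrite expr0 mulr1; apply.
  by case: d_cases => ->.
have WV5 : W * V5 <= K * QE.
  apply: le_trans WV2; rewrite ler_wpM2l// /V5 /V2 ler_wpM2l ?exprn_ge0//.
  by rewrite lef_pV2 ?posrE ?exprn_gt0// Qle// leq_mul2r orbT.
have -> : 4 * th * (d%:R ^+ 2 * q%:R ^+ (2 * 2)) / n%:R ^+ 2 *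
     (n%:R ^+ d + (P * H + 2 * n%:R ^+ d / q%:R ^+ (5 * d))) =
  4 * th * d%:R ^+ 2 * (X * n%:R ^+ d + X * (P * H + 2 * V5)).
  by rewrite /X /V5; ring.
have -> : 4 * th * (d%:R ^+ 2 * q%:R ^+ (5 * 2)) / n%:R ^+ 2 *
    (P * H + 2 * n%:R ^+ d / q%:R ^+ (2 * d) + (P * H + 2 * n%:R ^+ d / q%:R ^+ (5 * d))) =
  4 * th * d%:R ^+ 2 * (Z * (2 * (P * H) + 2 * V2 + 2 * V5)).
  by rewrite /Z /V5 /V2; ring.
have -> : 2 * n%:R ^+ d / q%:R ^+ (5 * d) = 2 * V5 by rewrite /V5 mulrA.
have PH : P * H <= 128 * H by rewrite ler_wpM2r.
have PH0 : 0 <= P * H by rewrite mulr_ge0.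
have XW : X <= W by exact: le_trans XZ ZW.
have s1 : X * n%:R ^+ d + X * (P * H + 2 * V5) <= 3 * (K * QE) + W * (128 * H).
  have e1 : X * (P * H + 2 * V5) <= W * (128 * H + 2 * V5).
    by apply: ler_pM => //; [rewrite addr_ge0// mulr_ge0|rewrite lerD2r].
  by lra.
have s2 : Z * (2 * (P * H) + 2 * V2 + 2 * V5) <= 4 * (K * QE) + W * (256 * H).
  have Z0 : 0 <= Z by exact: le_trans XZ.
  have e1 : Z * (2 * (P * H) + 2 * V2 + 2 * V5) <= W * (2 * (128 * H) + 2 * V2 + 2 * V5).
    by apply: ler_pM => //; lra.
  by lra.
have WH : 0 <= W * H by rewrite mulr_ge0.
have s3 : 4 * th * d%:R ^+ 2 * (X * n%:R ^+ d + X * (P * H + 2 * V5)) +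
   4 * th * d%:R ^+ 2 * (Z * (2 * (P * H) + 2 * V2 + 2 * V5)) <=
   36 * th * (7 * (K * QE) + 384 * (W * H)).
  rewrite -mulrDr; apply: ler_pM.
  - by apply: mulr_ge0 d0; rewrite mulr_ge0// ltW.
  - have Z0 : 0 <= Z by exact: le_trans XZ.
    have y1 : 0 <= X * (P * H + 2 * V5) by apply: mulr_ge0 => //; lra.
    have y2 : 0 <= Z * (2 * (P * H) + 2 * V2 + 2 * V5) by apply: mulr_ge0 => //; lra.
    have y3 : 0 <= X * n%:R ^+ d by rewrite mulr_ge0// exprn_ge0.
    by lra.
  - have -> : 36 * th = 4 * th * 9 by ring.
    by apply: ler_wpM2l => //; rewrite mulr_ge0// ltW.
  - lra.
have K1 : 128 <= K.
  by apply: (@le_trans _ _ (2 ^+ 7)); [rewrite -natrX ler_nat|exact: K_le].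
have tK : K * QE <= th * (K * QE) by rewrite ler_peMl.
have KH : 128 * H <= K * H by rewrite ler_wpM2r.
have KWH : th * (W * H) * 128 <= K * (th * (W * H)).
  by rewrite mulrC ler_wpM2r// mulr_ge0// ltW.
have thWH : 0 <= th * (W * H) by rewrite mulr_ge0// ltW.
have KH0 : 0 <= K * H by rewrite mulr_ge0// exprn_ge0.
have -> : rate_cst R * ((1 + th / q%:R ^+ 8) * H + th * QE) =
   300 * (K * H) + 300 * (K * (th * (W * H))) + 300 * (th * (K * QE)).
  by rewrite /rate_cst /W; ring.
have s3' : 36 * th * (7 * (K * QE) + 384 * (W * H)) =
   252 * (th * (K * QE)) + 108 * (th * (W * H) * 128) by ring.
move: s3; rewrite s3'; lra.
Qed.

End Rates.

(** * Walsh expansion *)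

Section Walsh.
Variables (R : realType) (d : nat) (f : cylinder d R) (rho : R).
Local Notation I := (cyl_supp f).
Local Notation sgn := (fun b : bool => if b then 1 else -1 : R).

(* The coefficient of [\prod_(s in J) (eta_s - rho)] in [f]: in one variable,
   [F b] is its Bernoulli mean plus [(F true - F false) (b - rho)]. *)
Definition walsh (J : {set I}) : R :=
  \sum_(xi : {ffun I -> bool}) f (extend_false xi) *
    \prod_(s : I) (if s \in J then sgn (xi s) else bernoulli_weight rho (xi s)).

(** Two values of [X] are of interest. For [X s = eta_s - rho] the factor at [s] is the indicator of
    [xi s = eta_s], and the sum is [f eta]. For [X s = r - rho] it is the Bernoulli weight of
    density [r], and the sum is the mean of [f] at density [r], with the same coefficients. *)
Lemma walsh_sum (X : I -> R) :
  \sum_(xi : {ffun I -> bool}) f (extend_false xi) *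
    \prod_(s : I) (sgn (xi s) * X s + bernoulli_weight rho (xi s)) =
  \sum_(J : {set I}) walsh J * \prod_(s in J) X s.
Proof.
transitivity (\sum_(xi : {ffun I -> bool}) \sum_(J : {set I}) f (extend_false xi) *
    \prod_(s : I) (if s \in J then sgn (xi s) else bernoulli_weight rho (xi s)) *
    \prod_(s in J) X s).
  apply: eq_bigr => xi _; rewrite bigA_distr mulr_sumr; apply: eq_big => [J|J _]; first by rewrite inE.
  rewrite -mulrA [X in _ * (_ * X)]big_mkcond -big_split/=; congr (_ * _).
  by apply: eq_bigr => s _; case: ifP => _; rewrite ?mulr1.
by rewrite exchange_big/=; apply: eq_bigr => J _; rewrite mulr_suml.
Qed.

Lemma extend_false_val (xi : {ffun I -> bool}) (s : I) : extend_false xi (val s) = xi s.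
Proof. by rewrite /extend_false valK. Qed.

Lemma walsh_expansion (eta : zconfig d) :
  f eta = \sum_(J : {set I}) walsh J * \prod_(s in J) ((eta (val s))%:R - rho).
Proof.
rewrite -walsh_sum (bigD1 [ffun s : I => eta (val s)])//= [X in _ + X]big1 ?addr0.
  rewrite big1 ?mulr1 => [|s _].
    apply: cyl_suppP => z zs; rewrite -[z]/(val [` zs]%fset).
    by rewrite extend_false_val ffunE.
  by rewrite ffunE; case: (eta _) => /=; ring.
move=> xi xin; have [s es] : exists s : I, xi s != eta (val s).
  apply/existsP; apply: contraNT xin; rewrite negb_exists => /forallP xs.
  by apply/eqP/ffunP => s; rewrite ffunE; have := xs s; rewrite negbK => /eqP.
have e0 : sgn (xi s) * ((eta (val s))%:R - rho) + bernoulli_weight rho (xi s) = 0.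
  by move: es; case: (xi s); case: (eta (val s)) => //= _; ring.
by rewrite (bigD1 s)//= e0 mul0r mulr0.
Qed.

Lemma bernoulli_mean_walsh (r : R) :
  bernoulli_mean f r = \sum_(J : {set I}) walsh J * (r - rho) ^+ #|J|.
Proof.
transitivity (\sum_(J : {set I}) walsh J * \prod_(s in J) (r - rho)).
  rewrite -(walsh_sum (fun=> r - rho)) /bernoulli_mean; apply: eq_bigr => xi _.
  rewrite mulrC; congr (_ * _); apply: eq_bigr => s _.
  by case: (xi s) => /=; ring.
by apply: eq_bigr => J _; rewrite prodr_const.
Qed.

Lemma is_derive_bigsum (J : Type) (s : seq J) (F : J -> R -> R) (F' : J -> R) (x : R) :
  (forall j, is_derive x 1 (F j) (F' j)) ->
  is_derive x 1 (fun r => \sum_(j <- s) F j r) (\sum_(j <- s) F' j).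
Proof.
move=> HF; elim: s => [|j s IH].
  rewrite big_nil (_ : (fun _ => _) = cst 0); last by apply/funext => r; rewrite big_nil.
  exact: is_derive_cst.
rewrite big_cons (_ : (fun _ => _) = F j + (fun r => \sum_(j <- s) F j r)).
  exact: is_deriveD.
by apply/funext => r; rewrite big_cons.
Qed.

Lemma bernoulli_mean_derive :
  derive1 (bernoulli_mean f) rho = \sum_(J : {set I} | #|J| == 1%N) walsh J.
Proof.
have -> : bernoulli_mean f = fun r => \sum_(J : {set I}) walsh J * (r - rho) ^+ #|J|.
  by apply/funext => r; exact: bernoulli_mean_walsh.
rewrite derive1E big_mkcond /=.
apply: derive_val.
have id1 : is_derive rho 1 (fun r => r - rho) (1 : R).
  have := @is_deriveB _ _ _ id (cst rho) rho 1 1 0 (is_derive_id _ _) (is_derive_cst _ _ _).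
  by rewrite subr0.
apply: is_derive_bigsum => J.
have dX := @is_deriveZ _ _ _ _ (walsh J) rho 1 _ (@is_deriveX R R (fun r => r - rho) #|J| rho 1 1 id1).
rewrite (_ : (fun r => _) = walsh J \*: ((fun r : R => r - rho) ^+ #|J|)); last first.
  by apply/funext => r; rewrite /= exprfctE.
rewrite (_ : (if _ then _ else _) = walsh J *: ((#|J|%:R * (rho - rho) ^+ #|J|.-1) *: (1 : R)))//.
rewrite subrr /GRing.scale/= mulr1; case: #|J| => [|[|k]]/=.
- by rewrite mul0r mulr0.
- by rewrite !mulr1.
- by rewrite expr0n/= !mulr0.
Qed.

(** The mean removes the degree 0, and the derivative is the sum of the coefficients of degree 1, so
    each linear spin is only compared with the spin at 0. *)
Lemma Pi_rho_walsh (eta : zconfig d) :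
  Pi_rho rho f eta =
  \sum_(J : {set I} | (1 < #|J|)%N) walsh J * \prod_(s in J) ((eta (val s))%:R - rho) +
  \sum_(s : I) walsh [set s]%SET * ((eta (val s))%:R - (eta 0)%:R).
Proof.
have sum1 (F : {set I} -> R) : \sum_(J : {set I} | #|J| == 1%N) F J = \sum_(s : I) F [set s]%SET.
  rewrite (eq_bigl (fun J : {set I} => J \in [set [set s] | s : I]%SET)).
    rewrite big_imset/=; last by move=> s s' _ _ /set1_inj.
    by apply: eq_bigl => s; rewrite inE.
  move=> J; apply/idP/imsetP => [/cards1P[s ->]|[s _ ->]]; first by exists s.
  by rewrite cards1.
have split3 (F : {set I} -> R) : \sum_(J : {set I}) F J =
    F finset.set0 + \sum_(s : I) F [set s]%SET + \sum_(J : {set I} | (1 < #|J|)%N) F J.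
  rewrite (bigD1 finset.set0)//= -addrA; congr (_ + _).
  rewrite (bigID (fun J : {set I} => #|J| == 1%N))/= -sum1; congr (_ + _).
    by apply: eq_bigl => J; rewrite -cards_eq0; case: #|J| => [|[|]].
  by apply: eq_bigl => J; rewrite -cards_eq0; case: #|J| => [|[|]].
rewrite /Pi_rho bernoulli_mean_derive bernoulli_mean_walsh walsh_expansion sum1 !split3.
have -> : \sum_(J : {set I} | (1 < #|J|)%N) walsh J * (rho - rho) ^+ #|J| = 0.
  by rewrite big1// => J J1; rewrite subrr expr0n gtn_eqF ?mulr0// ltnW.
have -> : \sum_(s : I) walsh [set s]%SET * (rho - rho) ^+ #|[set s]%SET| = 0.
  by rewrite big1// => s _; rewrite cards1 subrr expr1 mulr0.
rewrite cards0 expr0 big_set0 mulr1 !addr0.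
have -> : \sum_(s : I) walsh [set s]%SET * \prod_(s' in [set s]%SET) ((eta (val s'))%:R - rho) =
    \sum_(s : I) walsh [set s]%SET * ((eta (val s))%:R - (eta 0)%:R) +
    (\sum_(s : I) walsh [set s]%SET) * ((eta 0)%:R - rho).
  rewrite mulr_suml -big_split/=; apply: eq_bigr => s _.
  by rewrite big_set1; ring.
ring.
Qed.

End Walsh.

(** * Static rates of the voter potential and of the fluctuation field *)

Section ModelRates.
Variables (R : realType) (d n q : nat) (rho : R).
Hypothesis rho01 : 0 < rho < 1.
Hypothesis d13 : (1 <= d <= 3)%N.
Hypothesis q_gt0 : (0 < q)%N.
Hypothesis qn : (q ^ 9 <= n <= (2 * q) ^ 9)%N.
Hypothesis n_gt1 : (1 < n)%N.
Local Notation T := (torus d n).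
Local Notation mean := (@mean R T rho).
Local Notation form := (exchange_form rho (unit_vec 'Z_n (d := d))).
Local Notation static_error := (@static_error R d n q rho).
Implicit Types u : config d n -> R.

Definition unit_root u := mean (fun eta => u eta ^+ 2) = 1.

Lemma static_rate_abs (I : finType) (v : I -> lattice d) (J : {set I}) (G : T -> R) u (B : nat) (th : R) :
  injective v -> (1 < #|J|)%N -> (2 * B + 2 * q ^ 5 < n)%N ->
  (forall s j, (`|v s 0%R j| <= B)%N) ->
  (forall x, `|G x| <= 1) -> unit_root u -> 1 <= th ->
  `|mean (fun eta => \sum_x G x * spin_product rho v J x eta * u eta ^+ 2)| <= static_error u th.
Proof.
move=> vi J1 Bn vB G1 u1 th1; rewrite ler_norml; apply/andP; split; last exact: static_rate vB G1 u1 th1.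
rewrite lerNl -meanN.
have := @static_rate R d n q rho rho01 d13 q_gt0 qn n_gt1 I v J (fun x => - G x) u B th vi J1 Bn vB.
move=> /(_ _ u1 th1) H; apply: le_trans (H _) => [|x]; last by rewrite normrN.
rewrite le_eqVlt; apply/orP; left; apply/eqP; apply: eq_mean => eta.
by rewrite -sumrN; apply: eq_bigr => x _; rewrite !mulNr.
Qed.

(** The successor keeps this squared path length at least 1 when [z = 0]; [linear_rate] divides by
    it. *)
Definition path_cst (z : lattice d) : R := (\sum_j `|z 0%R j|%N).+1%:R ^+ 2.

Lemma linear_rate (z : lattice d) (G : T -> R) u :
  (forall x, `|G x| <= 1) -> unit_root u ->
  mean (fun eta => \sum_x G x * (centered rho eta (x + proj_torus n z) - centered rho eta x)
    * u eta ^+ 2) <= path_cst z * static_error u 1.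
Proof.
move=> G1 u1; set l := (\sum_j `|z 0%R j|%N)%N.
have n0 : 0 < n%:R :> R by rewrite ltr0n ltnW.
have S0 : 0 < path_cst z by rewrite exprn_gt0// ltr0n.
pose k : R := n%:R ^+ 2 / (4 * path_cst z).
have n2 : 0 < n%:R ^+ 2 :> R by rewrite exprn_gt0.
have k0 : 0 < k by rewrite divr_gt0// mulr_gt0.
have form0 : 0 <= form u by exact: rate_form_ge0.
have farle : far_form rho (proj_torus n z) u <= 4 * path_cst z * form u.
  apply: le_trans (far_form_lattice _ _ rho01) _; apply: ler_wpM2r => //.
  by rewrite ler_pM2l// /path_cst lerXn2r ?nnegrE// ler_nat.
rewrite mean_sum.
apply: (@le_trans _ _ (\sum_x (k * hop rho x (x + proj_torus n z) u + (4 * k)^-1))).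
  apply: ler_sum => x _.
  apply: (le_trans (@exchange_by_parts R T rho rho01 k (x + proj_torus n z) x (fun=> G x) u k0 (fun=> erefl))).
  rewrite hopC lerD2l -[leRHS]mulr1; apply: ler_wpM2l.
    by rewrite invr_ge0 mulr_ge0// ltW.
  apply: (@le_trans _ _ (mean (fun eta => u eta ^+ 2))); last by rewrite u1.
  apply: le_mean => // eta; rewrite -[leRHS]mul1r ler_wpM2r ?sqr_ge0//.
  exact: sqr_le1.
rewrite big_split/= -mulr_sumr sum_cst card_torus// -/(far_form rho (proj_torus n z) u).
have e1 : k * far_form rho (proj_torus n z) u <= n%:R ^+ 2 * form u.
  apply: (@le_trans _ _ (k * (4 * path_cst z * form u))); first by rewrite ler_pM2l.
  by rewrite le_eqVlt; apply/orP; left; apply/eqP; rewrite /k; field; rewrite gt_eqF.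
have e2 : (n ^ d)%:R * (4 * k)^-1 = path_cst z * (q%:R ^+ 0 * n%:R ^+ d / n%:R ^+ 2).
  by rewrite natrX /k expr0; field; rewrite !gt_eqF.
rewrite e2; have := @volume_rate2 R d n q d13 q_gt0 qn n_gt1 0%N isT.
move: (_ / n%:R ^+ 2) => w wle.
have S1 : 1 <= path_cst z by rewrite exprn_ege1// ler1n.
have H0 : 0 <= entropy rho (fun eta => u eta ^+ 2).
  exact/(entropy_ge0 rho01)/sum_sq_root_density.
have q8 : 0 <= (1 + q%:R ^- 8) * entropy rho (fun eta => u eta ^+ 2).
  by rewrite mulr_ge0// addr_ge0// invr_ge0 exprn_ge0.
rewrite /(static_error _ _) divr1 mul1r mulrDr; apply: lerD.
  by apply: (le_trans e1); rewrite ler_peMl// mulr_ge0// ltW.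
rewrite ler_pM2l//; apply: (le_trans wle).
apply: (@le_trans _ _ (rate_cst R * q%:R ^+ rate_exp d)); last first.
  by apply: ler_wpM2l; rewrite ?rate_cst_ge0 ?mul1r// lerDr.
rewrite ler_wpM2r ?exprn_ge0// /rate_cst ler_peMl ?exprn_ge0//.
by rewrite ler1n.
Qed.

(** At most [2 d] vectors have norm 1; for each of them the potential is a spin product over the two
    points 0 and [z], indexed by [bool]. *)
Lemma voter_rate u th : (2 * 1 + 2 * q ^ 5 < n)%N -> unit_root u -> 1 <= th ->
  mean (fun eta => voter_potential rho eta * u eta ^+ 2) <= (2 * d)%:R * static_error u th.
Proof.
move=> qn5 u1 th1.
have th0 : 0 < th by exact: lt_le_trans th1.
have E0 : 0 <= static_error u th by exact: static_error_ge0.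
have one (w : T) : torus_norm w = 1%N ->
    mean (fun eta => \sum_x centered rho eta x * centered rho eta (x + w) * u eta ^+ 2) <=
    static_error u th.
  move=> w1; have [z [pz z0 zB]] : exists z : lattice d,
      [/\ w = proj_torus n z, z != 0 & forall j, (`|z 0%R j| <= 1)%N].
    have [j wj] := torus_norm1 n_gt1 w1.
    have uj : unit_vec int j != 0.
      by apply/eqP => /rowP/(_ j); rewrite !mxE !eqxx.
    case: wj => ->; [exists (unit_vec int j)|exists (- unit_vec int j)].
      by split; rewrite ?proj_torus_unit// => k; rewrite mxE; case: (_ && _).
    split; rewrite ?proj_torusN ?proj_torus_unit ?oppr_eq0//.
    by move=> k; rewrite !mxE; case: (_ && _).
  pose v (b : bool) : lattice d := if b then 0 else z.
  have vi : injective v.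
    by move=> [] [] //= /eqP; rewrite ?[0 == _]eq_sym (negbTE z0).
  have J1 : (1 < #|[set: bool]%SET|)%N by rewrite cardsT card_bool.
  have vB s j : (`|v s 0%R j| <= 1)%N by case: s => //=; rewrite mxE.
  have G1 (x : T) : `|1 : R| <= 1 by rewrite normr1.
  have := @static_rate R d n q rho rho01 d13 q_gt0 qn n_gt1 bool v [set: bool]%SET (fun=> 1) u 1 th
    vi J1 qn5 vB G1 u1 th1.
  apply: le_trans.
  rewrite le_eqVlt; apply/orP; left; apply/eqP; apply: eq_mean => eta.
  apply: eq_bigr => x _; rewrite mul1r /spin_product (eq_bigl xpredT) => [|s]; last by rewrite inE.
  rewrite big_bool/=.
  by rewrite proj_torus0 addr0 -pz.
have -> : mean (fun eta => voter_potential rho eta * u eta ^+ 2) =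
    \sum_(w : T | torus_norm w == 1%N)
      mean (fun eta => \sum_x centered rho eta x * centered rho eta (x + w) * u eta ^+ 2).
  rewrite -mean_sum; apply: eq_mean => eta.
  rewrite exchange_big/= mulr_suml; apply: eq_bigr => x _.
  rewrite mulr_suml (reindex_inj (addrI x))/=.
  by apply: eq_bigl => w; rewrite addrAC subrr add0r.
apply: (@le_trans _ _ (\sum_(w : T | torus_norm w == 1%N) static_error u th)).
  by apply: ler_sum => w /eqP; exact: one.
rewrite sumr_const -[leLHS]mulr_natl ler_wpM2r// ler_nat.
pose g (p : 'I_d * bool) : T := if p.2 then unit_vec 'Z_n p.1 else - unit_vec 'Z_n p.1.
apply: (@leq_trans #|[set g p | p : 'I_d * bool]%SET|).
  apply: subset_leq_card; apply/fintype.subsetP => w; rewrite unfold_in => /eqP w1.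
  have [j [->|->]] := torus_norm1 n_gt1 w1; apply/imsetP.
    by exists (j, true).
  by exists (j, false).
by apply: (leq_trans (leq_imset_card _ _)); rewrite card_prod card_ord card_bool mulnC.
Qed.

Lemma fluct_rate (f : cylinder d R) (G : T -> R) u (B : nat) :
  (2 * B + 2 * q ^ 5 < n)%N ->
  (forall (s : cyl_supp f) j, (`|val s 0%R j| <= B)%N) ->
  (forall x, `|G x| <= 1) -> unit_root u ->
  `|mean (fun eta => (\sum_x G x * Pi_rho rho f (periodic_ext (tshift x eta))) * u eta ^+ 2)| <=
  (\sum_(J : {set cyl_supp f}) `|walsh rho J|
   + \sum_(s : cyl_supp f) `|walsh rho [set s]%SET| * path_cst (val s)) * static_error u 1.
Proof.
move=> Bn vB G1 u1.
have spinE (x : T) (eta : config d n) (s : cyl_supp f) : (periodic_ext (tshift x eta) (val s))%:R - rho =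
   centered rho eta (x + proj_torus n (val s)).
  by rewrite /periodic_ext ffunE.
have spin0 (x : T) (eta : config d n) : (periodic_ext (tshift x eta) (0 : lattice d))%:R - rho = centered rho eta x.
  by rewrite /periodic_ext ffunE proj_torus0 addr0.
have -> : mean (fun eta => (\sum_x G x * Pi_rho rho f (periodic_ext (tshift x eta))) * u eta ^+ 2) =
  \sum_(J : {set cyl_supp f} | (1 < #|J|)%N) walsh rho J *
    mean (fun eta => \sum_x G x * spin_product rho val J x eta * u eta ^+ 2) +
  \sum_(s : cyl_supp f) walsh rho [set s]%SET *
    mean (fun eta => \sum_x G x * (centered rho eta (x + proj_torus n (val s)) - centered rho eta x)
       * u eta ^+ 2).
  under [X in _ = X + _]eq_bigr do rewrite -meanZ.
  under [X in _ = _ + X]eq_bigr do rewrite -meanZ.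
  rewrite -!mean_sum -meanD; apply: eq_mean => eta /=.
  under [X in _ = X + _]eq_bigr do rewrite mulr_sumr.
  under [X in _ = _ + X]eq_bigr do rewrite mulr_sumr.
  rewrite exchange_big/= [X in _ = _ + X]exchange_big/= -big_split/= mulr_suml.
  apply: eq_bigr => x _; rewrite Pi_rho_walsh mulrDr mulrDl !mulr_sumr !mulr_suml.
  congr (_ + _); apply: eq_bigr => J _.
    under eq_bigr do rewrite spinE.
    by rewrite -/(spin_product rho val J x eta); ring.
  by rewrite -spinE -(spin0 x eta); ring.
have E0 : 0 <= static_error u 1 by exact: static_error_ge0.
apply: (le_trans (ler_normD _ _)); rewrite mulrDl; apply: lerD.
  apply: (le_trans (ler_norm_sum _ _ _)).
  rewrite mulr_suml [leRHS](bigID (fun J : {set cyl_supp f} => (1 < #|J|)%N))/=.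
  rewrite -[leLHS]addr0; apply: lerD; last by apply: sumr_ge0 => J _; rewrite mulr_ge0.
  apply: ler_sum => J J1; rewrite normrM ler_wpM2l//.
  exact: static_rate_abs val_inj J1 Bn vB G1 u1 (lexx 1).
apply: (le_trans (ler_norm_sum _ _ _)); rewrite mulr_suml.
apply: ler_sum => s _; rewrite normrM -mulrA ler_wpM2l// ler_norml.
apply/andP; split; last exact: linear_rate.
rewrite lerNl -meanN.
have G1' x : `|- G x| <= 1 by rewrite normrN.
apply: le_trans (linear_rate (val s) G1' u1).
rewrite le_eqVlt; apply/orP; left; apply/eqP; apply: eq_mean => eta.
by rewrite -sumrN; apply: eq_bigr => x _; rewrite !mulNr.
Qed.

End ModelRates.

(** * The bound at fixed n *)

(* The chain is started from [(mu + nu) / 2], which is bounded below by [nu / 2],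
   at the cost of a factor 2 on expectations of nonnegative functions. *)
Lemma rel_entropy_half (R : realType) (S : finType) (mu nu : S -> R) :
  (forall x, 0 < nu x) -> (forall x, 0 <= mu x) -> \sum_x mu x = 1 -> \sum_x nu x = 1 ->
  rel_entropy (fun x => (mu x + nu x) / 2) nu <= rel_entropy mu nu / 2.
Proof.
move=> nu0 mu0 mu1 nu1; rewrite /rel_entropy mulr_suml; apply: ler_sum => x _.
pose r := mu x / nu x; have r0 : 0 <= r by rewrite divr_ge0// ltW.
have muE : mu x = nu x * r by rewrite /r mulrC divfK// gt_eqF.
have -> : (mu x + nu x) / 2 / nu x = (1 + r) / 2 by rewrite muE; field; rewrite gt_eqF.
have y0 : 0 < (1 + r) / 2 by lra.
(* Young's inequality with [b = ln ((1 + r) / 2)], for [a = r] and for [a = 1]: in the sum the terms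
   without logarithm cancel. *)
have := young_entropy (ln ((1 + r) / 2)) r0.
have := young_entropy (ln ((1 + r) / 2)) (@ler01 R).
rewrite ln1 mulr0 lnK ?posrE// mul1r -/r => h1 h2.
have -> : (mu x + nu x) / 2 * ln ((1 + r) / 2) = nu x * (((1 + r) * ln ((1 + r) / 2)) / 2).
  by rewrite muE; field.
have -> : mu x * ln r / 2 = nu x * (r * ln r / 2) by rewrite {1}muE; field.
by rewrite ler_pM2l//; lra.
Qed.

Section FixedSize.
Variables (R : realType) (d n q B : nat) (rho c0 a t MG : R).
Variables (c : 'I_d -> cylinder d R) (f : cylinder d R).
Hypothesis rho01 : 0 < rho < 1.
Hypothesis d13 : (1 <= d <= 3)%N.
Hypothesis q_gt0 : (0 < q)%N.
Hypothesis qn : (q ^ 9 <= n <= (2 * q) ^ 9)%N.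
Hypothesis n_gt1 : (1 < n)%N.
Hypotheses (c0_gt0 : 0 < c0) (a_ge1 : 1 <= a) (t_gt0 : 0 < t) (MG_gt0 : 0 < MG).
Hypothesis c_ge : forall j eta, c0 <= c j eta.
Hypothesis c_0 : forall j, independent_of (c j) 0.
Hypothesis c_e : forall j, independent_of (c j) (unit_vec int j).
Hypothesis c_small : forall j z k, z \in cyl_supp (c j) -> (`|z 0%R k|.+1 < n)%N.
Hypothesis B_gt0 : (0 < B)%N.
Hypothesis Bn : (2 * B + 2 * q ^ 5 < n)%N.
Hypothesis fB : forall (s : cyl_supp f) j, (`|val s 0%R j| <= B)%N.

Local Notation T := (torus d n).
Local Notation nu := (@bernoulli_prod T R rho).
Local Notation A := (jump_matrix (@stirring_voter_gen d n R c a)).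
Local Notation form := (exchange_form rho (unit_vec 'Z_n (d := d))).
Local Notation QE := (q%:R ^+ rate_exp d : R).
Local Notation chi := (rho * (1 - rho)).

(* The value of [th] for which the voter potential uses up half of the lower
   bound [n^2 (c0 / 2) form] on the stirring energy. *)
Definition voter_scale : R := 4 * a * d%:R / (chi * c0).

Hypothesis scale_ge1 : 1 <= voter_scale.
Hypothesis scale_le : voter_scale <= q%:R ^+ 8.

(** The rate in Gronwall's lemma, linear in [a]. The factor 2 bounds [1 + voter_scale / q ^+ 8]. *)
Definition growth_cst : R := 2 * (a * d%:R / chi) * rate_cst R.

Definition drift_cst : R := (a * d%:R / chi) * rate_cst R * (voter_scale * QE).

Definition cylinder_cst : R := \sum_(J : {set cyl_supp f}) `|walsh rho J|
   + \sum_(s : cyl_supp f) `|walsh rho [set s]%SET| * path_cst R (val s).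

Definition fluct_cst : R :=
  (Num.sqrt (a * n%:R ^+ d))^-1 * MG * cylinder_cst * (4 / c0 + 2 * rate_cst R).

(** What remains of the stirring energy once the voter potential has used up its half. *)
Let dirichlet (u : config d n -> R) : R := n%:R ^+ 2 * (c0 / 4) * form u.

Let chi_gt0 : 0 < chi.
Proof. by case/andP: rho01 => r0 r1; rewrite mulr_gt0// subr_gt0. Qed.

Let a_gt0 : 0 < a. Proof. exact: lt_le_trans a_ge1. Qed.

Let d_gt0 : 0 < d%:R :> R. Proof. by rewrite ltr0n; case/andP: d13. Qed.

Let dirichlet_ge0 u : 0 <= dirichlet u.
Proof.
apply: mulr_ge0; last exact: rate_form_ge0.
by apply: mulr_ge0; [exact: sqr_ge0|rewrite divr_ge0// ltW].
Qed.

Let cylinder_cst_ge0 : 0 <= cylinder_cst.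
Proof.
apply: addr_ge0; apply: sumr_ge0 => // s _.
by apply: mulr_ge0 => //; exact: sqr_ge0.
Qed.

Let scale_gt0 : 0 < voter_scale. Proof. exact: lt_le_trans scale_ge1. Qed.

Let ratio_ge0 : 0 <= a * d%:R / chi.
Proof. by apply/ltW/divr_gt0 => //; apply: mulr_gt0. Qed.

Let growth_cst_ge0 : 0 <= growth_cst.
Proof.
apply: mulr_ge0; last exact: rate_cst_ge0.
exact: mulr_ge0.
Qed.

Let drift_cst_ge0 : 0 <= drift_cst.
Proof.
apply: mulr_ge0; last by rewrite mulr_ge0 ?exprn_ge0// ltW.
by apply: mulr_ge0 => //; exact: rate_cst_ge0.
Qed.

Let root_unit (u : config d n -> R) : positive_unit nu u -> unit_root rho u.
Proof. by case. Qed.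

Let entropyE (u : config d n -> R) : entropy rho (fun eta => u eta ^+ 2) = sq_entropy nu u.
Proof. by []. Qed.

Let ent_ge0 (u : config d n -> R) : positive_unit nu u -> 0 <= sq_entropy nu u.
Proof. exact: (sq_entropy_ge0 (bernoulli_prod_gt0 rho01) (sum_bernoulli_prod _ _)). Qed.

Let energy_ge (u : config d n -> R) : positive_unit nu u ->
  dirichlet u - growth_cst * sq_entropy nu u - drift_cst <= energy nu A u.
Proof.
move=> uu; have := @energy_lower_bound R d n rho c c0 a rho01 n_gt1 c0_gt0 (ltW a_gt0) c_ge c_0 c_e c_small u.
apply: le_trans.
have qn5 : (2 * 1 + 2 * q ^ 5 < n)%N.
  by apply: leq_ltn_trans Bn; rewrite leq_add2r leq_mul2l B_gt0.
have := voter_rate rho01 d13 q_gt0 qn n_gt1 qn5 (root_unit uu) scale_ge1.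
set V := mean _ _ => hV.
have H0 := ent_ge0 uu; have F0 : 0 <= form u by exact: rate_form_ge0.
pose kap : R := a * d%:R / chi.
have kap0 : 0 <= kap by exact: ratio_ge0.
have k1 : a / (2 * chi) * (2 * d)%:R = kap.
  by rewrite natrM /kap; move: (chi) chi_gt0 => x x0; field; rewrite gt_eqF.
have k2 : kap / voter_scale = c0 / 4.
  rewrite /voter_scale /kap; move: (chi) chi_gt0 (d%:R) d_gt0 => x x0 y y0.
  by field; rewrite !gt_eqF.
have {}hV : a / (2 * chi) * V <= kap * static_error q rho u voter_scale.
  rewrite -k1 -[leRHS]mulrA; apply: ler_wpM2l => //.
  by apply: divr_ge0; [exact: ltW|apply: mulr_ge0 => //; exact: ltW].
apply: le_trans (lerB (lexx _) hV).
have -> : kap * static_error q rho u voter_scale = n%:R ^+ 2 * (kap / voter_scale) * form u +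
    kap * rate_cst R * (1 + voter_scale / q%:R ^+ 8) * sq_entropy nu u + drift_cst.
  by rewrite /static_error entropyE /drift_cst -/kap; ring.
have w1 : voter_scale / q%:R ^+ 8 <= 1.
  by rewrite ler_pdivrMr ?mul1r// exprn_gt0// ltr0n.
have : kap * rate_cst R * (1 + voter_scale / q%:R ^+ 8) * sq_entropy nu u <=
    growth_cst * sq_entropy nu u.
  apply: ler_wpM2r => //.
  have kr : 0 <= kap * rate_cst R by apply: mulr_ge0 => //; exact: rate_cst_ge0.
  have -> : growth_cst = kap * rate_cst R * 2 by rewrite /growth_cst -/kap; ring.
  by apply: ler_wpM2l => //; lra.
rewrite k2 /dirichlet.
move: (kap * _ * _ * _) (growth_cst * _) (drift_cst) => x y z xy; lra.
Qed.

Variables (mu : config d n -> R) (G : R -> 'rV[R]_d -> R).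
Variables (dsp : measure_display) (Omega : measurableType dsp) (P : probability Omega R).
Variable X : R -> Omega -> config d n.
Hypothesis mu_pmf : is_pmf mu.
Hypothesis chain : markov_chain (@stirring_voter_gen d n R c a) mu P X.
Hypothesis G_right : forall (x : T) s, 0 <= s -> G r (macro R x) @[r --> s^'+] --> G s (macro R x).
Hypothesis G_bounded : forall (x : T) s, 0 <= s <= 2 * t -> `|G s (macro R x)| <= MG.

Let F s (eta : config d n) : R := fluctuation a rho G f s eta.

Let fluct_cst_ge0 : 0 <= fluct_cst.
Proof.
apply: mulr_ge0; last first.
  apply: addr_ge0; first by rewrite divr_ge0// ltW.
  by apply: mulr_ge0 => //; exact: rate_cst_ge0.
by apply: mulr_ge0 => //; rewrite mulr_ge0 ?invr_ge0 ?sqrtr_ge0// ltW.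
Qed.

Let F_le s (u : config d n -> R) : 0 <= s <= 2 * t -> positive_unit nu u ->
  `|\sum_eta nu eta * (F s eta * u eta ^+ 2)| <= fluct_cst * (dirichlet u + sq_entropy nu u + QE).
Proof.
move=> st uu.
pose S : R := (Num.sqrt (a * n%:R ^+ d))^-1.
have S0 : 0 <= S by rewrite invr_ge0 sqrtr_ge0.
have H0 := ent_ge0 uu; have D0 := dirichlet_ge0 u.
have -> : \sum_eta nu eta * (F s eta * u eta ^+ 2) = S * MG *
   mean rho (fun eta => (\sum_(x : T) (G s (macro R x) / MG) *
      Pi_rho rho f (periodic_ext (tshift x eta))) * u eta ^+ 2).
  rewrite -meanZ; apply: eq_bigr => eta _; congr (_ * _).
  rewrite mulrA; congr (_ * _); rewrite /F /fluctuation -/S -mulrA; congr (_ * _).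
  rewrite mulr_sumr; apply: eq_bigr => x _.
  by field; rewrite gt_eqF.
have G1 (x : T) : `|G s (macro R x) / MG| <= 1.
  by rewrite normrM normfV (gtr0_norm MG_gt0) ler_pdivrMr// mul1r G_bounded.
have := fluct_rate rho01 d13 q_gt0 qn n_gt1 Bn fB G1 (root_unit uu).
rewrite -/cylinder_cst => h.
rewrite normrM ger0_norm; last by rewrite mulr_ge0// ltW.
apply: (@le_trans _ _ (S * MG * (cylinder_cst * static_error q rho u 1))).
  by rewrite ler_wpM2l// mulr_ge0// ltW.
rewrite /fluct_cst -/S [leLHS]mulrA -[leRHS]mulrA; apply: ler_wpM2l.
  by rewrite mulr_ge0// mulr_ge0// ltW.
rewrite /static_error entropyE divr1 mul1r.
have Q8 : (q%:R ^+ 8)^-1 <= 1 :> R by rewrite invf_le1 ?exprn_gt0 ?ltr0n// exprn_ege1// ler1n.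
have e1 : n%:R ^+ 2 * form u = 4 / c0 * dirichlet u.
  by rewrite /dirichlet; field; rewrite gt_eqF.
have rc0 := rate_cst_ge0 R.
have QE0 : 0 <= QE by rewrite exprn_ge0.
have c04 : 0 <= 4 / c0 by rewrite divr_ge0// ltW.
have e2 : rate_cst R * ((1 + (q%:R ^+ 8)^-1) * sq_entropy nu u + 1 * QE) <=
   rate_cst R * (2 * sq_entropy nu u + 2 * QE).
  apply: ler_wpM2l => //; apply: lerD; last by rewrite ler_wpM2r// ler1n.
  by rewrite ler_wpM2r//; lra.
apply: (le_trans (lerD (lexx _) e2)); rewrite e1.
have := mulr_ge0 rc0 D0; have := mulr_ge0 c04 H0; have := mulr_ge0 c04 QE0.
move: (dirichlet u) (sq_entropy nu u) (QE) (4 / c0) (rate_cst R) => x y z v w; lra.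
Qed.

Let mu' eta : R := (mu eta + nu eta) / 2.

Let mu'_ge eta : nu eta / 2 <= mu' eta.
Proof. by have [mu0 _] := mu_pmf; rewrite ler_pM2r// lerDr. Qed.

Let mu'_sum : \sum_eta mu' eta = 1.
Proof.
have [_ mu1] := mu_pmf.
by rewrite -mulr_suml big_split/= mu1 sum_bernoulli_prod divff.
Qed.

Let h N : R := t / N.+1%:R.

Let h_cvg0 : h N @[N --> \oo] --> 0.
Proof. by rewrite -(mulr0 t); apply: cvgM; [exact: cvg_cst|exact: cvg_harmonic]. Qed.

(** The bound [2 * (5 * tilted_cst)] as the mesh tends to 0, when the curvature term drops out. The
    factor 2 is the price of [mu <= 2 mu']. *)
Definition path_cst_limit (H : R) : R :=
  let g := 4 + 3 / 2 * H + t * drift_cst in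
  10 * (fluct_cst * (g + (growth_cst + 1) * t * (4 * g * expR (4 * growth_cst * t)) + t * QE)).

Let path_cst_N N : R :=
  let g := 4 + 3 / 2 * rel_entropy mu' nu + t * drift_cst + t * h N * curvature_cst nu A in
  10 * (fluct_cst * (g + (growth_cst + 1) * t * (4 * g * expR (4 * growth_cst * t)) + t * QE)).

Let path_cst_cvg : path_cst_N N @[N --> \oo] --> path_cst_limit (rel_entropy mu' nu).
Proof.
have gc : 4 + 3 / 2 * rel_entropy mu' nu + t * drift_cst + t * h N * curvature_cst nu A
    @[N --> \oo] --> 4 + 3 / 2 * rel_entropy mu' nu + t * drift_cst.
  rewrite -[X in _ --> X]addr0; apply: cvgD; first exact: cvg_cst.
  rewrite -(mul0r (curvature_cst nu A)); apply: cvgM; last exact: cvg_cst.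
  by rewrite -(mulr0 t); apply: cvgM; [exact: cvg_cst|exact: h_cvg0].
apply: cvgM; first exact: cvg_cst.
apply: cvgM; first exact: cvg_cst.
apply: cvgD; last exact: cvg_cst.
apply: cvgD => //; apply: cvgM; first exact: cvg_cst.
by apply: cvgM; [apply: cvgM => //; exact: cvg_cst|exact: cvg_cst].
Qed.

Lemma fixed_size_bound :
  ('E_P[fun w => (`| \int[lebesgue_measure]_(s in `[0, t]) fluctuation a rho G f s (X s w) |)%R]
   <= (path_cst_limit (rel_entropy mu' nu))%:E)%E.
Proof.
have [mu0 mu1] := mu_pmf.
have chain' : markov_chain (matrix_op A) mu P X by rewrite gen_op.
pose Pi1 : R := \sum_eta \sum_(x : T) `|Pi_rho rho f (periodic_ext (tshift x eta))|.
pose MF : R := (Num.sqrt (a * n%:R ^+ d))^-1 * (MG * Pi1).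
have F_right eta s : 0 <= s -> F r eta @[r --> s^'+] --> F s eta.
  move=> s0; apply: cvgM; first exact: cvg_cst.
  apply: (cvg_big (Ff := fun x r => G r (macro R x) * _) add_continuous) => // x _.
  by apply: cvgM; [exact: G_right|exact: cvg_cst].
have F_bounded eta s : 0 <= s <= 2 * t -> `|F s eta| <= MF.
  move=> st; rewrite normrM ger0_norm ?invr_ge0 ?sqrtr_ge0//.
  rewrite ler_wpM2l ?invr_ge0 ?sqrtr_ge0//.
  apply: (le_trans (ler_norm_sum _ _ _)).
  apply: (@le_trans _ _ (MG * \sum_(x : T) `|Pi_rho rho f (periodic_ext (tshift x eta))|)).
    rewrite mulr_sumr; apply: ler_sum => x _; rewrite normrM ler_wpM2r//.
    exact: G_bounded.
  rewrite ler_wpM2l ?(ltW MG_gt0)// /Pi1 [leRHS](bigD1 eta)//= lerDl.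
  by apply: sumr_ge0 => z _; apply: sumr_ge0.
apply: (process_bound (gen_offdiag c0_gt0 (ltW a_gt0) c_ge) (gen_row c a) mu_pmf chain' t_gt0
  F_right F_bounded path_cst_cvg).
have c1 : 0 < growth_cst * 4 + 1 by have := growth_cst_ge0; lra.
have nA : 0 < \sum_eta `|A eta eta| + 1 by rewrite ltr_wpDl// sumr_ge0.
near=> N.
have h0 : 0 < h N by rewrite divr_gt0.
have hsmall1 : h N < (growth_cst * 4 + 1)^-1.
  by near: N; apply: (cvgr_lt _ h_cvg0); rewrite invr_gt0.
have hsmall2 : h N < (\sum_eta `|A eta eta| + 1)^-1.
  by near: N; apply: (cvgr_lt _ h_cvg0); rewrite invr_gt0.
have ch : growth_cst * h N <= 1 / 4.
  move: hsmall1; rewrite -[X in _ < X]mul1r ltr_pdivlMr//; nra.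
have hA eta : 0 < 1 + h N * A eta eta.
  have : `|A eta eta| <= \sum_eta `|A eta eta|.
    by rewrite [leRHS](bigD1 eta)//= lerDl sumr_ge0.
  move: hsmall2; rewrite -[X in _ < X]mul1r ltr_pdivlMr//.
  have := ler_norm (- A eta eta); rewrite normrN.
  move: (\sum_(_ : _) _) (A eta eta) => x y; nra.
have hNt : N.+1%:R * h N = t by rewrite /h mulrC divfK.
(* [path_bound] asks for the static bound at every index, whereas [G] is bounded by [MG] only up to
   time [2 t]; beyond [N + 1] the functional is cut off. *)
pose W (i : nat) eta : R := if (i <= N.+1)%N then F (i%:R * h N) eta else 0.
have W_le i u : positive_unit nu u -> `|\sum_eta nu eta * (W i eta * u eta ^+ 2)| <=
    fluct_cst * (dirichlet u + sq_entropy nu u + QE).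
  move=> uu; rewrite /W; case: (leqP i N.+1) => iN; last first.
    rewrite big1 => [|eta _]; last by rewrite mul0r mulr0.
    rewrite normr0; apply: mulr_ge0 => //; apply: addr_ge0; last exact: exprn_ge0.
    by apply: addr_ge0; [exact: dirichlet_ge0|exact: ent_ge0].
  apply: F_le => //; apply/andP; split; first by rewrite mulr_ge0// ltW.
  apply: (@le_trans _ _ (N.+1%:R * h N)); first by rewrite ler_pM2r// ler_nat.
  by rewrite hNt ler_peMl ?ler1n ?ltW.
have := @path_bound R (config d n) nu A (h N) N.+1 (bernoulli_prod_gt0 rho01)
  (sum_bernoulli_prod _ _) (gen_offdiag c0_gt0 (ltW a_gt0) c_ge) (gen_row c a) (ltW h0) hA
  dirichlet growth_cst drift_cst fluct_cst QE W dirichlet_ge0 growth_cst_ge0 drift_cst_ge0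
  fluct_cst_ge0 energy_ge W_le ch mu' mu'_ge mu'_sum.
move=> bound.
have XE (p : config d n * N.+1.-tuple (config d n)) :
    h N * (\sum_(0 <= i < N.+1) F (i.+1%:R * h N) (site p i.+1)) = riemann_sum (h N) W p.
  congr (_ * _); apply: eq_big_nat => i /andP[_ iN].
  by rewrite /W iN.
apply: (@le_trans _ _ (2 * \sum_(p : config d n * N.+1.-tuple (config d n))
   path_law A (h N) mu' p * `|riemann_sum (h N) W p|)).
  rewrite mulr_sumr; apply: ler_sum => p _; rewrite XE mulrA ler_wpM2r//.
  rewrite /path_law mulrA ler_wpM2r//.
    apply: path_weight_ge0 => _ x y.
    exact: (euler_kernel_ge0 (gen_offdiag c0_gt0 (ltW a_gt0) c_ge) (ltW h0) hA).
  by rewrite /mu' mulrC divfK// lerDl bernoulli_prod_ge0.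
apply: (@le_trans _ _ (2 * (5 * tilted_cst nu A (h N) N.+1 growth_cst drift_cst fluct_cst QE mu'))).
  by rewrite ler_pM2l.
rewrite /path_cst_N /tilted_cst /gronwall_cst /initial_cst hNt.
have -> : N.+1%:R * (h N ^+ 2 * curvature_cst nu A) = t * h N * curvature_cst nu A.
  by rewrite -[in RHS]hNt; ring.
by rewrite le_eqVlt; apply/orP; left; apply/eqP; ring.
Unshelve. all: by end_near.
Qed.

End FixedSize.

(** * Asymptotics *)

Lemma ninth_root (n : nat) : (0 < n)%N -> exists2 q, (0 < q)%N & (q ^ 9 <= n <= (2 * q) ^ 9)%N.
Proof.
move=> n0; have ex : exists q, (q ^ 9 <= n)%N by exists 1%N; rewrite exp1n.
have bnd q : (q ^ 9 <= n)%N -> (q <= n)%N.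
  by apply: leq_trans; case: q => // q; rewrite expnS leq_pmulr// expn_gt0.
case: (ex_maxnP ex bnd) => q qn qmax.
have q0 : (0 < q)%N by apply: qmax; rewrite exp1n.
exists q => //; rewrite qn/=; have [//|/ltnW/(leq_trans _) nq] := leqP n ((2 * q) ^ 9).
have : (q.+1 <= q)%N by apply/qmax/nq; rewrite leq_exp2r// mul2n -addnn -addn1 leq_add2l.
by rewrite ltnn.
Qed.

Section Asymptotics.
Variables (R : realType) (d n q : nat).
Hypothesis d13 : (1 <= d <= 3)%N.
Hypothesis q_gt0 : (0 < q)%N.
Hypothesis qn : (q ^ 9 <= n <= (2 * q) ^ 9)%N.
Local Notation QE := (q%:R ^+ rate_exp d : R).

Let n_gt0 : (0 < n)%N.
Proof. by case/andP: qn => + _; apply: leq_trans; rewrite expn_gt0 q_gt0. Qed.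

Let Q0 : 0 < q%:R :> R. Proof. by rewrite ltr0n. Qed.

Let Q1 : 1 <= q%:R :> R. Proof. by rewrite ler1n. Qed.

Let N0 : 0 < n%:R :> R. Proof. by rewrite ltr0n. Qed.

Lemma ln_root_le : ln n%:R <= 9 * (ln q%:R + 1) :> R.
Proof.
have -> : ln q%:R + 1 = ln q%:R + ln (expR 1) :> R by rewrite expRK.
rewrite -lnM ?posrE ?expR_gt0// mulr_natl -lnXn ?mulr_gt0 ?expR_gt0//.
rewrite ler_ln ?posrE ?exprn_gt0 ?mulr_gt0 ?expR_gt0//.
have [_ h] := andP qn; apply: (@le_trans _ _ ((2 * q) ^ 9)%:R); first by rewrite ler_nat.
rewrite natrX lerXn2r ?nnegrE ?mulr_ge0 ?expR_ge0// natrM mulrC ler_pM2l//.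
by have := expR_ge1Dx (1 : R); lra.
Qed.

Lemma ln_root_linear : ln n%:R <= 18 * q%:R :> R.
Proof.
apply: (le_trans ln_root_le).
by have := ln_sublinear Q0; move: Q1; move: (ln _) => x; move: (q%:R) => y; lra.
Qed.

(** Thus the initial entropy does not exceed the order of the drift that the voter dynamics produces
    anyway. *)
Lemma entropy_bound_le (a : R) : 1 <= a -> entropy_bound d n a <= 2 ^+ 9 * (a * QE).
Proof.
move=> a1; have a0 : 0 <= a by lra.
have k9 : 1 <= 2 ^+ 9 :> R by rewrite exprn_ege1// ler1n.
have QE1 : q%:R <= QE.
  rewrite -[leLHS]expr1 ler_weXn2l//; move: d13; by case: d => [|[|[|[]]]].
case: d d13 QE1 => [|[|[|[|]]]]//= _ QE1.
- have sa : Num.sqrt a <= a.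
    by rewrite -{2}(sqr_sqrtr a0) expr2 ler_peMl ?sqrtr_ge0// -[leLHS]sqrtr1 ler_sqrt.
  apply: (le_trans sa); apply: (@le_trans _ _ (a * q%:R ^+ 4)).
    by rewrite ler_peMr// (le_trans Q1).
  by rewrite ler_peMl// mulr_ge0// exprn_ge0.
- rewrite mulrCA ler_wpM2l//; apply: (le_trans ln_root_linear).
  apply: ler_pM => //.
  by rewrite (_ : 2 ^+ 9 = 512 :> R) ?ler_nat//; ring.
- rewrite mulrCA ler_wpM2l//.
  apply: (@le_trans _ _ ((2 * q) ^ 9)%:R); first by rewrite ler_nat; case/andP: qn.
  rewrite natrX natrM exprMn ler_wpM2l ?exprn_ge0//.
  by rewrite ler_weXn2l.
Qed.

(** This is [2 E + 1 <= 9 d] for [E = rate_exp d]. The gain [q ^ (-1/2)] is written as an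
    exponential, to be weighed against the Gronwall factor. *)
Lemma rate_volume_le (a : R) : 1 <= a ->
  (Num.sqrt (a * n%:R ^+ d))^-1 * QE <= expR (- (ln q%:R / 2)).
Proof.
move=> a1; have a0 : 0 < a by lra.
have V0 : 0 < a * n%:R ^+ d by rewrite mulr_gt0// exprn_gt0.
rewrite mulrC ler_pdivrMr ?sqrtr_gt0// mulrC.
have q12 : expR (ln q%:R / 2) = Num.sqrt q%:R :> R.
  have e : expR (ln q%:R / 2) ^+ 2 = q%:R :> R by rewrite -expRM_natl mulrC divfK// lnK.
  by rewrite -[in RHS]e sqrtr_sqr ger0_norm// expR_ge0.
rewrite expRN q12 ler_pdivlMr ?sqrtr_gt0//.
rewrite -(ger0_norm (exprn_ge0 (rate_exp d) (ltW Q0))) -sqrtr_sqr -sqrtrM ?sqr_ge0//.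
rewrite ler_sqrt ?(ltW V0)// -exprM -exprSr.
apply: (@le_trans _ _ (n%:R ^+ d)); last by rewrite ler_peMl ?exprn_ge0.
apply: (@le_trans _ _ (q%:R ^+ (9 * d))).
  by rewrite ler_weXn2l//; move: d13; case: d => [|[|[|[]]]].
rewrite exprM lerXn2r ?nnegrE ?exprn_ge0// -natrX ler_nat.
by case/andP: qn.
Qed.

(** With [s = sqrt (ln n)], [k s <= s^2 / 36 + 9 k^2]: half of the gain
    [ln q / 2 >= ln n / 18 - 1 / 2] pays for the Gronwall factor. *)
Lemma expR_sqrt_ln_le (a k : R) : 0 <= k -> a <= Num.sqrt (ln n%:R) ->
  expR (k * a) * expR (- (ln q%:R / 2)) <= expR (9 * k ^+ 2 + 1) * expR (- (ln n%:R / 36)).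
Proof.
move=> k0 a_le; rewrite -!expRD ler_expR.
have ka := ler_wpM2l k0 a_le.
have y0 : 0 <= ln n%:R :> R by rewrite ln_ge0// ler1n.
have := sqr_sqrtr y0; have := sqrtr_ge0 (ln n%:R : R).
have := ln_root_le; move: ka; move: (Num.sqrt _) => s ka h s0 sE.
have := sqr_ge0 (s / 6 - 3 * k); rewrite sqrrB !expr2.
move: h sE; rewrite expr2; move: (ln _) (ln _) => y z h sE; lra.
Qed.

End Asymptotics.

(** The drift brings [a ^+ 2] and the growth constant one more [a]; [a ^+ 3 <= expR (3 * a)] moves
    these powers into the exponent. *)
Lemma gronwall_le (R : realType) (a Q H K k1 k2 k4 t g : R) :
  1 <= a -> 1 <= Q -> 0 <= K -> 0 <= k1 -> 0 <= k2 -> 0 < t -> H <= K * (a * Q) ->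
  g <= 4 + 3 / 2 * H + t * (k2 * (a ^+ 2 * Q)) -> 4 + 3 / 2 * K + t * k2 <= k4 ->
  g + (k1 * a + 1) * t * (4 * g * expR (4 * (k1 * a) * t)) + t * Q <=
  (k4 + (k1 + 1) * t * (4 * k4) + t) * Q * expR ((4 * k1 * t + 3) * a).
Proof.
move=> a1 Q1 K0 k10 k20 t0 HK gle k4_ge.
have a2 : a <= a ^+ 2 by rewrite expr2 ler_peMr//; lra.
have a3 : a ^+ 2 <= a ^+ 3 by rewrite ler_weXn2l.
have aQ : a * Q <= a ^+ 2 * Q by rewrite ler_wpM2r//; lra.
have a2Q : 1 <= a ^+ 2 * Q by rewrite mulr_ege1// exprn_ege1.
pose X := k4 * (a ^+ 2 * Q).
have tk : 0 <= t * k2 by rewrite mulr_ge0// ltW.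
have k40 : 0 <= k4 by lra.
have X0 : 0 <= X by rewrite mulr_ge0//; lra.
have gX : g <= X.
  have h1 : H <= K * (a ^+ 2 * Q) by apply: (le_trans HK); rewrite ler_wpM2l.
  have h2 : 0 <= K * (a ^+ 2 * Q) by rewrite mulr_ge0//; lra.
  apply: (le_trans gle); apply: (@le_trans _ _ ((4 + 3 / 2 * K + t * k2) * (a ^+ 2 * Q))); last first.
    by rewrite ler_wpM2r//; lra.
  rewrite [leRHS]mulrDl [t * (k2 * _)]mulrA.
  have -> : (4 + 3 / 2 * K) * (a ^+ 2 * Q) = 4 * (a ^+ 2 * Q) + 3 / 2 * (K * (a ^+ 2 * Q)) by ring.
  by move: (a ^+ 2 * Q) a2Q h1 h2 => z a2Q h1 h2; rewrite lerD2r; lra.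
set E := expR _; have E1 : 1 <= E.
  by rewrite -expR0 ler_expR mulr_ge0 ?mulr_ge0//; lra.
have E0 : 0 <= E by lra.
have k1a : k1 * a + 1 <= (k1 + 1) * a by rewrite mulrDl mul1r lerD2l.
have k1a0 : 0 <= k1 * a by rewrite mulr_ge0//; lra.
have s1 : (k1 * a + 1) * t * (4 * g * E) <= (k1 + 1) * a * t * (4 * X * E).
  apply: (@le_trans _ _ ((k1 * a + 1) * t * (4 * X * E))).
    apply: ler_wpM2l; first by rewrite mulr_ge0 ?ltW//; lra.
    by rewrite ler_wpM2r// ler_pM2l.
  apply: ler_wpM2r; first by rewrite mulr_ge0// mulr_ge0.
  by rewrite ler_wpM2r// ltW.
have a1' : 1 <= a ^+ 2 by rewrite exprn_ege1.
have aE : a ^+ 2 <= a ^+ 3 * E.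
  by apply: (le_trans a3); rewrite ler_peMr// exprn_ge0//; lra.
have Q0 : 0 <= Q by lra.
have s0 : X <= k4 * Q * (a ^+ 3 * E).
  have -> : X = k4 * Q * a ^+ 2 by rewrite /X; ring.
  by apply: ler_wpM2l => //; exact: mulr_ge0.
have s2 : t * Q <= t * Q * (a ^+ 3 * E).
  by apply: ler_peMr; [apply: mulr_ge0 => //; exact: ltW|lra].
have F : a ^+ 3 * E <= expR ((4 * k1 * t + 3) * a).
  have -> : (4 * k1 * t + 3) * a = 3%:R * a + 4 * (k1 * a) * t by ring.
  rewrite expRD expRM_natl; apply: ler_wpM2r => //.
  apply: lerXn2r; rewrite ?nnegrE ?expR_ge0//; first by lra.
  by have := expR_ge1Dx a; lra.
apply: (@le_trans _ _ ((k4 + (k1 + 1) * t * (4 * k4) + t) * Q * (a ^+ 3 * E))).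
  have -> : (k4 + (k1 + 1) * t * (4 * k4) + t) * Q * (a ^+ 3 * E) =
    k4 * Q * (a ^+ 3 * E) + (k1 + 1) * a * t * (4 * X * E) + t * Q * (a ^+ 3 * E) by rewrite /X; ring.
  by apply: lerD => //; apply: lerD => //; exact: le_trans gX s0.
apply: ler_wpM2l => //; apply: mulr_ge0 => //; apply: addr_ge0; last exact: ltW.
apply: addr_ge0 => //; apply: mulr_ge0; last by apply: mulr_ge0.
by apply: mulr_ge0; [lra|exact: ltW].
Qed.

Lemma macro_unit (R : realType) (d n : nat) (x : torus d n) i : (1 < n)%N ->
  0 <= macro R x 0 i <= 1.
Proof.
move=> n1; rewrite mxE divr_ge0//= ler_pdivrMr ?mul1r ?ltr0n ?(ltnW n1)// ler_nat.
by have := ltn_ord (x 0 i); rewrite [X in (_ < X)%N]Zp_cast// => /ltnW.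
Qed.

(** The points [macro R x] lie in the unit cube for every [n], so one compact set gives a bound
    uniform in [n]. *)
Lemma C01_bounded (R : realType) (d : nat) (G : R -> 'rV[R]_d -> R) (t : R) : C01 G ->
  exists2 M, 0 < M & forall n (x : torus d n) s, (1 < n)%N -> 0 <= s <= t -> `|G s (macro R x)| <= M.
Proof.
move=> CG; pose K := `[0, t]%classic `*` [set v : 'rV[R]_d | forall i, `[0, 1]%classic (v ord0 i)].
have Kc : compact K.
  apply: compact_setX; first exact: segment_compact.
  by apply: (@rV_compact R d (fun=> `[0, 1]%classic)) => i; exact: segment_compact.
have GK : {within K, continuous (fun p : R * 'rV[R]_d => G p.1 p.2)}.
  apply: continuous_subspaceW (C01_continuous CG).
  by move=> [s v] [/=]; rewrite in_itv/= => /andP[].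
have [M M0 HM] := pinfty_ex_gt0 (compact_bounded (continuous_compact GK Kc)).
exists M => // n x s n1 st; apply: (HM (G s (macro R x))); exists (s, macro R x) => //.
by split => [|i] /=; rewrite in_itv/=//; exact: macro_unit.
Qed.

Lemma C01_right_continuous (R : realType) (d : nat) (G : R -> 'rV[R]_d -> R) (u : 'rV[R]_d) (s : R) :
  C01 G -> 0 <= s -> G r u @[r --> s^'+] --> G s u.
Proof.
move=> CG s0; have /subspace_continuousP/(_ (s, u) s0) := C01_continuous CG.
apply: (@cvg_comp _ _ _ (fun r => (r, u)) (fun p : R * 'rV[R]_d => G p.1 p.2)) => A wA.
have su : (r, u) @[r --> s^'+] --> (s, u).
  have ss : r @[r --> s^'+] --> s by apply: cvg_at_right_filter; exact: cvg_id.
  exact: (cvg_pair ss (cvg_cst u)).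
have near_A : \forall r \near s^'+, 0 <= r -> A (r, u) by exact: su wA.
have : \forall r \near s^'+, A (r, u).
  near=> r; have : 0 <= r -> A (r, u) by near: r.
  by apply; apply: (le_trans s0); apply: ltW; near: r; exact: nbhs_right_gt.
by [].
Unshelve. all: by end_near.
Qed.

Lemma cvg_expR_ln (R : realType) : expR (- (ln n%:R / 36)) @[n --> \oo] --> (0 : R).
Proof.
apply: (@cvg_comp _ _ _ (fun n : nat => ln n%:R / 36 : R) (fun x => expR (- x)) _ (pinfty_nbhs R)); last first.
  exact: cvgr_expR.
apply/cvgryPge => A; near=> n.
rewrite ler_pdivlMr// -(expRK (A * 36)) ler_ln ?posrE ?expR_gt0//.
  by near: n; exact: nbhs_infty_ger.
by rewrite ltr0n; near: n; exact: nbhs_infty_gt.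
Unshelve. all: by end_near.
Qed.

Section Limit.
Variables (R : realType) (d n q : nat) (rho c0 a t MG : R) (f : cylinder d R).
Hypothesis rho01 : 0 < rho < 1.
Hypothesis d13 : (1 <= d <= 3)%N.
Hypothesis q_gt0 : (0 < q)%N.
Hypothesis qn : (q ^ 9 <= n <= (2 * q) ^ 9)%N.
Hypotheses (c0_gt0 : 0 < c0) (a_ge1 : 1 <= a) (t_gt0 : 0 < t) (MG_gt0 : 0 < MG).
Hypothesis a_le : a <= Num.sqrt (ln n%:R).
Local Notation chi := (rho * (1 - rho)).

(** What is left of [growth_cst], [drift_cst] and [fluct_cst] when the factors [a], [a ^+ 2 * q ^ E]
    and [1 / sqrt (a n^d)] are taken out. *)
Definition limit_rates : R * R * R :=
  (2 * (d%:R / chi) * rate_cst R,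
   (d%:R / chi) * rate_cst R * (4 * d%:R / (chi * c0)),
   MG * cylinder_cst rho f * (4 / c0 + 2 * rate_cst R)).

Definition limit_cst : R :=
  let: (k1, k2, k3) := limit_rates in
  let k4 := 4 + 3 / 2 * 2 ^+ 9 + t * k2 in
  10 * (k3 * (k4 + (k1 + 1) * t * (4 * k4) + t)) * expR (9 * (4 * k1 * t + 3) ^+ 2 + 1).

Lemma path_cst_limit_le H : H <= entropy_bound d n a / 2 ->
  path_cst_limit n q rho c0 a t MG f H <= limit_cst * expR (- (ln n%:R / 36)).
Proof.
move=> HE; rewrite /limit_cst /limit_rates.
set k1 := 2 * _ * _; set k2 := _ * _ * (_ / _); set k3 := MG * _ * _.
set k4 := _ + t * k2; set k5 := _ + t.
have chi0 : 0 < chi by case/andP: rho01 => r0 r1; rewrite mulr_gt0// subr_gt0.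
have dchi : 0 <= d%:R / chi by rewrite divr_ge0// ltW.
have r0 := rate_cst_ge0 R.
have k10 : 0 <= k1 by apply: mulr_ge0 => //; exact: mulr_ge0.
have k20 : 0 <= k2.
  apply: mulr_ge0; first exact: mulr_ge0.
  by apply: divr_ge0; [exact: mulr_ge0|apply: mulr_ge0; exact: ltW].
have cyl0 : 0 <= cylinder_cst rho f.
  apply: addr_ge0; apply: sumr_ge0 => // s _.
  by apply: mulr_ge0 => //; exact: sqr_ge0.
have k30 : 0 <= k3.
  apply: mulr_ge0; first by apply: mulr_ge0 => //; exact: ltW.
  by apply: addr_ge0; [rewrite divr_ge0// ltW|exact: mulr_ge0].
have K9 : 0 <= 2 ^+ 9 :> R by exact: exprn_ge0.
have Q1 : 1 <= q%:R ^+ rate_exp d :> R by rewrite exprn_ege1// ler1n.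
have HQ : H <= 2 ^+ 9 * (a * q%:R ^+ rate_exp d).
  have := entropy_bound_le d13 q_gt0 qn a_ge1.
  have : 0 <= 2 ^+ 9 * (a * q%:R ^+ rate_exp d).
    by apply: mulr_ge0 => //; apply: mulr_ge0; [exact: le_trans a_ge1|exact: exprn_ge0].
  move: (2 ^+ 9 * _) => x; lra.
pose Q : R := q%:R ^+ rate_exp d.
pose g := 4 + 3 / 2 * H + t * drift_cst d q rho c0 a.
have gle : g <= 4 + 3 / 2 * H + t * (k2 * (a ^+ 2 * Q)).
  rewrite le_eqVlt; apply/orP; left; apply/eqP; congr (_ + t * _).
  rewrite /drift_cst /voter_scale /k2 -/Q; move: (Q) (rate_cst R) => z w.
  by move: chi0 => /gt_eqF chiN; field; rewrite !gt_eqF//; case/andP: rho01 => ? ?; rewrite ?subr_gt0.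
have B := gronwall_le a_ge1 Q1 K9 k10 k20 t_gt0 HQ gle (lexx k4).
have growE : growth_cst d rho a = k1 * a by rewrite /growth_cst /k1; ring.
pose S : R := (Num.sqrt (a * n%:R ^+ d))^-1.
have S0 : 0 <= S by rewrite invr_ge0 sqrtr_ge0.
have SQ := rate_volume_le d13 q_gt0 qn a_ge1.
have k0 : 0 <= 4 * k1 * t + 3 by have := mulr_ge0 k10 (ltW t_gt0); rewrite -mulrA; lra.
have ES := expR_sqrt_ln_le q_gt0 qn k0 a_le.
have k40 : 0 <= k4 by have := mulr_ge0 (ltW t_gt0) k20; rewrite /k4; move: (2 ^+ 9) K9 (t * k2) => x hx y hy; lra.
have k50 : 0 <= k5.
  apply: addr_ge0; last exact: ltW.
  apply: addr_ge0 => //; apply: mulr_ge0; last exact: mulr_ge0.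
  by apply: mulr_ge0; [exact: addr_ge0|exact: ltW].
have -> : path_cst_limit n q rho c0 a t MG f H = 10 * (S * k3 *
    (g + (k1 * a + 1) * t * (4 * g * expR (4 * (k1 * a) * t)) + t * Q)).
  rewrite /path_cst_limit -/g growE; congr (_ * (_ * _)).
  by rewrite /fluct_cst -/S /k3 !mulrA.
apply: (@le_trans _ _ (10 * (k3 * k5) * (expR ((4 * k1 * t + 3) * a) * expR (- (ln q%:R / 2))))); last first.
  rewrite -[leRHS]mulrA; apply: ler_wpM2l => //.
  by apply: mulr_ge0 => //; exact: mulr_ge0.
apply: (@le_trans _ _ (10 * (k3 * k5) * (expR ((4 * k1 * t + 3) * a) * (S * Q)))); last first.
  apply: ler_wpM2l; first by apply: mulr_ge0 => //; exact: mulr_ge0.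
  by apply: ler_wpM2l; rewrite ?expR_ge0.
apply: (@le_trans _ _ (10 * (S * k3 * (k5 * Q * expR ((4 * k1 * t + 3) * a))))); last first.
  by rewrite le_eqVlt; apply/orP; left; apply/eqP; ring.
by apply: ler_wpM2l => //; apply: ler_wpM2l => //; exact: mulr_ge0.
Qed.

End Limit.

Definition coord_bound (d : nat) (A : {fset lattice d}) : nat :=
  \max_(z : A) \max_(k < d) `|val z 0%R k|%N.

Lemma coord_boundP (d : nat) (A : {fset lattice d}) z k : z \in A -> (`|z 0%R k| <= coord_bound A)%N.
Proof.
move=> zA; apply: leq_trans (leq_bigmax [` zA]%fset).
exact: (leq_bigmax (F := fun k => `|z 0%R k|%N)).
Qed.

Theorem theorem3p3 (R : realType) (d : nat) (hd : (1 <= d <= 3)%N)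
  (c : 'I_d -> cylinder d R) (h : 'I_d -> 'I_d -> cylinder d R) (c0 : R)
  (hc0 : 0 < c0)
  (hc : forall (j : 'I_d) (eta : zconfig d), c0 <= c j eta)
  (hc_0 : forall j : 'I_d, independent_of (c j) 0)
  (hc_e : forall j : 'I_d, independent_of (c j) (unit_vec int j))
  (hgrad : gradient_condition c h)
  (rho : R) (hrho : 0 < rho < 1)
  (a : nat -> R)
  (ha_pos : forall n : nat, (1 <= n)%N -> 0 < a n)
  (ha_infty : a n @[n --> \oo] --> +oo)
  (ha_log : forall n : nat, (2 <= n)%N -> a n <= Num.sqrt (ln n%:R))
  (mu : forall n : nat, config d n -> R)
  (hmu : forall n : nat, (3 <= n)%N -> is_pmf (mu n))
  (hmu_entropy : forall n : nat, (3 <= n)%N ->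
     rel_entropy (mu n) (bernoulli_prod rho) <= entropy_bound d n (a n))
  (dsp : nat -> measure_display)
  (Omega : forall n : nat, measurableType (dsp n))
  (P : forall n : nat, probability (Omega n) R)
  (eta : forall n : nat, R -> Omega n -> config d n)
  (heta : forall n : nat, (3 <= n)%N ->
     markov_chain (@stirring_voter_gen d n R c (a n)) (mu n) (P n) (eta n)) :
  forall (t : R) (G : R -> 'rV[R]_d -> R) (f : cylinder d R),
    0 < t -> C01 G ->
    ('E_(P n) [fun w => (`| \int[lebesgue_measure]_(s in `[0, t])
                             fluctuation (a n) rho G f s (eta n s w) |)%R])%E
      @[n --> \oo] --> 0%E.
Proof.
move=> t G f t_gt0 CG.
have [MG MG_gt0 G_bounded] := C01_bounded (2 * t) CG.
pose kap := voter_scale d rho c0 1.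
have chi_gt0 : 0 < rho * (1 - rho).
  by case/andP: hrho => r0 r1; rewrite mulr_gt0// subr_gt0.
have kap_gt0 : 0 < kap.
  rewrite divr_gt0//; last exact: mulr_gt0.
  by rewrite mulr_gt0// ltr0n; case/andP: hd.
have kapE x : voter_scale d rho c0 x = kap * x.
  by rewrite /kap /voter_scale mulr1; ring.
pose B := (coord_bound (cyl_supp f)).+1.
pose Bc := (\max_j coord_bound (cyl_supp (c j)))%N.
(* A lower bound to be forced on [q] through [n > (2 C) ^ 9]: [B] and 2 serve [Bn], and [18 * kap]
   serves [scale_le]. *)
pose C := (B + 2 + (Num.bound (18 * kap)))%N.
pose K := limit_cst rho c0 t MG f.
apply: (@squeeze_cvge _ _ _ _ (fun=> 0%E) _ (fun n => (K * expR (- (ln n%:R / 36)))%:E)); last 2 first.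
- exact: cvg_cst.
- apply: cvg_EFin; first exact: nearW.
  by rewrite -(mulr0 K); apply: cvgM; [exact: cvg_cst|exact: cvg_expR_ln].
near=> n.
have n3 : (3 <= n)%N by near: n; exact: nbhs_infty_ge.
have n_gt1 : (1 < n)%N by exact: ltnW.
have n_gt0 : (0 < n)%N by exact: ltnW.
have a1 : 1 <= a n by near: n; exact: (cvgry_ge ha_infty).
(* The voter scale is [kap * a n]; this makes it at least 1. *)
have ak : kap^-1 <= a n by near: n; exact: (cvgry_ge ha_infty).
have nBc : (Bc.+1 < n)%N by near: n; exact: nbhs_infty_gt.
have nC : ((2 * C) ^ 9 < n)%N by near: n; exact: nbhs_infty_gt.
apply/andP; split; first by apply: expectation_ge0 => w.
have [q q_gt0 qn] := ninth_root n_gt0.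
have qC : (C < q)%N.
  have /andP[_ h2] := qn; rewrite ltnNge; apply/negP => qC.
  have := leq_trans nC h2; rewrite ltnNge => /negP; apply.
  by rewrite leq_exp2r// leq_mul2l qC.
have qB : (B < q)%N by apply: leq_ltn_trans qC; rewrite /C -addnA leq_addr.
have q2 : (2 < q)%N by apply: leq_ltn_trans qC; rewrite /C addnAC leq_addl.
have qk : 18 * kap <= q%:R.
  apply: (@le_trans _ _ (Num.bound (18 * kap))%:R).
    by apply/ltW/archi_boundP; rewrite mulr_ge0// ltW.
  by rewrite ler_nat; apply: leq_trans (ltnW qC); rewrite leq_addl.
have Bn : (2 * B + 2 * q ^ 5 < n)%N.
  have /andP[qn9 _] := qn; apply: leq_trans qn9.
  have q5 : (q <= q ^ 5)%N by rewrite expnS leq_pmulr// expn_gt0 q_gt0.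
  have q4 : (16 <= q ^ 4)%N by rewrite (@leq_exp2r 2 q 4)// ltnW.
  have -> : (q ^ 9 = q ^ 5 * q ^ 4)%N by rewrite -expnD.
  move: (q ^ 5)%N (q ^ 4)%N q5 q4 qB => x y; clear -q_gt0; nia.
have aln := ha_log n n_gt1.
have y0 : 0 <= ln n%:R :> R by rewrite ln_ge0// ler1n.
have scale_ge1 : 1 <= voter_scale d rho c0 (a n).
  by rewrite kapE -(divff (lt0r_neq0 kap_gt0)) ler_pM2l.
(* [a <= a^2 <= ln n <= 18 q], so [kap * a <= 18 kap q <= q^2]. *)
have scale_le : voter_scale d rho c0 (a n) <= q%:R ^+ 8.
  have a18 : a n <= 18 * q%:R.
    apply: (le_trans _ (ln_root_linear R q_gt0 qn)).
    apply: (@le_trans _ _ (a n ^+ 2)); first by rewrite expr2 ler_peMl//; lra.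
    rewrite -(sqr_sqrtr y0) lerXn2r ?nnegrE ?sqrtr_ge0//; lra.
  have Q1 : 1 <= q%:R :> R by rewrite ler1n.
  rewrite kapE; apply: (@le_trans _ _ (q%:R ^+ 2)); last by rewrite ler_weXn2l.
  apply: (@le_trans _ _ (kap * (18 * q%:R))); first by rewrite ler_pM2l.
  rewrite mulrA [kap * 18]mulrC expr2; apply: ler_wpM2r => //.
have fB (s : cyl_supp f) j : (`|val s 0%R j| <= B)%N.
  by apply: leqW; apply: coord_boundP; exact: valP.
have c_small j z k : z \in cyl_supp (c j) -> (`|z 0%R k|.+1 < n)%N.
  move=> zc; apply: leq_ltn_trans nBc; rewrite ltnS; apply: (leq_trans (coord_boundP k zc)).
  exact: (leq_bigmax (F := fun j => coord_bound (cyl_supp (c j)))).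
have mu_pmf := hmu n n3.
have G_right (x : torus d n) s : 0 <= s -> G r (macro R x) @[r --> s^'+] --> G s (macro R x).
  exact: C01_right_continuous.
have G_bnd (x : torus d n) s : 0 <= s <= 2 * t -> `|G s (macro R x)| <= MG by exact: G_bounded.
apply: (le_trans (fixed_size_bound hrho hd q_gt0 qn n_gt1 hc0 a1 t_gt0 MG_gt0 hc hc_0 hc_e c_small
  (ltn0Sn _) Bn fB scale_ge1 scale_le mu_pmf (heta n n3) G_right G_bnd)).
rewrite lee_fin; apply: path_cst_limit_le => //.
have [mu0 mu1] := mu_pmf.
apply: (le_trans (rel_entropy_half (bernoulli_prod_gt0 hrho) mu0 mu1 (sum_bernoulli_prod _ _))).
by rewrite ler_pM2r// hmu_entropy.
Unshelve. all: by end_near.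
Qed.
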